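(* Let $z,z'$ be complex parameters satisfying the standing assumption of the context. For $0<\xi<1$ let $K_{++},K_{+-},K_{-+},K_{--}$ be the blocks of the hypergeometric kernel with parameters $z,z',\xi$, and let $\mathcal K_{++},\mathcal K_{+-},\mathcal K_{-+},\mathcal K_{--}$ be the blocks of the Whittaker kernel with parameters $z,z'$ (both defined in the context). Then for all real $u,v>0$ $$\lim_{\xi\nearrow1}\frac1{1-\xi}\,K_{**}\!\left(\left[\frac u{1-\xi}\right],\left[\frac v{1-\xi}\right]\right)=\mathcal K_{**}(u,v),$$ where the subscript $**$ stands for any of the four symbols $++$, $+-$, $-+$, $--$, and $[\cdot]$ denotes the integer part.
   Context: $\mathbb Z_+=\{0,1,2,\dots\}$; $(a)_k=a(a+1)\cdots(a+k-1)$, $(a)_0=1$. Standing assumption on $z,z'$: $(z)_k(z')_k$ and $(-z)_k(-z')_k$ are real and strictly positive for all $k=1,2,\dots$. Equivalently, either $z'=\bar z$ and $z\in\mathbb C\setminus\mathbb Z$, or $z,z'\in\mathbb R$ and there is $m\in\mathbb Z$ with $m<z,z'<m+1$. Put $t=zz'>0$. $F(a,b;c;w)$ is the Gauss hypergeometric function ${}_2F_1$, analytically continued in $w$ to $\mathbb C\setminus[1,\infty)$. Hypergeometric kernel. Define $$\psi_\pm(u)=t^{1/2}\,\xi^{u+1/2}\,(1-\xi)^{\pm(z+z')}\,\frac{\Gamma(u+1\pm z)\Gamma(u+1\pm z')}{\Gamma(1\pm z)\Gamma(1\pm z')\Gamma(u+1)\Gamma(u+1)},$$ which satisfies $\psi_\pm(k)=t^{1/2}\xi^{k+1/2}(1-\xi)^{\pm(z+z')}\frac{(1\pm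 z)_k(1\pm z')_k}{k!\,k!}>0$ for $k\in\mathbb Z_+$, and $$P_\pm(u)=\psi_\pm(u)^{1/2}F\!\left(\mp z,\mp z';u+1;\tfrac{\xi}{\xi-1}\right),\qquad Q_\pm(u)=\frac{t^{1/2}\xi^{1/2}\psi_\pm(u)^{1/2}}{1-\xi}\,\frac{F\!\left(1\mp z,1\mp z';u+2;\tfrac{\xi}{\xi-1}\right)}{u+1}$$ (positive square roots; used at points of $\mathbb Z_+$ and in small real neighbourhoods of them, where $\psi_\pm>0$). For $k,l\in\mathbb Z_+$, $$K_{++}(k,l)=\frac{P_+(k)Q_+(l)-Q_+(k)P_+(l)}{k-l},\qquad K_{+-}(k,l)=\frac{P_+(k)P_-(l)+Q_+(k)Q_-(l)}{k+l+1},$$ $$K_{-+}(k,l)=-\frac{P_-(k)P_+(l)+Q_-(k)Q_+(l)}{k+l+1},\qquad K_{--}(k,l)=\frac{P_-(k)Q_-(l)-Q_-(k)P_-(l)}{k-l},$$ with $K_{\pm\pm}(k,k)=P_\pm'(k)Q_\pm(k)-Q_\pm'(k)P_\pm(k)$ (L'Hospital rule). Whittaker kernel. $W_{\kappa,\mu}(x)$, $x>0$, is the classical Whittaker function: the unique solution of $y''-\left(\frac14-\frac\kappa x+\frac{\mu^2-\frac14}{x^2}\right)y=0$ with $y\sim x^\kappa e^{-x/2}$ as $x\to+\infty$. For $x>0$ set $$\mathcal P_\pm(x)=\frac{(zz')^{1/4}}{(\Gamma(1\pm z)\Gamma(1\pm z')\,x)^{1/2}}\,W_{\frac{\pm(z+z')+1}2,\frac{z-z'}2}(x),$$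 $$\mathcal Q_\pm(x)=\frac{(zz')^{3/4}}{(\Gamma(1\pm z)\Gamma(1\pm z')\,x)^{1/2}}\,W_{\frac{\pm(z+z')-1}2,\frac{z-z'}2}(x)$$ (the products $\Gamma(1\pm z)\Gamma(1\pm z')$ are positive). For $x,y>0$, $$\mathcal K_{++}(x,y)=\frac{\mathcal P_+(x)\mathcal Q_+(y)-\mathcal Q_+(x)\mathcal P_+(y)}{x-y},\qquad \mathcal K_{+-}(x,y)=\frac{\mathcal P_+(x)\mathcal P_-(y)+\mathcal Q_+(x)\mathcal Q_-(y)}{x+y},$$ $$\mathcal K_{-+}(x,y)=-\frac{\mathcal P_-(x)\mathcal P_+(y)+\mathcal Q_-(x)\mathcal Q_+(y)}{x+y},\qquad \mathcal K_{--}(x,y)=\frac{\mathcal P_-(x)\mathcal Q_-(y)-\mathcal Q_-(x)\mathcal P_-(y)}{x-y},$$ with the values of $\mathcal K_{++},\mathcal K_{--}$ at $x=y$ given by the L'Hospital rule, $\mathcal K_{\pm\pm}(x,x)=\mathcal P_\pm'(x)\mathcal Q_\pm(x)-\mathcal Q_\pm'(x)\mathcal P_\pm(x)$. *)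

(* Defs.v *)
From Stdlib Require Import Reals ZArith ClassicalEpsilon.
From Coquelicot Require Import Coquelicot.

Open Scope R_scope.

(** ** Complex preliminaries *)

Definition Cexp (a : C) : C := (exp (Re a) * cos (Im a), exp (Re a) * sin (Im a)).

(** [x ^ a] for a real [x > 0] and a complex exponent. *)
Definition Rcpow (x : R) (a : C) : C := Cexp (a * RtoC (ln x))%C.

Fixpoint poch (a : C) (k : nat) : C :=
  match k with
  | O => RtoC 1
  | S k' => (poch a k' * (a + RtoC (INR k')))%C
  end.

Definition Clim_seq (f : nat -> C) : C :=
  (real (Lim_seq (fun n => Re (f n))), real (Lim_seq (fun n => Im (f n)))).

(** Derivative of a complex-valued function of a real variable. *)
Definition CDerive (f : R -> C) (x : R) : C :=
  (Derive (fun s => Re (f s)) x, Derive (fun s => Im (f s)) x).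

(** Euler's limit [n! n^a / (a (a+1) ... (a+n))]; meaningful when [a] is not
    one of [0, -1, -2, ...]. *)
Definition Gamma (a : C) : C :=
  Clim_seq (fun n =>
    (RtoC (INR (fact n)) * Rcpow (INR n) a / poch a (S n))%C).

(** ** The Gauss hypergeometric function *)

Definition analytic_at (f : C -> C) (w0 : C) : Prop :=
  exists (a : nat -> C) (r : R), 0 < r /\
    forall w : C, Cmod (w - w0)%C < r ->
      @is_pseries C_AbsRing C_NormedModule a (w - w0)%C (f w).

Definition slit_plane (w : C) : Prop := ~ (Im w = 0 /\ 1 <= Re w).

Definition gauss_coef (a b c : C) (n : nat) : C :=
  (poch a n * poch b n / (poch c n * RtoC (INR (fact n))))%C.

Definition is_hyp2F1 (a b c : C) (F : C -> C) : Prop :=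
  (forall w, slit_plane w -> analytic_at F w) /\
  (forall w, Cmod w < 1 ->
     @is_pseries C_AbsRing C_NormedModule (gauss_coef a b c) w (F w)).

(** The conditions determine the function on [slit_plane] (identity theorem);
    its values on the cut are arbitrary. *)
Definition hyp2F1 (a b c : C) : C -> C :=
  epsilon (inhabits (fun _ : C => RtoC 0)) (is_hyp2F1 a b c).

(** ** The Whittaker function *)

Definition is_whittaker (kappa mu : C) (y : R -> C) : Prop :=
  (exists y1 y2 : R -> C, forall x : R, 0 < x ->
     @is_derive R_AbsRing C_R_NormedModule y x (y1 x) /\
     @is_derive R_AbsRing C_R_NormedModule y1 x (y2 x) /\
     (y2 x - (RtoC (1 / 4) - kappa / RtoC x
              + (mu * mu - RtoC (1 / 4)) / RtoC (x ^ 2)) * y x = RtoC 0)%C) /\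
  filterlim (fun x : R => (y x / (Rcpow x kappa * RtoC (exp (- x / 2))))%C)
    (Rbar_locally p_infty) (locally (RtoC 1)).

(** The conditions determine the function on [x > 0]; elsewhere its values are
    arbitrary. *)
Definition whittakerW (kappa mu : C) : R -> C :=
  epsilon (inhabits (fun _ : R => RtoC 0)) (is_whittaker kappa mu).

(** ** The parameters *)

Definition real_positive (a : C) : Prop := Im a = 0 /\ 0 < Re a.

Definition admissible (z z' : C) : Prop :=
  forall k : nat, (1 <= k)%nat ->
    real_positive (poch z k * poch z' k)%C /\
    real_positive (poch (- z) k * poch (- z') k)%C.

Inductive pm : Set := Plus | Minus.

Definition signed (e : pm) (a : C) : C :=
  match e with Plus => a | Minus => (- a)%C end.

(** The product [z z'], [psi] below, and [Gamma (1 +- z) * Gamma (1 +- z')] are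
    real and positive for admissible [z, z'] (for [psi], at real points close to
    nonnegative integers); [Re] only transports them to [R], where real roots
    are taken. *)
Definition tpar (z z' : C) : R := Re (z * z')%C.

(** ** The hypergeometric kernel *)

Definition psi (z z' : C) (xi : R) (e : pm) (u : R) : C :=
  (RtoC (sqrt (tpar z z')) * RtoC (Rpower xi (u + 1 / 2))
   * Rcpow (1 - xi) (signed e (z + z'))
   * (Gamma (RtoC (u + 1) + signed e z) * Gamma (RtoC (u + 1) + signed e z')
      / (Gamma (RtoC 1 + signed e z) * Gamma (RtoC 1 + signed e z')
         * Gamma (RtoC (u + 1)) * Gamma (RtoC (u + 1)))))%C.

Definition sqrt_psi (z z' : C) (xi : R) (e : pm) (u : R) : R :=
  sqrt (Re (psi z z' xi e u)).

Definition hypP (z z' : C) (xi : R) (e : pm) (u : R) : C :=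
  (RtoC (sqrt_psi z z' xi e u)
   * hyp2F1 (- signed e z) (- signed e z') (RtoC (u + 1))
       (RtoC (xi / (xi - 1))))%C.

Definition hypQ (z z' : C) (xi : R) (e : pm) (u : R) : C :=
  (RtoC (sqrt (tpar z z') * sqrt xi * sqrt_psi z z' xi e u / (1 - xi))
   * (hyp2F1 (RtoC 1 - signed e z) (RtoC 1 - signed e z') (RtoC (u + 2))
        (RtoC (xi / (xi - 1)))
      / RtoC (u + 1)))%C.

Definition hyp_kernel (z z' : C) (xi : R) (e1 e2 : pm) (k l : nat) : C :=
  let P e := hypP z z' xi e in
  let Q e := hypQ z z' xi e in
  let x := INR k in
  let y := INR l in
  let same e :=
    if Nat.eq_dec k l then
      (CDerive (P e) x * Q e x - CDerive (Q e) x * P e x)%C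
    else ((P e x * Q e y - Q e x * P e y) / RtoC (x - y))%C in
  match e1, e2 with
  | Plus, Plus => same Plus
  | Plus, Minus =>
      ((P Plus x * P Minus y + Q Plus x * Q Minus y) / RtoC (x + y + 1))%C
  | Minus, Plus =>
      (- ((P Minus x * P Plus y + Q Minus x * Q Plus y) / RtoC (x + y + 1)))%C
  | Minus, Minus => same Minus
  end.

(** ** The Whittaker kernel *)

Definition whitP (z z' : C) (e : pm) (x : R) : C :=
  (RtoC (Rpower (tpar z z') (1 / 4)
         / sqrt (Re (Gamma (RtoC 1 + signed e z) * Gamma (RtoC 1 + signed e z'))
                 * x)%R)
   * whittakerW ((signed e (z + z') + RtoC 1) / RtoC 2) ((z - z') / RtoC 2) x)%C.

Definition whitQ (z z' : C) (e : pm) (x : R) : C :=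
  (RtoC (Rpower (tpar z z') (3 / 4)
         / sqrt (Re (Gamma (RtoC 1 + signed e z) * Gamma (RtoC 1 + signed e z'))
                 * x)%R)
   * whittakerW ((signed e (z + z') - RtoC 1) / RtoC 2) ((z - z') / RtoC 2) x)%C.

Definition whit_kernel (z z' : C) (e1 e2 : pm) (x y : R) : C :=
  let P e := whitP z z' e in
  let Q e := whitQ z z' e in
  let same e :=
    if Req_EM_T x y then
      (CDerive (P e) x * Q e x - CDerive (Q e) x * P e x)%C
    else ((P e x * Q e y - Q e x * P e y) / RtoC (x - y))%C in
  match e1, e2 with
  | Plus, Plus => same Plus
  | Plus, Minus =>
      ((P Plus x * P Minus y + Q Plus x * Q Minus y) / RtoC (x + y))%C
  | Minus, Plus =>
      (- ((P Minus x * P Plus y + Q Minus x * Q Plus y) / RtoC (x + y)))%C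
  | Minus, Minus => same Minus
  end.

(** Integer part of a nonnegative real. *)
Definition nat_part (x : R) : nat := Z.to_nat (Int_part x).

(* Main.v *)
(** Put [e = 1 - xi].  For [Re a > 1] and [c] large, Euler's integral represents
    [F(a, b; c; w)] at [c = x / e], [w = 1 - 1 / e]; substituting [y = 1 - exp (- e t)] turns it
    into a quotient of Laplace-type integrals whose integrands have the limits
    [t^(a - 1) (1 + t)^(-b) exp (- x t)] as [e] tends to [0], so dominated convergence gives
    the limit of [F] and of its [x]-derivative, locally uniformly in [x].  Gauss' contiguous
    relation carries this to every [a].  The limit satisfies a second-order equation and tends
    to [1] at infinity, so after multiplication by [x^kappa exp (- x / 2)] it is the Whittaker
    function.  The weights [psi] are handled by Gauss' limit for [Gamma]; on the diagonal the
    common factor [sqrt psi] cancels in the Wronskian.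

    The Euler representation itself is obtained, for integer [m > Re b], from the double
    integral of [(1 - w x y)^(-m)] against beta densities, which is analytic on the slit plane
    by expanding under the integral; its inner integral equals a multiple of
    [(1 - w x)^(-b)] because both solve the same linear differential equation. *)
Require Import Defs.
From Stdlib Require Import Reals ZArith Lra Lia Classical FunctionalExtensionality ClassicalEpsilon.
From Coquelicot Require Import Coquelicot.
Open Scope R_scope.

(** * Complex limits and derivatives *)

(** [hyp2F1] and [whittakerW] are chosen by [epsilon], so each needs both existence and uniqueness.
    For [hyp2F1], existence means an analytic function on the whole slit plane, while uniqueness is
    wanted on the negative half-line, where the kernel evaluates it: xi / (xi - 1) = 1 - 1 / e < 0.
    The third parameter is k + 1 or k + 2, of size u / e, so results about F may assume it real and
    large. Numerator and denominator of Euler's formula are one and the same integral [kern], with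
    exponent b and with exponent 0; their quotient removes the Gamma factors of c. The condition Re
    a > 1, rather than the convergence condition Re a > 0, keeps all integrands continuous at 0, so
    Riemann integrals with an exponential bound suffice. As the parameters -z and 1 - z lie
    anywhere, recursions of step 1 lead out of this half-plane, for [Gamma], for Euler's integral in
    b and for the limits in a. Besides nonvanishing, the standing assumption provides that z + z'
    and z z' are real: this makes kappa real, which uniqueness of the Whittaker function uses, and
    lets the weight psi be real and positive. *)

(** Convergence in modulus along an arbitrary filter. [ctends_filterlim] and [filterlim_ctends]
    identify it with convergence for the uniform structure on C that the theorem uses; the filter is
    left free because sequences, one-sided limits, limits at infinity and product filters all
    occur. *)
Definition ctends {I : Type} (F : (I -> Prop) -> Prop) (f : I -> C) (l : C) : Prop :=
  forall eps : R, 0 < eps -> F (fun i => Cmod (f i - l)%C < eps).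

Definition ccont (f : R -> C) (x : R) : Prop := ctends (locally x) f (f x).

(** Componentwise, to match [CDerive]; [is_derive_cder] relates it to the derivative used in
    [is_whittaker]. *)
Definition cder (f : R -> C) (x : R) (l : C) : Prop :=
  is_derive (fun t => Re (f t)) x (Re l) /\ is_derive (fun t => Im (f t)) x (Im l).

Lemma Ceq (a b : C) : Re a = Re b -> Im a = Im b -> a = b.
Proof. destruct a, b; simpl; intros; subst; reflexivity. Qed.

Lemma Re_minus (a b : C) : Re (a - b)%C = Re a - Re b. Proof. reflexivity. Qed.

Lemma RtoC_neq_0 (x : R) : x <> 0 -> RtoC x <> 0%C.
Proof. intros H E. apply H, RtoC_inj, E. Qed.

Lemma im_le_Cmod (c : C) : Rabs (Im c) <= Cmod c.
Proof. eapply Rle_trans; [apply Rmax_r | apply Rmax_Cmod]. Qed.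

Lemma Cmod_le_re_im (c : C) : Cmod c <= Rabs (Re c) + Rabs (Im c).
Proof.
  replace c with (RtoC (Re c) + Ci * RtoC (Im c))%C at 1
    by (apply Ceq; simpl; ring).
  eapply Rle_trans; [apply Cmod_triangle|].
  rewrite Cmod_mult, !Cmod_R, Cmod_Ci. lra.
Qed.

Lemma Cmod_sub_sym (a b : C) : Cmod (a - b)%C = Cmod (b - a)%C.
Proof. rewrite <- Cmod_opp. f_equal. ring. Qed.

Lemma Cmod_tri_sub (a b c : C) : Cmod (a - c)%C <= Cmod (a - b)%C + Cmod (b - c)%C.
Proof. replace (a - c)%C with ((a - b) + (b - c))%C by ring. apply Cmod_triangle. Qed.

Lemma Cmod_ge_sub (a b : C) : Cmod b - Cmod (a - b)%C <= Cmod a.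
Proof.
  assert (H := Cmod_triangle a (b - a)%C). replace (a + (b - a))%C with b in H by ring.
  rewrite (Cmod_sub_sym a b). lra.
Qed.

Section Ctends.
Context {I : Type} {F : (I -> Prop) -> Prop} {FF : Filter F}.

Lemma ctends_re (f : I -> C) (l : C) :
  ctends F f l -> filterlim (fun i => Re (f i)) F (locally (Re l)).
Proof.
  intros H. apply filterlim_locally. intros e.
  generalize (H e (cond_pos e)). apply filter_imp. intros i Hi.
  change (Rabs (Re (f i) - Re l) < e). eapply Rle_lt_trans; [|apply Hi].
  apply (re_le_Cmod (f i - l)%C).
Qed.

Lemma ctends_im (f : I -> C) (l : C) :
  ctends F f l -> filterlim (fun i => Im (f i)) F (locally (Im l)).
Proof.
  intros H. apply filterlim_locally. intros e.
  generalize (H e (cond_pos e)). apply filter_imp. intros i Hi.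
  change (Rabs (Im (f i) - Im l) < e). eapply Rle_lt_trans; [|apply Hi].
  apply (im_le_Cmod (f i - l)%C).
Qed.

Lemma ctends_re_im (f : I -> C) (l : C) :
  filterlim (fun i => Re (f i)) F (locally (Re l)) ->
  filterlim (fun i => Im (f i)) F (locally (Im l)) -> ctends F f l.
Proof.
  intros H1 H2 e He.
  assert (He2 : 0 < e / 2) by lra.
  generalize (filter_and _ _ (proj1 (filterlim_locally _ _) H1 (mkposreal _ He2))
                             (proj1 (filterlim_locally _ _) H2 (mkposreal _ He2))).
  apply filter_imp. intros i [Hi Hj].
  change (Rabs (Re (f i) - Re l) < e / 2) in Hi.
  change (Rabs (Im (f i) - Im l) < e / 2) in Hj.
  eapply Rle_lt_trans; [apply Cmod_le_re_im|].
  change (Rabs (Re (f i) - Re l) + Rabs (Im (f i) - Im l) < e). lra.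
Qed.

Lemma ctends_filterlim (f : I -> C) (l : C) :
  ctends F f l -> filterlim f F (locally l).
Proof.
  intros H. apply filterlim_locally. intros e.
  generalize (H e (cond_pos e)). apply filter_imp. intros i Hi.
  apply C_NormedModule_mixin_compat1. exact Hi.
Qed.

Lemma filterlim_ctends (f : I -> C) (l : C) :
  filterlim f F (locally l) -> ctends F f l.
Proof.
  intros H. apply ctends_re_im; apply filterlim_locally; intros e;
  generalize (proj1 (filterlim_locally f l) H e); apply filter_imp; intros i Hi; apply Hi.
Qed.

Lemma ctends_ext_loc (f g : I -> C) (l : C) :
  F (fun i => f i = g i) -> ctends F f l -> ctends F g l.
Proof.
  intros H1 H2 e He. generalize (filter_and _ _ H1 (H2 e He)). apply filter_imp.
  intros i [E Hi]. rewrite <- E. exact Hi.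
Qed.

Lemma ctends_ext (f g : I -> C) (l : C) :
  (forall i, f i = g i) -> ctends F f l -> ctends F g l.
Proof. intros H. apply ctends_ext_loc. apply filter_forall. exact H. Qed.

Lemma ctends_const (l : C) : ctends F (fun _ => l) l.
Proof.
  intros e He. apply filter_forall. intros _. replace (l - l)%C with (RtoC 0) by ring.
  rewrite Cmod_0. exact He.
Qed.

Lemma ctends_plus (f g : I -> C) (l m : C) :
  ctends F f l -> ctends F g m -> ctends F (fun i => (f i + g i)%C) (l + m)%C.
Proof.
  intros H1 H2 e He. assert (He2 : 0 < e / 2) by lra.
  generalize (filter_and _ _ (H1 _ He2) (H2 _ He2)). apply filter_imp.
  intros i [A B]. replace (f i + g i - (l + m))%C with ((f i - l) + (g i - m))%C by ring.
  eapply Rle_lt_trans; [apply Cmod_triangle|]. lra.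
Qed.

Lemma ctends_opp (f : I -> C) (l : C) :
  ctends F f l -> ctends F (fun i => (- f i)%C) (- l)%C.
Proof.
  intros H e He. generalize (H e He). apply filter_imp. intros i Hi.
  replace (- f i - - l)%C with (- (f i - l))%C by ring. rewrite Cmod_opp. exact Hi.
Qed.

Lemma ctends_minus (f g : I -> C) (l m : C) :
  ctends F f l -> ctends F g m -> ctends F (fun i => (f i - g i)%C) (l - m)%C.
Proof. intros H1 H2. apply ctends_plus; [exact H1 | apply ctends_opp, H2]. Qed.

Lemma ctends_mult (f g : I -> C) (l m : C) :
  ctends F f l -> ctends F g m -> ctends F (fun i => (f i * g i)%C) (l * m)%C.
Proof.
  intros H1 H2 e He.
  pose (K := Cmod l + Cmod m + 1).
  assert (HK : 0 < K) by (unfold K; generalize (Cmod_ge_0 l) (Cmod_ge_0 m); lra).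
  pose (d := Rmin 1 (e / (2 * K))).
  assert (Hq : 0 < e / (2 * K)) by (apply Rdiv_lt_0_compat; lra).
  assert (Hd : 0 < d) by (apply Rmin_pos; lra).
  generalize (filter_and _ _ (H1 _ Hd) (H2 _ Hd)). apply filter_imp.
  intros i [A B].
  replace (f i * g i - l * m)%C with ((f i - l) * (g i - m) + (f i - l) * m + l * (g i - m))%C by ring.
  assert (d1 : d <= 1) by apply Rmin_l. assert (d2 : d <= e / (2 * K)) by apply Rmin_r.
  assert (d3 : d * K <= e / 2).
  { apply Rle_trans with (e / (2 * K) * K); [apply Rmult_le_compat_r; lra|].
    right. field. lra. }
  eapply Rle_lt_trans; [apply Cmod_triangle|].
  eapply Rle_lt_trans; [apply Rplus_le_compat_r, Cmod_triangle|].
  rewrite !Cmod_mult.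
  assert (a0 := Cmod_ge_0 (f i - l)%C). assert (b0 := Cmod_ge_0 (g i - m)%C).
  assert (l0 := Cmod_ge_0 l). assert (m0 := Cmod_ge_0 m).
  unfold K in d3. nra.
Qed.

Lemma ctends_ne0 (f : I -> C) (l : C) :
  l <> 0%C -> ctends F f l -> F (fun i => f i <> 0%C).
Proof.
  intros Hl H. apply Cmod_gt_0 in Hl. generalize (H _ Hl). apply filter_imp.
  intros i Hi E. rewrite E in Hi. replace (0 - l)%C with (- l)%C in Hi by ring.
  rewrite Cmod_opp in Hi. lra.
Qed.

Lemma ctends_inv (f : I -> C) (l : C) :
  l <> 0%C -> ctends F f l -> ctends F (fun i => (/ f i)%C) (/ l)%C.
Proof.
  intros Hl H e He. assert (Hl' := proj1 (Cmod_gt_0 l) Hl).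
  pose (d := Rmin (Cmod l / 2) (e * Cmod l * Cmod l / 2)).
  assert (Hd : 0 < d) by (apply Rmin_pos; [lra|]; assert (0 < e * Cmod l) by nra; nra).
  generalize (filter_and _ _ (H _ Hd) (ctends_ne0 _ _ Hl H)). apply filter_imp.
  intros i [A B].
  assert (d1 : d <= Cmod l / 2) by apply Rmin_l.
  assert (d2 : d <= e * Cmod l * Cmod l / 2) by apply Rmin_r.
  replace (/ f i - / l)%C with (- ((f i - l) / (f i * l)))%C by (field; auto).
  rewrite Cmod_opp, Cmod_div, Cmod_mult by (apply Cmult_neq_0; auto).
  assert (G := Cmod_ge_sub (f i) l).
  apply Rlt_div_l; [nra|].
  apply Rlt_le_trans with d; [exact A|].
  apply Rle_trans with (e * (Cmod l / 2 * Cmod l)); [lra|].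
  apply Rmult_le_compat_l; [lra|]. apply Rmult_le_compat_r; lra.
Qed.

Lemma ctends_div (f g : I -> C) (l m : C) :
  m <> 0%C -> ctends F f l -> ctends F g m -> ctends F (fun i => (f i / g i)%C) (l / m)%C.
Proof. intros Hm H1 H2. apply ctends_mult; [exact H1 | apply ctends_inv; auto]. Qed.

Lemma ctends_RtoC (f : I -> R) (l : R) :
  filterlim f F (locally l) -> ctends F (fun i => RtoC (f i)) (RtoC l).
Proof.
  intros H e He. generalize (proj1 (filterlim_locally _ _) H (mkposreal _ He)).
  apply filter_imp. intros i Hi. rewrite <- RtoC_minus, Cmod_R. exact Hi.
Qed.

Lemma ctends_Cmod (f : I -> C) (l : C) :
  ctends F f l -> filterlim (fun i => Cmod (f i)) F (locally (Cmod l)).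
Proof.
  intros H. apply filterlim_locally. intros e. generalize (H e (cond_pos e)).
  apply filter_imp. intros i Hi. change (Rabs (Cmod (f i) - Cmod l) < e).
  assert (A := Cmod_ge_sub (f i) l). assert (B := Cmod_ge_sub l (f i)).
  rewrite (Cmod_sub_sym l) in B. apply Rabs_def1; lra.
Qed.

Lemma ctends_Cexp (f : I -> C) (l : C) :
  ctends F f l -> ctends F (fun i => Cexp (f i)) (Cexp l).
Proof.
  intros H. assert (A := ctends_re _ _ H). assert (B := ctends_im _ _ H).
  apply ctends_re_im; simpl.
  - apply (filterlim_comp_2 _ _ Rmult (filterlim_comp _ _ _ _ exp _ _ _ A (continuous_exp _))
            (filterlim_comp _ _ _ _ cos _ _ _ B (continuous_cos _))).
    apply (filterlim_Rbar_mult (Finite _) (Finite _) (Finite _)). reflexivity.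
  - apply (filterlim_comp_2 _ _ Rmult (filterlim_comp _ _ _ _ exp _ _ _ A (continuous_exp _))
            (filterlim_comp _ _ _ _ sin _ _ _ B (continuous_sin _))).
    apply (filterlim_Rbar_mult (Finite _) (Finite _) (Finite _)). reflexivity.
Qed.

Lemma ctends_Rcpow (f : I -> R) (l : R) (a : C) :
  0 < l -> filterlim f F (locally l) -> ctends F (fun i => Rcpow (f i) a) (Rcpow l a).
Proof.
  intros Hl H. apply ctends_Cexp. apply ctends_mult; [apply ctends_const|].
  apply ctends_RtoC. apply (filterlim_comp _ _ _ f ln _ _ _ H). apply continuous_ln. exact Hl.
Qed.
End Ctends.

Lemma ctends_comp {I J : Type} {F : (I -> Prop) -> Prop} {G : (J -> Prop) -> Prop}
  (f : J -> C) (g : I -> J) (l : C) :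
  filterlim g F G -> ctends G f l -> ctends F (fun i => f (g i)) l.
Proof. intros H1 H2 e He. exact (H1 _ (H2 e He)). Qed.

Lemma ctends_unique {I : Type} {F : (I -> Prop) -> Prop} {FF : ProperFilter F}
  (f : I -> C) (l m : C) : ctends F f l -> ctends F f m -> l = m.
Proof.
  intros H1 H2. apply Ceq.
  - exact (filterlim_locally_unique _ _ _ (ctends_re _ _ H1) (ctends_re _ _ H2)).
  - exact (filterlim_locally_unique _ _ _ (ctends_im _ _ H1) (ctends_im _ _ H2)).
Qed.

Lemma is_derive_eq (f : R -> R) (x l m : R) : is_derive f x l -> l = m -> is_derive f x m.
Proof. intros H <-. exact H. Qed.

Lemma cder_unique (f : R -> C) (x : R) (l m : C) : cder f x l -> cder f x m -> l = m.
Proof.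
  intros [A B] [A' B']. apply Ceq.
  - rewrite <- (is_derive_unique _ _ _ A). apply is_derive_unique, A'.
  - rewrite <- (is_derive_unique _ _ _ B). apply is_derive_unique, B'.
Qed.

Lemma cder_ext_loc (f g : R -> C) (x : R) (l : C) :
  locally x (fun t => f t = g t) -> cder f x l -> cder g x l.
Proof.
  intros H [A B]. split; (eapply is_derive_ext_loc; [|eassumption]);
  generalize H; apply filter_imp; intros t E; rewrite E; reflexivity.
Qed.

Lemma cder_ext (f g : R -> C) (x : R) (l : C) :
  (forall t, f t = g t) -> cder f x l -> cder g x l.
Proof. intros H. apply cder_ext_loc. apply filter_forall. exact H. Qed.

Lemma cder_eq (f : R -> C) (x : R) (l m : C) : l = m -> cder f x l -> cder f x m.
Proof. intros ->. auto. Qed.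

Lemma cder_const (c : C) (x : R) : cder (fun _ => c) x 0%C.
Proof. split; apply is_derive_Reals, derivable_pt_lim_const. Qed.

Lemma cder_plus (f g : R -> C) (x : R) (l m : C) :
  cder f x l -> cder g x m -> cder (fun t => (f t + g t)%C) x (l + m)%C.
Proof. intros [A B] [A' B']. split; simpl;
  [apply (is_derive_plus (K := R_AbsRing) _ _ _ _ _ A A') | apply (is_derive_plus (K := R_AbsRing) _ _ _ _ _ B B')]. Qed.

Lemma cder_opp (f : R -> C) (x : R) (l : C) :
  cder f x l -> cder (fun t => (- f t)%C) x (- l)%C.
Proof. intros [A B]. split; simpl;
  [apply (is_derive_opp (K := R_AbsRing) _ _ _ A) | apply (is_derive_opp (K := R_AbsRing) _ _ _ B)]. Qed.

Lemma cder_minus (f g : R -> C) (x : R) (l m : C) :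
  cder f x l -> cder g x m -> cder (fun t => (f t - g t)%C) x (l - m)%C.
Proof. intros H1 H2. apply cder_plus; [exact H1 | apply cder_opp, H2]. Qed.

Lemma is_derive_mult_R (f g : R -> R) (x l m : R) :
  is_derive f x l -> is_derive g x m ->
  is_derive (fun t => f t * g t) x (l * g x + f x * m).
Proof. intros A B. apply (is_derive_mult (K := R_AbsRing)); auto. intros; apply Rmult_comm. Qed.

Lemma cder_mult (f g : R -> C) (x : R) (l m : C) :
  cder f x l -> cder g x m -> cder (fun t => (f t * g t)%C) x (l * g x + f x * m)%C.
Proof.
  intros [A B] [A' B']. split; simpl.
  - eapply is_derive_ext; [|eapply is_derive_eq;
      [apply (is_derive_minus (K := R_AbsRing) (fun t => Re (f t) * Re (g t)) (fun t => Im (f t) * Im (g t)));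
         apply is_derive_mult_R; eassumption|]].
    + intros t. reflexivity.
    + unfold minus, plus, opp; simpl. unfold Re, Im. ring.
  - eapply is_derive_ext; [|eapply is_derive_eq;
      [apply (is_derive_plus (K := R_AbsRing) (fun t => Re (f t) * Im (g t)) (fun t => Im (f t) * Re (g t)));
         apply is_derive_mult_R; eassumption|]].
    + intros t. reflexivity.
    + unfold minus, plus, opp; simpl. unfold Re, Im. ring.
Qed.

Lemma cder_RtoC (f : R -> R) (x l : R) :
  is_derive f x l -> cder (fun t => RtoC (f t)) x (RtoC l).
Proof. intros H. split; simpl; [exact H | apply is_derive_Reals, derivable_pt_lim_const]. Qed.

Lemma cder_inv (f : R -> C) (x : R) (l : C) :
  f x <> 0%C -> cder f x l -> cder (fun t => (/ f t)%C) x (- l / (f x * f x))%C.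
Proof.
  intros H0 [A B].
  assert (Hn : Re (f x) ^ 2 + Im (f x) ^ 2 <> 0).
  { rewrite <- Cmod2_alt. apply pow_nonzero. apply Rgt_not_eq, Cmod_gt_0, H0. }
  assert (N : is_derive (fun t => Re (f t) ^ 2 + Im (f t) ^ 2) x
                (2 * Re (f x) * Re l + 2 * Im (f x) * Im l)).
  { eapply is_derive_eq.
    - apply is_derive_Reals, derivable_pt_lim_plus; apply is_derive_Reals;
      apply is_derive_pow; [exact A | exact B].
    - simpl. ring. }
  split.
  - eapply is_derive_eq; [apply (is_derive_div (fun t => Re (f t)) _ x _ _ A N Hn)|].
    simpl. unfold Re, Im in *. simpl in *. field.
    split; intros E; apply Hn;
      first [rewrite <- E; ring | apply Rsqr_0_uniq; unfold Rsqr; rewrite <- E; ring].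
  - eapply is_derive_eq; [apply (is_derive_div (fun t => - Im (f t)) _ x _ _
      (is_derive_opp (K := R_AbsRing) _ _ _ B) N Hn)|].
    simpl. unfold opp; simpl. unfold Re, Im in *. simpl in *. field.
    split; intros E; apply Hn;
      first [rewrite <- E; ring | apply Rsqr_0_uniq; unfold Rsqr; rewrite <- E; ring].
Qed.

Lemma cder_div (f g : R -> C) (x : R) (l m : C) :
  g x <> 0%C -> cder f x l -> cder g x m ->
  cder (fun t => (f t / g t)%C) x ((l * g x - f x * m) / (g x * g x))%C.
Proof.
  intros H0 A B. eapply cder_eq; [|apply (cder_mult _ _ _ _ _ A (cder_inv _ _ _ H0 B))].
  field. exact H0.
Qed.

Lemma cder_Cexp (f : R -> C) (x : R) (l : C) :
  cder f x l -> cder (fun t => Cexp (f t)) x (l * Cexp (f x))%C.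
Proof.
  intros [A B].
  assert (E := is_derive_comp (K := R_AbsRing) exp _ _ _ _ (is_derive_exp _) A).
  assert (Cc := is_derive_comp (K := R_AbsRing) cos _ _ _ _ (is_derive_cos _) B).
  assert (S := is_derive_comp (K := R_AbsRing) sin _ _ _ _ (is_derive_sin _) B).
  split; simpl.
  - eapply is_derive_eq; [apply is_derive_mult_R; eassumption|].
    unfold scal; simpl; unfold mult; simpl. unfold Re, Im. ring.
  - eapply is_derive_eq; [apply is_derive_mult_R; eassumption|].
    unfold scal; simpl; unfold mult; simpl. unfold Re, Im. ring.
Qed.

Lemma cder_comp (f : R -> C) (g : R -> R) (x : R) (l : C) (m : R) :
  cder f (g x) l -> is_derive g x m -> cder (fun t => f (g t)) x (RtoC m * l)%C.
Proof.
  intros [A B] H. split.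
  - eapply is_derive_eq; [apply (is_derive_comp (K := R_AbsRing) (fun t => Re (f t)) g); eassumption|].
    unfold scal; simpl; unfold mult; simpl. unfold Re, Im. ring.
  - eapply is_derive_eq; [apply (is_derive_comp (K := R_AbsRing) (fun t => Im (f t)) g); eassumption|].
    unfold scal; simpl; unfold mult; simpl. unfold Re, Im. ring.
Qed.

Lemma cder_Rcpow (a : C) (x : R) :
  0 < x -> cder (fun t => Rcpow t a) x (a / RtoC x * Rcpow x a)%C.
Proof.
  intros Hx. eapply cder_eq; [|apply (cder_Cexp (fun t => (a * RtoC (ln t))%C) x (a * RtoC (/ x))%C)].
  - rewrite RtoC_inv by lra. reflexivity.
  - eapply cder_eq; [|apply cder_mult; [apply cder_const | apply cder_RtoC; apply is_derive_ln; exact Hx]].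
    cbv beta; ring.
Qed.

Lemma cder_CDerive (f : R -> C) (x : R) (l : C) : cder f x l -> CDerive f x = l.
Proof.
  intros [A B]. unfold CDerive. apply Ceq; simpl; apply is_derive_unique; assumption.
Qed.

Lemma cder_0_const (f : R -> C) (a x : R) : a <= x -> (forall t, a <= t -> cder f t 0%C) -> f x = f a.
Proof.
  intros [Hs| <-] H; [|reflexivity]. symmetry. apply Ceq.
  - apply (eq_is_derive (fun t => Re (f t)) a x); [|exact Hs]. intros t Ht. apply H. lra.
  - apply (eq_is_derive (fun t => Im (f t)) a x); [|exact Hs]. intros t Ht. apply H. lra.
Qed.

Lemma ctends_cder (f : R -> C) (x : R) (l : C) :
  ctends (locally' 0) (fun h => ((f (x + h)%R - f x) / RtoC h)%C) l -> cder f x l.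
Proof.
  intros H. split; apply is_derive_Reals; intros e He;
  destruct (H e He) as [d Hd]; exists d; intros h Hh0 Hh.
  - assert (D : Cmod ((f (x + h)%R - f x) / RtoC h - l)%C < e).
    { apply Hd; [|exact Hh0]. change (Rabs (h - 0) < d). rewrite Rminus_0_r. exact Hh. }
    eapply Rle_lt_trans; [|apply D]. eapply Rle_trans; [|apply re_le_Cmod].
    right. f_equal. simpl. unfold Re, Im; simpl. field. exact Hh0.
  - assert (D : Cmod ((f (x + h)%R - f x) / RtoC h - l)%C < e).
    { apply Hd; [|exact Hh0]. change (Rabs (h - 0) < d). rewrite Rminus_0_r. exact Hh. }
    eapply Rle_lt_trans; [|apply D]. eapply Rle_trans; [|apply im_le_Cmod].
    right. f_equal. simpl. unfold Re, Im; simpl. field. exact Hh0.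
Qed.

(** * The complex exponential and complex powers of a positive base *)

Lemma Cexp_plus (a b : C) : Cexp (a + b)%C = (Cexp a * Cexp b)%C.
Proof.
  unfold Cexp. apply Ceq; simpl; unfold Re, Im; simpl;
  rewrite exp_plus, ?cos_plus, ?sin_plus; ring.
Qed.

Lemma Cexp_0 : Cexp 0%C = 1%C.
Proof. unfold Cexp; apply Ceq; simpl; rewrite exp_0, ?cos_0, ?sin_0; ring. Qed.

Lemma Cmod_Cexp (a : C) : Cmod (Cexp a) = exp (Re a).
Proof.
  unfold Cexp, Cmod; simpl.
  replace (_ + _) with (exp (Re a) ^ 2 * (Rsqr (sin (Im a)) + Rsqr (cos (Im a)))) by (unfold Rsqr; ring).
  rewrite sin2_cos2, Rmult_1_r. apply sqrt_pow2. left. apply exp_pos.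
Qed.

Lemma Cexp_RtoC (x : R) : Cexp (RtoC x) = RtoC (exp x).
Proof. unfold Cexp; apply Ceq; simpl; rewrite ?cos_0, ?sin_0; ring. Qed.

Lemma Cexp_neq_0 (a : C) : Cexp a <> 0%C.
Proof. apply Cmod_gt_0. rewrite Cmod_Cexp. apply exp_pos. Qed.

Lemma Rcpow_neq_0 (x : R) (a : C) : Rcpow x a <> 0%C.
Proof. apply Cexp_neq_0. Qed.

Lemma Rcpow_plus (x : R) (a b : C) : Rcpow x (a + b)%C = (Rcpow x a * Rcpow x b)%C.
Proof. unfold Rcpow. rewrite <- Cexp_plus. f_equal. ring. Qed.

Lemma Rcpow_mult (x y : R) (a : C) :
  0 < x -> 0 < y -> Rcpow (x * y) a = (Rcpow x a * Rcpow y a)%C.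
Proof.
  intros Hx Hy. unfold Rcpow. rewrite <- Cexp_plus, ln_mult, RtoC_plus by assumption. f_equal. ring.
Qed.

Lemma Rcpow_0 (x : R) : Rcpow x 0%C = 1%C.
Proof. unfold Rcpow. rewrite Cmult_0_l. apply Cexp_0. Qed.

Lemma Rcpow_1 (x : R) : 0 < x -> Rcpow x 1%C = RtoC x.
Proof. intros Hx. unfold Rcpow. rewrite Cmult_1_l, Cexp_RtoC, exp_ln by exact Hx. reflexivity. Qed.

Lemma Rcpow_base_1 (a : C) : Rcpow 1 a = 1%C.
Proof. unfold Rcpow. rewrite ln_1, Cmult_0_r. apply Cexp_0. Qed.

Lemma Rcpow_opp (x : R) (a : C) : Rcpow x (- a)%C = (/ Rcpow x a)%C.
Proof.
  assert (H : (Rcpow x (- a) * Rcpow x a = 1)%C).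
  { rewrite <- Rcpow_plus. replace (- a + a)%C with (RtoC 0) by ring. apply Rcpow_0. }
  assert (N := Rcpow_neq_0 x a).
  replace (Rcpow x (- a)) with (Rcpow x (- a) * Rcpow x a / Rcpow x a)%C by (field; exact N).
  rewrite H. field. exact N.
Qed.

Lemma Rcpow_RtoC (x a : R) : Rcpow x (RtoC a) = RtoC (Rpower x a).
Proof. unfold Rcpow. rewrite <- RtoC_mult. apply Cexp_RtoC. Qed.

Lemma Cmod_Rcpow (x : R) (a : C) : Cmod (Rcpow x a) = exp (Re a * ln x).
Proof. unfold Rcpow. rewrite Cmod_Cexp. f_equal. simpl. unfold Re. ring. Qed.

(** * Laplace-type integrals *)

(** Continuity on the closed half-line with an exponential bound: the integral over the half-line is
    then a limit of Riemann integrals, with an explicit tail. *)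
Definition rtame (g : R -> R) (K lam : R) : Prop :=
  0 < lam /\ (forall t, 0 <= t -> continuous g t) /\ (forall t, 0 <= t -> Rabs (g t) <= K * exp (- lam * t)).

Definition Lr (g : R -> R) : R := real (Lim (fun A => RInt g 0 A) p_infty).

Lemma ex_RInt_cont (g : R -> R) (a b : R) : 0 <= a -> 0 <= b ->
  (forall t, 0 <= t -> continuous g t) -> ex_RInt g a b.
Proof.
  intros Ha Hb H. apply (ex_RInt_continuous (V := R_CompleteNormedModule)).
  intros z Hz. apply H. eapply Rle_trans; [apply (Rmin_glb _ _ _ Ha Hb) | apply Hz].
Qed.

Lemma RInt_Chasles_cont (g : R -> R) (a b c : R) : 0 <= a -> 0 <= b -> 0 <= c ->
  (forall t, 0 <= t -> continuous g t) -> RInt g a c = RInt g a b + RInt g b c.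
Proof.
  intros Ha Hb Hc H. symmetry. apply (RInt_Chasles (V := R_CompleteNormedModule)); apply ex_RInt_cont; assumption.
Qed.

Lemma RInt_exp_decay (K lam A B : R) : 0 < lam ->
  is_RInt (fun t => K * exp (- lam * t)) A B (K / lam * (exp (- lam * A) - exp (- lam * B))).
Proof.
  intros Hl.
  pose (Fp := fun t => - (K / lam) * exp (- lam * t)).
  replace (K / lam * (exp (- lam * A) - exp (- lam * B))) with (minus (Fp B) (Fp A))
    by (unfold Fp, minus, plus, opp; simpl; ring).
  apply (is_RInt_derive (V := R_CompleteNormedModule) Fp).
  - intros x _. unfold Fp. auto_derive; [trivial|]. field. lra.
  - intros x _. apply (ex_derive_continuous (fun t => K * exp (- lam * t))). auto_derive. trivial.
Qed.

Lemma rtame_tail (g : R -> R) (K lam A B : R) : rtame g K lam -> 0 <= A <= B ->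
  Rabs (RInt g A B) <= K / lam * exp (- lam * A).
Proof.
  intros (Hl & Hc & Hb) HAB.
  eapply Rle_trans; [apply abs_RInt_le; [lra | apply ex_RInt_cont; [lra|lra|exact Hc]]|].
  assert (E := RInt_exp_decay K lam A B Hl).
  eapply Rle_trans; [apply RInt_le with (g := fun t => K * exp (- lam * t))|].
  - lra.
  - apply ex_RInt_cont; [lra|lra|]. intros t Ht. apply (continuous_comp g Rabs); [apply Hc, Ht | apply continuous_Rabs].
  - eexists; apply E.
  - intros t Ht. apply Hb. lra.
  - rewrite (is_RInt_unique _ _ _ _ E).
    assert (HK : 0 <= K).
    { specialize (Hb 0 (Rle_refl 0)). rewrite Rmult_0_r, exp_0 in Hb.
      generalize (Rabs_pos (g 0)); lra. }
    assert (0 <= K / lam) by (apply Rdiv_le_0_compat; lra).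
    assert (P := exp_pos (- lam * B)). nra.
Qed.

Lemma exp_decay_small (M lam eps : R) : 0 < lam -> 0 < eps ->
  exists A0, 0 <= A0 /\ forall A, A0 <= A -> M * exp (- lam * A) < eps.
Proof.
  intros Hl He. exists (Rmax 0 (Rabs M / (eps * lam))). split; [apply Rmax_l|].
  intros A HA.
  assert (H1 : Rabs M / (eps * lam) <= A) by (eapply Rle_trans; [apply Rmax_r|exact HA]).
  assert (H0 : 0 <= A) by (eapply Rle_trans; [apply Rmax_l|exact HA]).
  assert (Hel : 0 < eps * lam) by nra.
  apply Rle_div_l in H1; [|lra].
  assert (X := exp_ineq1_le (lam * A)).
  replace (- lam * A) with (- (lam * A)) by ring. rewrite exp_Ropp.
  assert (HP := exp_pos (lam * A)).
  apply Rlt_div_l; [exact HP|].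
  assert (M <= Rabs M) by apply Rle_abs. nra.
Qed.

Lemma Lr_lim (g : R -> R) (K lam : R) : rtame g K lam ->
  filterlim (fun A => RInt g 0 A) (Rbar_locally p_infty) (locally (Lr g)).
Proof.
  intros Ht.
  assert (EX : exists y : R_CompleteSpace,
     filterlim (fun A => RInt g 0 A) (Rbar_locally p_infty) (locally y)).
  { apply filterlim_locally_cauchy. intros eps.
    destruct (exp_decay_small (K / lam) lam eps (proj1 Ht) (cond_pos eps)) as (A0 & HA0 & HA).
    exists (fun A => A0 < A). split; [exists A0; auto|].
    assert (Q : forall u v, A0 < u -> u <= v -> Rabs (RInt g 0 v - RInt g 0 u) < eps).
    { intros u v Hu Huv.
      rewrite (RInt_Chasles_cont g 0 u v) by (apply Ht || lra).
      rewrite Rplus_minus_l.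
      eapply Rle_lt_trans; [apply (rtame_tail g K lam); [exact Ht|lra]|]. apply HA. lra. }
    intros u v Hu Hv. change (Rabs (RInt g 0 v - RInt g 0 u) < eps).
    destruct (Rle_dec u v) as [L|L]; [apply Q; assumption|].
    rewrite Rabs_minus_sym. apply Q; [exact Hv|lra]. }
  destruct EX as [y Hy]. unfold Lr.
  replace (Lim (fun A => RInt g 0 A) p_infty) with (Finite y); [exact Hy|].
  symmetry. apply is_lim_unique. exact Hy.
Qed.

Lemma Lr_tail (g : R -> R) (K lam A : R) : rtame g K lam -> 0 <= A ->
  Rabs (Lr g - RInt g 0 A) <= K / lam * exp (- lam * A).
Proof.
  intros Ht HA. apply le_epsilon. intros e He.
  assert (H := proj1 (filterlim_locally _ _) (Lr_lim g K lam Ht) (mkposreal e He)).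
  destruct H as [M HM]. simpl in HM.
  pose (B := Rmax A M + 1).
  assert (HB : M < B) by (unfold B; generalize (Rmax_r A M); lra).
  assert (HAB : A <= B) by (unfold B; generalize (Rmax_l A M); lra).
  specialize (HM B HB). change (Rabs (RInt g 0 B - Lr g) < e) in HM.
  assert (Q := rtame_tail g K lam A B Ht (conj HA HAB)).
  rewrite (RInt_Chasles_cont g 0 A B) in HM by (apply Ht || lra).
  assert (E : forall l a b : R, l - a = b - (a + b - l)) by (intros; ring).
  rewrite (E _ _ (RInt g A B)).
  eapply Rle_trans; [apply Rabs_triang|]. rewrite Rabs_Ropp. lra.
Qed.

(** The constants stay visible because dominated convergence needs one pair for a whole family;
    [istame] forgets them. *)
Definition tame (f : R -> C) (K lam : R) : Prop :=
  0 < lam /\ (forall t, 0 <= t -> ccont f t) /\ (forall t, 0 <= t -> Cmod (f t) <= K * exp (- lam * t)).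

Definition istame (f : R -> C) : Prop := exists K lam, tame f K lam.

Definition L (f : R -> C) : C := (Lr (fun t => Re (f t)), Lr (fun t => Im (f t))).

Definition intC (f : R -> C) (A : R) : C :=
  (RInt (fun t => Re (f t)) 0 A, RInt (fun t => Im (f t)) 0 A).

Lemma ccont_re (f : R -> C) (x : R) : ccont f x -> continuous (fun t => Re (f t)) x.
Proof. apply ctends_re. Qed.
Lemma ccont_im (f : R -> C) (x : R) : ccont f x -> continuous (fun t => Im (f t)) x.
Proof. apply ctends_im. Qed.

Lemma tame_re (f : R -> C) K lam : tame f K lam -> rtame (fun t => Re (f t)) K lam.
Proof.
  intros (a & b & c). split; [exact a|]. split.
  - intros t Ht. apply ccont_re, b, Ht.
  - intros t Ht. eapply Rle_trans; [apply re_le_Cmod | auto].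
Qed.
Lemma tame_im (f : R -> C) K lam : tame f K lam -> rtame (fun t => Im (f t)) K lam.
Proof.
  intros (a & b & c). split; [exact a|]. split.
  - intros t Ht. apply ccont_im, b, Ht.
  - intros t Ht. eapply Rle_trans; [apply im_le_Cmod | auto].
Qed.

(** The factor 2 comes from bounding the real and the imaginary part separately. *)
Lemma L_tail (f : R -> C) K lam A : tame f K lam -> 0 <= A ->
  Cmod (L f - intC f A)%C <= 2 * (K / lam * exp (- lam * A)).
Proof.
  intros Ht HA. eapply Rle_trans; [apply Cmod_le_re_im|].
  assert (a := Lr_tail _ _ _ A (tame_re _ _ _ Ht) HA).
  assert (b := Lr_tail _ _ _ A (tame_im _ _ _ Ht) HA).
  unfold L, intC, Re, Im in *; simpl in *. unfold Rminus in *. lra.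
Qed.

Lemma L_lim (f : R -> C) : istame f -> ctends (Rbar_locally p_infty) (intC f) (L f).
Proof.
  intros (K & lam & Ht) e He.
  destruct (exp_decay_small (2 * (K / lam)) lam e (proj1 Ht) He) as (A0 & H0 & HA).
  exists A0. intros A Hlt. rewrite Cmod_sub_sym.
  eapply Rle_lt_trans; [apply (L_tail f K lam A Ht); lra|].
  rewrite <- Rmult_assoc. apply HA. lra.
Qed.

Lemma L_unique (f : R -> C) (l : C) : ctends (Rbar_locally p_infty) (intC f) l -> L f = l.
Proof.
  intros H. apply Ceq; unfold L; simpl; unfold Lr.
  - rewrite (is_lim_unique _ _ (Finite (Re l))); [reflexivity|]. exact (ctends_re _ _ H).
  - rewrite (is_lim_unique _ _ (Finite (Im l))); [reflexivity|]. exact (ctends_im _ _ H).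
Qed.

Lemma L_bound (f : R -> C) K lam : tame f K lam -> Cmod (L f) <= 2 * (K / lam).
Proof.
  intros Ht. assert (H := L_tail f K lam 0 Ht (Rle_refl 0)).
  assert (E : intC f 0 = RtoC 0) by (unfold intC; rewrite !RInt_point; reflexivity).
  rewrite E in H.
  rewrite Rmult_0_r, exp_0, Rmult_1_r in H.
  replace (L f - 0)%C with (L f) in H by ring. exact H.
Qed.

Lemma ccont_plus (f g : R -> C) x : ccont f x -> ccont g x -> ccont (fun t => (f t + g t)%C) x.
Proof. apply ctends_plus. Qed.
Lemma ccont_mult (f g : R -> C) x : ccont f x -> ccont g x -> ccont (fun t => (f t * g t)%C) x.
Proof. apply ctends_mult. Qed.
Lemma ccont_const (c : C) x : ccont (fun _ => c) x.
Proof. apply ctends_const. Qed.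

Lemma tame_nonneg (f : R -> C) K lam : tame f K lam -> 0 <= K.
Proof.
  intros (_ & _ & Hb). specialize (Hb 0 (Rle_refl 0)). rewrite Rmult_0_r, exp_0 in Hb.
  generalize (Cmod_ge_0 (f 0)); lra.
Qed.

Lemma istame_scal (c : C) (f : R -> C) : istame f -> istame (fun t => (c * f t)%C).
Proof.
  intros (K & lam & a & b & d). exists (Cmod c * K), lam. split; [exact a|]. split.
  - intros t Ht. apply ccont_mult; [apply ccont_const | auto].
  - intros t Ht. rewrite Cmod_mult, Rmult_assoc. apply Rmult_le_compat_l; [apply Cmod_ge_0|auto].
Qed.

Lemma istame_plus (f g : R -> C) : istame f -> istame g -> istame (fun t => (f t + g t)%C).
Proof.
  intros (K1 & l1 & H1) (K2 & l2 & H2).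
  assert (P1 := tame_nonneg _ _ _ H1). assert (P2 := tame_nonneg _ _ _ H2).
  destruct H1 as (a1 & b1 & d1), H2 as (a2 & b2 & d2).
  assert (W : forall K l t, 0 <= K -> 0 <= t -> Rmin l1 l2 <= l ->
            K * exp (- l * t) <= K * exp (- Rmin l1 l2 * t)).
  { intros K l t HK Ht Hl. apply Rmult_le_compat_l; [exact HK|].
    assert (Q : - l * t <= - Rmin l1 l2 * t) by nra.
    destruct Q as [Q| ->]; [left; apply exp_increasing, Q | right; reflexivity]. }
  exists (K1 + K2), (Rmin l1 l2). split; [apply Rmin_pos; assumption|]. split.
  - intros t Ht. apply ccont_plus; auto.
  - intros t Ht. eapply Rle_trans; [apply Cmod_triangle|].
    specialize (d1 t Ht). specialize (d2 t Ht).
    assert (V1 := W K1 l1 t P1 Ht (Rmin_l _ _)). assert (V2 := W K2 l2 t P2 Ht (Rmin_r _ _)). lra.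
Qed.

Lemma istame_ext (f g : R -> C) : (forall t, f t = g t) -> istame f -> istame g.
Proof.
  intros E (K & lam & a & b & d). exists K, lam. split; [exact a|]. split.
  - intros t Ht. apply ctends_ext with f; [exact E|]. rewrite <- E. apply b, Ht.
  - intros t Ht. rewrite <- E. auto.
Qed.

Lemma istame_mult_bdd (f g : R -> C) (M : R) : istame f -> (forall t, 0 <= t -> ccont g t) ->
  (forall t, 0 <= t -> Cmod (g t) <= M) -> istame (fun t => (f t * g t)%C).
Proof.
  intros (K & lam & Ht) Hc Hb. assert (HK := tame_nonneg _ _ _ Ht). destruct Ht as (a & b & d).
  exists (K * M), lam. split; [exact a|]. split.
  - intros t Ht. apply ccont_mult; auto.
  - intros t Ht. rewrite Cmod_mult.
    replace (K * M * exp (- lam * t)) with (K * exp (- lam * t) * M) by ring.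
    apply Rmult_le_compat; auto using Cmod_ge_0.
Qed.

Lemma intC_plus (f g : R -> C) A : 0 <= A ->
  (forall t, 0 <= t -> ccont f t) -> (forall t, 0 <= t -> ccont g t) ->
  intC (fun t => (f t + g t)%C) A = (intC f A + intC g A)%C.
Proof.
  intros HA Hf Hg. unfold intC. apply Ceq; simpl;
  apply (RInt_plus (V := R_CompleteNormedModule)); (apply ex_RInt_cont; [lra|exact HA|]; intros t Ht);
  (apply ccont_re || apply ccont_im); auto.
Qed.

Lemma intC_scal (c : C) (f : R -> C) A : 0 <= A -> (forall t, 0 <= t -> ccont f t) ->
  intC (fun t => (c * f t)%C) A = (c * intC f A)%C.
Proof.
  intros HA Hf.
  assert (E1 : ex_RInt (fun t => Re (f t)) 0 A)
    by (apply ex_RInt_cont; [lra|exact HA|]; intros; apply ccont_re; auto).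
  assert (E2 : ex_RInt (fun t => Im (f t)) 0 A)
    by (apply ex_RInt_cont; [lra|exact HA|]; intros; apply ccont_im; auto).
  assert (S : forall (k : R) (g : R -> R), ex_RInt g 0 A ->
            RInt (fun t => k * g t) 0 A = k * RInt g 0 A).
  { intros k g Hg. apply (RInt_scal (V := R_CompleteNormedModule)). exact Hg. }
  assert (S' : forall (k : R) (g : R -> R), ex_RInt g 0 A -> ex_RInt (fun t => k * g t) 0 A).
  { intros k g Hg. apply (ex_RInt_scal (V := R_NormedModule)). exact Hg. }
  unfold intC. apply Ceq; simpl.
  - transitivity (RInt (fun t => minus (fst c * Re (f t)) (snd c * Im (f t))) 0 A).
    { apply RInt_ext. intros; reflexivity. }
    rewrite (RInt_minus (V := R_CompleteNormedModule)) by auto.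
    rewrite !S by auto. reflexivity.
  - transitivity (RInt (fun t => plus (fst c * Im (f t)) (snd c * Re (f t))) 0 A).
    { apply RInt_ext. intros; reflexivity. }
    rewrite (RInt_plus (V := R_CompleteNormedModule)) by auto.
    rewrite !S by auto. reflexivity.
Qed.

Lemma intC_ext (f g : R -> C) A : 0 <= A -> (forall t, 0 < t -> f t = g t) -> intC f A = intC g A.
Proof.
  intros HA H. unfold intC. f_equal; apply RInt_ext; intros t Ht;
  rewrite Rmin_left in Ht by exact HA; rewrite H by lra; reflexivity.
Qed.

Lemma L_ext (f g : R -> C) : (forall t, 0 < t -> f t = g t) -> istame f -> L f = L g.
Proof.
  intros H Ht. symmetry. apply L_unique. apply ctends_ext_loc with (2 := L_lim f Ht).
  exists 0. intros A HA. apply intC_ext; [lra | exact H].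
Qed.

Lemma L_plus (f g : R -> C) : istame f -> istame g ->
  L (fun t => (f t + g t)%C) = (L f + L g)%C.
Proof.
  intros Hf Hg. apply L_unique.
  apply ctends_ext_loc with (fun A => (intC f A + intC g A)%C).
  - exists 0. intros A HA. symmetry. destruct Hf as (? & ? & ? & ? & ?), Hg as (? & ? & ? & ? & ?).
    apply intC_plus; try assumption; lra.
  - apply ctends_plus; apply L_lim; assumption.
Qed.

Lemma L_scal (c : C) (f : R -> C) : istame f -> L (fun t => (c * f t)%C) = (c * L f)%C.
Proof.
  intros Hf. apply L_unique.
  apply ctends_ext_loc with (fun A => (c * intC f A)%C).
  - exists 0. intros A HA. symmetry. destruct Hf as (? & ? & ? & ? & ?). apply intC_scal; try assumption; lra.
  - apply ctends_mult; [apply ctends_const | apply L_lim; assumption].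
Qed.

Lemma L_ftc (f f' : R -> C) (l : C) :
  (forall t, 0 <= t -> cder f t (f' t)) -> istame f' -> ctends (Rbar_locally p_infty) f l ->
  L f' = (l - f 0)%C.
Proof.
  intros Hd (K & lam & Ht) Hl. apply L_unique.
  apply ctends_ext_loc with (fun A => (f A - f 0)%C).
  2: { apply ctends_minus; [exact Hl | apply ctends_const]. }
  exists 0. intros A HA. unfold intC. apply Ceq; simpl; symmetry; apply is_RInt_unique.
  - apply (is_RInt_derive (V := R_CompleteNormedModule) (fun t => Re (f t))).
    + intros x Hx. rewrite Rmin_left in Hx by lra. apply Hd. lra.
    + intros x Hx. rewrite Rmin_left in Hx by lra. apply ccont_re, Ht. lra.
  - apply (is_RInt_derive (V := R_CompleteNormedModule) (fun t => Im (f t))).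
    + intros x Hx. rewrite Rmin_left in Hx by lra. apply Hd. lra.
    + intros x Hx. rewrite Rmin_left in Hx by lra. apply ccont_im, Ht. lra.
Qed.

Lemma L_scale (f : R -> C) (s : R) : 0 < s -> istame f ->
  L (fun t => (RtoC s * f (s * t)%R)%C) = L f.
Proof.
  intros Hs Hf. apply L_unique.
  apply ctends_ext_loc with (fun A => intC f (s * A)).
  - exists 0. intros A HA. unfold intC. destruct Hf as (K & lam & Ht).
    apply Ceq; simpl; symmetry.
    + transitivity (RInt (fun y => scal s (Re (f (s * y + 0)))) 0 A).
      { apply RInt_ext. intros t _. unfold scal; simpl; unfold mult; simpl.
        rewrite Rplus_0_r. unfold Re, Im. simpl. ring. }
      etransitivity; [apply (RInt_comp_lin (V := R_CompleteNormedModule) (fun t => Re (f t)) s 0 0 A)|].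
      * apply ex_RInt_cont; [lra|nra|]. intros; apply ccont_re, Ht; assumption.
      * f_equal; ring.
    + transitivity (RInt (fun y => scal s (Im (f (s * y + 0)))) 0 A).
      { apply RInt_ext. intros t _. unfold scal; simpl; unfold mult; simpl.
        rewrite Rplus_0_r. unfold Re, Im. simpl. ring. }
      etransitivity; [apply (RInt_comp_lin (V := R_CompleteNormedModule) (fun t => Im (f t)) s 0 0 A)|].
      * apply ex_RInt_cont; [lra|nra|]. intros; apply ccont_im, Ht; assumption.
      * f_equal; ring.
  - apply (ctends_comp (intC f) (fun A => s * A)) with (2 := L_lim f Hf).
    intros P [M HM]. exists (M / s). intros x Hx. apply HM.
    apply Rlt_div_l in Hx; [lra|exact Hs].
Qed.

Lemma intC_bound (f : R -> C) (eta A : R) : 0 <= A -> (forall t, 0 <= t -> ccont f t) ->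
  (forall t, 0 <= t <= A -> Cmod (f t) <= eta) -> Cmod (intC f A) <= 2 * (A * eta).
Proof.
  intros HA Hc Hb. eapply Rle_trans; [apply Cmod_le_re_im|]. unfold intC; simpl.
  assert (Q : forall g : R -> R, (forall t, 0 <= t -> continuous g t) -> (forall t, 0 <= t <= A -> Rabs (g t) <= eta) ->
    Rabs (RInt g 0 A) <= A * eta).
  { intros g Hg Hgb. eapply Rle_trans; [apply abs_RInt_le; [lra | apply ex_RInt_cont; [lra|exact HA|exact Hg]]|].
    eapply Rle_trans; [apply RInt_le with (g := fun _ => eta)|].
    - lra.
    - apply ex_RInt_cont; [lra|exact HA|]. intros t Ht. apply (continuous_comp g Rabs); [apply Hg, Ht | apply continuous_Rabs].
    - apply ex_RInt_cont; [lra|exact HA|]. intros; apply continuous_const.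
    - intros; apply Hgb; lra.
    - rewrite RInt_const. unfold scal; simpl; unfold mult; simpl. lra. }
  assert (Rabs (RInt (fun t => Re (f t)) 0 A) <= A * eta).
  { apply Q; [intros; apply ccont_re; auto|]. intros t Ht. eapply Rle_trans; [apply re_le_Cmod | auto]. }
  assert (Rabs (RInt (fun t => Im (f t)) 0 A) <= A * eta).
  { apply Q; [intros; apply ccont_im; auto|]. intros t Ht. eapply Rle_trans; [apply im_le_Cmod | auto]. }
  lra.
Qed.

(** * Dominated convergence along a filter *)

(** Joint convergence near each t0 gives uniformity near t0. A supremum argument on the length s of
    the good interval [0, s] then patches neighbourhoods together, so each enlargement uses one
    intersection in the filter. *)
Lemma uniform_on_compact {I : Type} {F : (I -> Prop) -> Prop} {FF : Filter F}
  (f : I -> R -> C) (g : R -> C) (T eta : R) :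
  0 <= T -> 0 < eta ->
  (forall t, 0 <= t -> ccont g t) ->
  (forall t0, 0 <= t0 -> ctends (filter_prod F (locally t0)) (fun p => f (fst p) (snd p)) (g t0)) ->
  F (fun i => forall t, 0 <= t <= T -> Cmod (f i t - g t)%C < eta).
Proof.
  intros HT He Hg Hf.
  assert (He2 : 0 < eta / 2) by lra.
  assert (Loc : forall t0, 0 <= t0 -> exists d, 0 < d /\
     F (fun i => forall t, Rabs (t - t0) < d -> Cmod (f i t - g t)%C < eta)).
  { intros t0 Ht0. destruct (Hf t0 Ht0 _ He2) as [P Q HP [d1 HQ] HPQ].
    destruct (Hg t0 Ht0 _ He2) as [d2 Hd2].
    exists (Rmin d1 d2). split; [apply Rmin_pos; apply cond_pos|].
    revert HP. apply filter_imp. intros i Hi t Ht.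
    assert (A1 : Rabs (t - t0) < d1) by (eapply Rlt_le_trans; [exact Ht|apply Rmin_l]).
    assert (A2 : Rabs (t - t0) < d2) by (eapply Rlt_le_trans; [exact Ht|apply Rmin_r]).
    specialize (HPQ i t Hi (HQ t A1)). specialize (Hd2 t A2). simpl in HPQ.
    eapply Rle_lt_trans; [apply (Cmod_tri_sub _ (g t0))|].
    rewrite (Cmod_sub_sym (g t0)). lra. }
  pose (S := fun s => 0 <= s <= T /\ F (fun i => forall t, 0 <= t <= s -> Cmod (f i t - g t)%C < eta)).
  assert (S0 : S 0).
  { split; [lra|]. destruct (Loc 0 (Rle_refl 0)) as (d & Hd & HF). revert HF. apply filter_imp.
    intros i Hi t Ht. apply Hi. rewrite Rminus_0_r, Rabs_pos_eq; lra. }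
  destruct (completeness S) as [m [Hub Hlub]].
  { exists T. intros s [Hs _]. lra. }
  { exists 0. exact S0. }
  assert (Hm0 : 0 <= m) by (apply Hub, S0).
  assert (HmT : m <= T) by (apply Hlub; intros s [Hs _]; lra).
  destruct (Loc m Hm0) as (d & Hd & HF).
  assert (EX : exists s, S s /\ m - d < s).
  { apply NNPP. intros N. assert (m <= m - d); [|lra]. apply Hlub. intros s Hs.
    destruct (Rle_dec s (m - d)); [assumption|]. exfalso. apply N. exists s. split; [exact Hs|lra]. }
  destruct EX as (s & [Hs1 Hs2] & Hs3).
  (* Going half a radius past the supremum m contradicts its maximality unless T has been
     reached. *)
  pose (s' := Rmin T (m + d / 2)).
  assert (Hs' : S s').
  { split.
    - split; [apply Rmin_glb; lra | apply Rmin_l].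
    - generalize (filter_and _ _ Hs2 HF). apply filter_imp. intros i [Q1 Q2] t Ht.
      destruct (Rle_dec t s) as [L1|L1]; [apply Q1; lra|].
      apply Q2. assert (t <= m + d / 2) by (eapply Rle_trans; [apply Ht | apply Rmin_r]).
      apply Rabs_def1; lra. }
  assert (s' <= m) by (apply Hub, Hs').
  assert (s' = T).
  { unfold s' in *. unfold Rmin in *. destruct (Rle_dec T (m + d / 2)); lra. }
  destruct Hs' as [_ HF']. rewrite H0 in HF'. exact HF'.
Qed.

(** Three parts of size e / 3: the two tails beyond T, controlled by the common bound, and the
    difference on [0, T], controlled by uniform convergence there. *)
Lemma L_dominated {I : Type} {F : (I -> Prop) -> Prop} {FF : Filter F}
  (f : I -> R -> C) (g : R -> C) (K lam : R) :
  F (fun i => tame (f i) K lam) -> tame g K lam ->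
  (forall t0, 0 <= t0 -> ctends (filter_prod F (locally t0)) (fun p => f (fst p) (snd p)) (g t0)) ->
  ctends F (fun i => L (f i)) (L g).
Proof.
  intros Hf Hg Hc e He.
  assert (He3 : 0 < e / 3) by lra.
  destruct (exp_decay_small (2 * (K / lam)) lam (e / 3) (proj1 Hg) He3) as (T & HT & HA).
  specialize (HA T (Rle_refl T)). rewrite Rmult_assoc in HA.
  (* The 2 anticipates [intC_bound], and T + 1 instead of T keeps the denominator positive when T =
     0. *)
  assert (Hn : 0 < e / 3 / (2 * (T + 1))) by (apply Rdiv_lt_0_compat; lra).
  generalize (filter_and _ _ Hf (uniform_on_compact f g T _ HT Hn (proj1 (proj2 Hg)) Hc)).
  apply filter_imp. intros i [Hi Hu].
  eapply Rle_lt_trans; [apply (Cmod_tri_sub _ (intC (f i) T))|].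
  assert (B1 := L_tail _ _ _ T Hi HT).
  assert (B2 := L_tail _ _ _ T Hg HT).
  assert (B3 : Cmod (intC (f i) T - intC g T)%C <= 2 * (T * (e / 3 / (2 * (T + 1))))).
  { replace (intC (f i) T - intC g T)%C with (intC (fun t => (f i t + (- (1)) * g t)%C) T).
    - apply intC_bound; [exact HT| |].
      + intros t Ht. apply ccont_plus; [apply Hi, Ht|]. apply ccont_mult; [apply ccont_const | apply Hg, Ht].
      + intros t Ht. left. replace (f i t + (- (1)) * g t)%C with (f i t - g t)%C by ring. apply Hu, Ht.
    - rewrite intC_plus; [rewrite intC_scal; [ring|exact HT|apply Hg]|exact HT|apply Hi|].
      intros t Ht. apply ccont_mult; [apply ccont_const | apply Hg, Ht]. }
  assert (B4 : 2 * (T * (e / 3 / (2 * (T + 1)))) <= e / 3).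
  { apply Rle_trans with (2 * ((T + 1) * (e / 3 / (2 * (T + 1))))); [nra|]. right. field. lra. }
  assert (B5 := Cmod_tri_sub (intC (f i) T) (intC g T) (L g)).
  rewrite (Cmod_sub_sym (intC g T)) in B5. lra.
Qed.

(** * The deformed kernel *)

(** Unlike [Rcpow], continuous at [0] when [Re a > 0]. *)
Definition pw (x : R) (a : C) : C := if Rle_dec x 0 then RtoC 0 else Rcpow x a.

Lemma pw_pos (x : R) (a : C) : 0 < x -> pw x a = Rcpow x a.
Proof. intros H. unfold pw. destruct (Rle_dec x 0); [lra|reflexivity]. Qed.

Lemma pw_nonpos (x : R) (a : C) : x <= 0 -> pw x a = 0%C.
Proof. intros H. unfold pw. destruct (Rle_dec x 0); [reflexivity|lra]. Qed.

Lemma exp_le_compat (x y : R) : x <= y -> exp x <= exp y.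
Proof. intros [H| ->]; [left; apply exp_increasing; assumption | right; reflexivity]. Qed.

Lemma ln_nonneg (x : R) : 1 <= x -> 0 <= ln x.
Proof. intros H. rewrite <- ln_1. apply ln_le; lra. Qed.

Lemma Cmod_pw_le (x y : R) (a : C) : x <= y -> 0 < y -> 0 <= Re a ->
  Cmod (pw x a) <= exp (Re a * ln y).
Proof.
  intros H Hy Ha. unfold pw. destruct (Rle_dec x 0) as [N|N].
  - rewrite Cmod_0. left. apply exp_pos.
  - rewrite Cmod_Rcpow. apply exp_le_compat. apply Rmult_le_compat_l; [exact Ha|].
    apply ln_le; lra.
Qed.

Lemma pw_tends {I : Type} {F : (I -> Prop) -> Prop} {FF : Filter F} (f : I -> R) (l : R) (a : C) :
  0 < Re a -> filterlim f F (locally l) -> ctends F (fun i => pw (f i) a) (pw l a).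
Proof.
  intros Ha Hf. destruct (Rlt_le_dec 0 l) as [Hl|Hl].
  - rewrite pw_pos by exact Hl.
    apply ctends_ext_loc with (2 := ctends_Rcpow f l a Hl Hf).
    generalize (proj1 (filterlim_locally _ _) Hf (mkposreal l Hl)). apply filter_imp.
    intros i Hi. change (Rabs (f i - l) < l) in Hi. apply Rabs_def2 in Hi.
    symmetry. apply pw_pos. lra.
  - rewrite pw_nonpos by exact Hl. intros e He.
    (* The root e^(1 / Re a): a base below d has a power of modulus below e. *)
    pose (d := exp (ln e / Re a)).
    assert (Hd : 0 < d) by apply exp_pos.
    generalize (proj1 (filterlim_locally _ _) Hf (mkposreal (d/2) ltac:(lra))). apply filter_imp.
    intros i Hi. change (Rabs (f i - l) < d/2) in Hi. apply Rabs_def2 in Hi.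
    replace (pw (f i) a - 0)%C with (pw (f i) a) by ring.
    eapply Rle_lt_trans; [apply (Cmod_pw_le _ (d/2) a); lra|].
    apply Rlt_le_trans with (exp (Re a * ln d)).
    + apply exp_increasing. apply Rmult_lt_compat_l; [exact Ha|]. apply ln_increasing; lra.
    + right. unfold d. rewrite ln_exp. replace (Re a * (ln e / Re a)) with (ln e) by (field; lra).
      apply exp_ln, He.
Qed.

Lemma pw_plus_1 (x : R) (a : C) : 0 <= x -> pw x (a + 1)%C = (RtoC x * pw x a)%C.
Proof.
  intros [H| <-].
  - rewrite !pw_pos by exact H. rewrite Rcpow_plus, Rcpow_1 by exact H. ring.
  - rewrite !pw_nonpos by lra. ring.
Qed.

Lemma pw_mult (x y : R) (a : C) : 0 < x -> 0 <= y -> pw (x * y) a = (Rcpow x a * pw y a)%C.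
Proof.
  intros H [Hy| <-].
  - rewrite !pw_pos by nra. apply Rcpow_mult; assumption.
  - rewrite Rmult_0_r, !pw_nonpos by lra. ring.
Qed.

(** At x = 0 the difference quotient is [pw h (a - 1)] itself, which tends to 0 because Re a > 1.
    Integration by parts against y^a starting at y = 0 rests on this. *)
Lemma cder_pw (a : C) (x : R) : 1 < Re a -> cder (fun t => pw t a) x (a * pw x (a - 1))%C.
Proof.
  intros Ha. destruct (Rtotal_order x 0) as [H|[H|H]].
  - rewrite pw_nonpos by lra. replace (a * 0)%C with (RtoC 0) by ring.
    apply cder_ext_loc with (fun _ => RtoC 0); [|apply cder_const].
    exists (mkposreal (- x) ltac:(lra)). intros y Hy. change (Rabs (y - x) < - x) in Hy.
    apply Rabs_def2 in Hy. symmetry. apply pw_nonpos. lra.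
  - subst x. apply ctends_cder.
    rewrite (pw_nonpos 0 (a - 1)%C) by lra. replace (a * 0)%C with (pw 0 (a - 1)%C) by (rewrite pw_nonpos by lra; ring).
    apply ctends_ext_loc with (fun h => pw h (a - 1)%C).
    + exists (mkposreal 1 Rlt_0_1). intros h _ Hh. rewrite Rplus_0_l, (pw_nonpos 0) by lra.
      destruct (Rlt_le_dec 0 h) as [P|P].
      * replace a with ((a - 1) + 1)%C at 2 by ring. rewrite pw_plus_1 by lra. field.
        apply RtoC_neq_0, Hh.
      * rewrite !pw_nonpos by exact P. field. intros E. apply Hh. apply RtoC_inj, E.
    + apply (pw_tends (F := locally' 0) (fun h => h)). { rewrite Re_minus, re_RtoC. lra. }
      intros P HP. apply filter_le_within. exact HP.
  - apply cder_ext_loc with (fun t => Rcpow t a).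
    + exists (mkposreal x H). intros y Hy. change (Rabs (y - x) < x) in Hy.
      apply Rabs_def2 in Hy. symmetry. apply pw_pos. lra.
    + eapply cder_eq; [|apply cder_Rcpow, H]. rewrite pw_pos by exact H.
      assert (N : RtoC x <> 0%C) by (apply RtoC_neq_0; lra).
      replace (Rcpow x a) with (Rcpow x (a - 1) * RtoC x)%C; [field; exact N|].
      rewrite <- (Rcpow_1 x H), <- Rcpow_plus. f_equal. ring.
Qed.

(** The value at [e = 0] is the limit as [e] tends to [0]. *)
Definition X (e t : R) : R := if Req_EM_T e 0 then t else (1 - exp (- (e * t))) / e.

Lemma X_0 (t : R) : X 0 t = t.
Proof. unfold X. destruct (Req_EM_T 0 0); [reflexivity|lra]. Qed.

Lemma X_e (e t : R) : e <> 0 -> X e t = (1 - exp (- (e * t))) / e.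
Proof. intros H. unfold X. destruct (Req_EM_T e 0); [lra|reflexivity]. Qed.

Lemma eX (e t : R) : e * X e t = 1 - exp (- (e * t)).
Proof.
  unfold X. destruct (Req_EM_T e 0) as [->|N]; [|field; exact N].
  rewrite !Rmult_0_l, Ropp_0, exp_0. ring.
Qed.

Lemma is_derive_X (e t : R) : is_derive (X e) t (1 - e * X e t).
Proof.
  rewrite eX. unfold X. destruct (Req_EM_T e 0) as [->|N].
  - rewrite Rmult_0_l, Ropp_0, exp_0. replace (1 - (1 - 1)) with 1 by ring. apply (is_derive_id (K := R_AbsRing)).
  - auto_derive; [trivial|]. field. exact N.
Qed.

Lemma X_at_0 (e : R) : X e 0 = 0.
Proof.
  unfold X. destruct (Req_EM_T e 0); [reflexivity|].
  rewrite Rmult_0_r, Ropp_0, exp_0. field. assumption.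
Qed.

Lemma X_pos (e t : R) : 0 <= e -> 0 < t -> 0 < X e t.
Proof.
  intros He Ht. unfold X. destruct (Req_EM_T e 0) as [->|N]; [exact Ht|].
  apply Rdiv_lt_0_compat; [|lra]. assert (0 < e * t) by nra.
  assert (exp (- (e * t)) < exp 0) by (apply exp_increasing; lra). rewrite exp_0 in *. lra.
Qed.

Lemma X_nonneg (e t : R) : 0 <= e -> 0 <= t -> 0 <= X e t.
Proof. intros He [Ht| <-]; [left; apply X_pos; assumption | rewrite X_at_0; lra]. Qed.

Lemma X_le (e t : R) : 0 <= e -> X e t <= t.
Proof.
  intros He. unfold X. destruct (Req_EM_T e 0) as [->|N]; [lra|].
  apply Rle_div_l; [lra|]. assert (Q := exp_ineq1_le (- (e * t))). lra.
Qed.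

Lemma eX_range (e t : R) : 0 <= e -> 0 <= t -> 0 <= e * X e t < 1.
Proof.
  intros He Ht. rewrite eX. assert (P := exp_pos (- (e * t))).
  assert (0 <= e * t) by nra.
  assert (Q : exp (- (e * t)) <= exp 0) by (apply exp_le_compat; lra). rewrite exp_0 in Q. lra.
Qed.

Lemma exp_second_order (s : R) : Rabs s <= 1 / 2 -> Rabs (exp s - 1 - s) <= 2 * s ^ 2.
Proof.
  intros Hs. apply Rabs_le_between in Hs.
  assert (A := exp_ineq1_le s). assert (B := exp_ineq1_le (- s)).
  rewrite Rabs_pos_eq by lra.
  rewrite exp_Ropp in B. assert (P := exp_pos s).
  assert (exp s * (1 - s) <= 1).
  { apply Rmult_le_reg_l with (/ exp s); [apply Rinv_0_lt_compat, P|].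
    rewrite <- Rmult_assoc, Rinv_l by lra. lra. }
  nra.
Qed.

Lemma X_near (e t : R) : Rabs (e * t) <= 1 / 2 -> Rabs (X e t - t) <= 2 * (Rabs e * t ^ 2).
Proof.
  intros H. unfold X. destruct (Req_EM_T e 0) as [->|N].
  - rewrite Rminus_diag, Rabs_R0. lra.
  - assert (N' := Rabs_pos_lt _ N). rewrite <- Rabs_Ropp in H. apply exp_second_order in H.
    replace ((1 - exp (- (e * t))) / e - t) with (- (exp (- (e * t)) - 1 - - (e * t)) / e) by (field; exact N).
    unfold Rdiv. rewrite Rabs_mult, Rabs_Ropp, Rabs_inv.
    apply Rle_div_l; [exact N'|]. eapply Rle_trans; [exact H|]. right.
    replace ((- (e * t)) ^ 2) with (e ^ 2 * t ^ 2) by ring. rewrite <- (pow2_abs e). ring.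
Qed.

Lemma X_tends {I : Type} {F : (I -> Prop) -> Prop} {FF : Filter F} (e : I -> R) (t0 : R) :
  filterlim e F (locally 0) ->
  filterlim (fun p => X (e (fst p)) (snd p)) (filter_prod F (locally t0)) (locally t0).
Proof.
  intros He. apply filterlim_locally. intros eps.
  pose (M := Rabs t0 + 1). assert (HM : 1 <= M) by (unfold M; generalize (Rabs_pos t0); lra).
  (* For |t| <= M the first bound gives |e t| <= 1/2, as [X_near] requires, and the second gives 2
     |e| t^2 < eps / 2. *)
  pose (d := Rmin (1 / (2 * M)) (eps / (4 * M ^ 2 + 1))).
  assert (Hd : 0 < d).
  { apply Rmin_pos; apply Rdiv_lt_0_compat; try lra; [apply cond_pos|nra]. }
  apply Filter_prod with (fun i => Rabs (e i) < d) (fun t => Rabs (t - t0) < Rmin 1 (eps / 2)).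
  - generalize (proj1 (filterlim_locally _ _) He (mkposreal d Hd)). apply filter_imp.
    intros i Hi. change (Rabs (e i - 0) < d) in Hi. rewrite Rminus_0_r in Hi. exact Hi.
  - assert (P : 0 < Rmin 1 (eps / 2)) by (apply Rmin_pos; [lra|generalize (cond_pos eps); lra]).
    exists (mkposreal _ P). intros t Ht. exact Ht.
  - intros i t Hi2 Ht. simpl. change (Rabs (X (e i) t - t0) < eps).
    assert (Hi := Rabs_pos (e i)).
    assert (T1 : Rabs (t - t0) < 1) by (eapply Rlt_le_trans; [exact Ht|apply Rmin_l]).
    assert (T2 : Rabs (t - t0) < eps / 2) by (eapply Rlt_le_trans; [exact Ht|apply Rmin_r]).
    assert (T3 : Rabs t <= M).
    { unfold M. replace t with ((t - t0) + t0) at 1 by ring. eapply Rle_trans; [apply Rabs_triang|]. lra. }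
    assert (D1 : Rabs (e i) < 1 / (2 * M)) by (eapply Rlt_le_trans; [exact Hi2|apply Rmin_l]).
    assert (D2 : Rabs (e i) < eps / (4 * M ^ 2 + 1)) by (eapply Rlt_le_trans; [exact Hi2|apply Rmin_r]).
    apply Rlt_div_r in D1; [|lra]. apply Rlt_div_r in D2; [|nra].
    assert (N := X_near (e i) t). rewrite Rabs_mult in N.
    assert (T0 := Rabs_pos t).
    assert (Q : Rabs (X (e i) t - t) <= 2 * (Rabs (e i) * t ^ 2)) by (apply N; nra).
    assert (t ^ 2 <= M ^ 2).
    { rewrite <- (pow2_abs t). apply pow_incr. lra. }
    assert (Rabs (e i) * t ^ 2 <= Rabs (e i) * M ^ 2) by (apply Rmult_le_compat_l; assumption).
    replace (X (e i) t - t0) with ((X (e i) t - t) + (t - t0)) by ring.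
    eapply Rle_lt_trans; [apply Rabs_triang|]. lra.
Qed.

(** The tangent bound ln y <= y - 1 at y = d (1 + t), with d = lam / (p + 1) so that p d <= lam. *)
Lemma power_le_exp (p lam : R) : 0 <= p -> 0 < lam ->
  exists K, 0 < K /\ forall t, 0 <= t -> exp (p * ln (1 + t)) <= K * exp (lam * t).
Proof.
  intros Hp Hl. pose (d := lam / (p + 1)).
  assert (Hd : 0 < d) by (apply Rdiv_lt_0_compat; lra).
  exists (exp (p * (d - 1 - ln d))). split; [apply exp_pos|].
  intros t Ht. rewrite <- exp_plus. apply exp_le_compat.
  assert (A : ln (1 + t) <= d * (1 + t) - 1 - ln d).
  { assert (Q := exp_ineq1_le (ln (d * (1 + t)))).
    rewrite exp_ln in Q by nra. rewrite ln_mult in Q by lra. lra. }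
  assert (B : p * ln (1 + t) <= p * (d * (1 + t) - 1 - ln d)) by (apply Rmult_le_compat_l; assumption).
  assert (E : d * (p + 1) = lam) by (unfold d; field; lra).
  assert (0 <= d * t) by nra. nra.
Qed.

(** The common integrand: [dt]-density of a scaled beta integral for [e > 0] under
    [y = e * X e t], of a confluent hypergeometric integral at [e = 0]. *)
Definition kern (p b q : C) (j : nat) (e x t : R) : C :=
  (RtoC (t ^ j) * (pw (X e t) p * Rcpow (1 + (1 - e) * X e t) (- b)
     * Cexp ((q * RtoC e - RtoC x) * RtoC t)))%C.

Lemma kern_tends {I : Type} {F : (I -> Prop) -> Prop} {FF : Filter F} (e x : I -> R) (x0 t0 : R)
  (p b q : C) (j : nat) :
  0 < Re p -> 0 <= t0 -> filterlim e F (locally 0) -> filterlim x F (locally x0) ->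
  ctends (filter_prod F (locally t0)) (fun p0 => kern p b q j (e (fst p0)) (x (fst p0)) (snd p0))
    (kern p b q j 0 x0 t0).
Proof.
  intros Hp Ht He Hx. unfold kern. rewrite X_0.
  assert (HX := X_tends e t0 He).
  assert (Hs : filterlim (fun p : I * R => snd p) (filter_prod F (locally t0)) (locally t0)) by apply filterlim_snd.
  assert (He' : filterlim (fun p : I * R => e (fst p)) (filter_prod F (locally t0)) (locally 0)).
  { eapply filterlim_comp; [apply filterlim_fst|exact He]. }
  assert (Hx' : filterlim (fun p : I * R => x (fst p)) (filter_prod F (locally t0)) (locally x0)).
  { eapply filterlim_comp; [apply filterlim_fst|exact Hx]. }
  apply ctends_mult; [|apply ctends_mult; [apply ctends_mult|]].
  - apply ctends_RtoC. apply (filterlim_comp _ _ _ _ (fun t => t ^ j) _ _ _ Hs).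
    apply (ex_derive_continuous (fun t => t ^ j)). auto_derive. trivial.
  - apply pw_tends; assumption.
  - apply ctends_Rcpow; [lra|].
    apply ctends_RtoC in HX. apply ctends_RtoC in He'.
    assert (Q := ctends_re _ _ (ctends_plus _ _ _ _ (ctends_const (RtoC 1))
      (ctends_mult _ _ _ _ (ctends_minus _ _ _ _ (ctends_const (RtoC 1)) He') HX))).
    replace (locally (1 + (1 - 0) * t0)) with (locally (Re (1 + (1 - 0) * RtoC t0)%C)).
    2: { f_equal. simpl. ring. }
    eapply filterlim_ext; [|exact Q]. intros i. simpl. ring.
  - apply ctends_Cexp. apply ctends_mult; [|apply ctends_RtoC, Hs].
    apply ctends_minus; [|apply ctends_RtoC, Hx'].
    apply ctends_mult; [apply ctends_const | apply ctends_RtoC, He'].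
Qed.

Lemma continuous_X (e t : R) : continuous (X e) t.
Proof. apply (ex_derive_continuous (X e)). eexists. apply is_derive_X. Qed.

Lemma kern_base (e t : R) : 0 <= e <= 1 -> 0 <= t -> 1 <= 1 + (1 - e) * X e t <= 1 + t.
Proof.
  intros He Ht. assert (A := X_nonneg e t (proj1 He) Ht). assert (B := X_le e t (proj1 He)). nra.
Qed.

Lemma kern_ccont (p b q : C) (j : nat) (e x t : R) :
  0 < Re p -> 0 <= e <= 1 -> 0 <= t -> ccont (kern p b q j e x) t.
Proof.
  intros Hp He Ht. unfold kern.
  apply ccont_mult; [|apply ccont_mult; [apply ccont_mult|]].
  - apply ctends_RtoC. apply (ex_derive_continuous (fun t => t ^ j)). auto_derive. trivial.
  - apply (pw_tends (X e)); [exact Hp | apply continuous_X].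
  - apply (ctends_Rcpow (fun t => 1 + (1 - e) * X e t)); [generalize (kern_base e t He Ht); lra|].
    apply (ex_derive_continuous (fun t => 1 + (1 - e) * X e t)). auto_derive.
    eexists. apply is_derive_X.
  - apply ctends_Cexp. apply ctends_mult; [apply ctends_const|]. apply ctends_RtoC.
    apply continuous_id.
Qed.

(** Both X e t and 1 + (1 - e) X e t are at most 1 + t, and the latter is at least 1, so all
    algebraic factors are dominated by one power of 1 + t, uniformly for e in [0, 1]. *)
Lemma kern_bound (p b q : C) (j : nat) (e x t : R) :
  0 <= Re p -> 0 <= e <= 1 -> 0 <= t ->
  Cmod (kern p b q j e x t) <=
    exp ((Re p + Rabs (Re b) + INR j) * ln (1 + t)) * exp ((Re q * e - x) * t).
Proof.
  intros Hp He Ht. unfold kern. rewrite !Cmod_mult, Cmod_R, Cmod_Rcpow, Cmod_Cexp.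
  rewrite re_scal_r, Re_minus, re_scal_r, re_RtoC.
  rewrite <- Rmult_assoc. apply Rmult_le_compat_r; [left; apply exp_pos|].
  rewrite !Rmult_plus_distr_r, !exp_plus.
  assert (B := kern_base e t He Ht).
  assert (P1 : Cmod (pw (X e t) p) <= exp (Re p * ln (1 + t))).
  { apply Cmod_pw_le; [|lra|exact Hp]. generalize (X_le e t (proj1 He)). lra. }
  assert (P2 : exp (Re (- b)%C * ln (1 + (1 - e) * X e t)) <= exp (Rabs (Re b) * ln (1 + t))).
  { apply exp_le_compat. rewrite re_opp.
    assert (L1 := ln_nonneg _ (proj1 B)).
    assert (L2 : ln (1 + (1 - e) * X e t) <= ln (1 + t)) by (apply ln_le; lra).
    assert (L3 : - Re b <= Rabs (Re b)) by (rewrite <- Rabs_Ropp; apply Rle_abs).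
    assert (L4 := Rabs_pos (Re b)). nra. }
  assert (P3 : Rabs (t ^ j) <= exp (INR j * ln (1 + t))).
  { change (exp (INR j * ln (1 + t))) with (Rpower (1 + t) (INR j)).
    rewrite Rpower_pow by lra. rewrite <- RPow_abs. apply pow_incr.
    split; [apply Rabs_pos|]. rewrite Rabs_pos_eq; lra. }
  assert (Q1 := Cmod_ge_0 (pw (X e t) p)). assert (Q2 := exp_pos (Re (- b)%C * ln (1 + (1 - e) * X e t))).
  assert (Q3 := Rabs_pos (t ^ j)). rewrite (Rmult_comm (Rabs (t ^ j))).
  apply Rmult_le_compat; [nra|exact Q3|apply Rmult_le_compat; lra|exact P3].
Qed.

(** Domination uniform in (e, x) near (0, x0). The choice of e0 makes Re q * e <= x0 / 4, which
    leaves decay x0 / 2 when x >= 3 x0 / 4; half of it absorbs the power of 1 + t. *)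
Lemma kern_tame (p b q : C) (j : nat) (x0 : R) : 0 < Re p -> 0 < x0 ->
  exists K e0, 0 < e0 <= 1 /\ forall e x, 0 <= e <= e0 -> 3 / 4 * x0 <= x ->
    tame (kern p b q j e x) K (x0 / 4).
Proof.
  intros Hp Hx0.
  assert (Hpp : 0 <= Re p + Rabs (Re b) + INR j).
  { generalize (Rabs_pos (Re b)) (pos_INR j). lra. }
  destruct (power_le_exp _ (x0 / 4) Hpp ltac:(lra)) as (K & HK & HG).
  assert (Hden : 0 < 4 * (Rabs (Re q) + 1)) by (generalize (Rabs_pos (Re q)); lra).
  exists K, (Rmin 1 (x0 / (4 * (Rabs (Re q) + 1)))). split.
  { split; [|apply Rmin_l]. apply Rmin_pos; [lra|]. apply Rdiv_lt_0_compat; lra. }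
  intros e x He Hx.
  assert (E1 : e <= 1) by (eapply Rle_trans; [apply He|apply Rmin_l]).
  assert (E2 : e <= x0 / (4 * (Rabs (Re q) + 1))) by (eapply Rle_trans; [apply He|apply Rmin_r]).
  apply Rle_div_r in E2; [|exact Hden].
  split; [lra|]. split.
  - intros t Ht. apply kern_ccont; [exact Hp|lra|exact Ht].
  - intros t Ht. eapply Rle_trans; [apply kern_bound; [lra|lra|exact Ht]|].
    specialize (HG t Ht).
    assert (D : Re q * e - x <= - (x0 / 2)).
    { assert (Re q * e <= Rabs (Re q) * e) by (apply Rmult_le_compat_r; [lra|apply Rle_abs]).
      lra. }
    apply Rle_trans with (K * exp (x0 / 4 * t) * exp (- (x0 / 2) * t)).
    + apply Rmult_le_compat; [left; apply exp_pos|left; apply exp_pos|exact HG|].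
      apply exp_le_compat. apply Rmult_le_compat_r; assumption.
    + right. rewrite Rmult_assoc, <- exp_plus. f_equal. f_equal. lra.
Qed.

Lemma L_kern_tends {I : Type} {F : (I -> Prop) -> Prop} {FF : Filter F} (e x : I -> R) (x0 : R)
  (p b q : C) (j : nat) :
  0 < Re p -> 0 < x0 ->
  F (fun i => 0 <= e i) -> filterlim e F (locally 0) -> filterlim x F (locally x0) ->
  ctends F (fun i => L (kern p b q j (e i) (x i))) (L (kern p b q j 0 x0)).
Proof.
  intros Hp Hx0 H0 He Hx.
  destruct (kern_tame p b q j x0 Hp Hx0) as (K & e0 & He0 & HT).
  apply L_dominated with K (x0 / 4).
  - assert (A1 := proj1 (filterlim_locally _ _) He (mkposreal e0 (proj1 He0))).
    assert (A2 := proj1 (filterlim_locally _ _) Hx (mkposreal (x0 / 4) ltac:(lra))).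
    generalize (filter_and _ _ H0 (filter_and _ _ A1 A2)). apply filter_imp.
    intros i (B0 & B1 & B2). change (Rabs (e i - 0) < e0) in B1. change (Rabs (x i - x0) < x0 / 4) in B2.
    apply Rabs_def2 in B1. apply Rabs_def2 in B2. apply HT; lra.
  - apply HT; lra.
  - intros t0 Ht0. apply kern_tends; assumption.
Qed.

(** Differentiation under the integral. For |h| <= lam / 4 the quotient (exp (- h t) - 1) / h is at
    most t exp (|h| t), and the factor t costs another exp (lam t / 4), so half of the original
    decay lam is left for domination. *)
Lemma L_der (f : R -> C) : istame f ->
  cder (fun h => L (fun t => (f t * RtoC (exp (- (h * t))))%C)) 0 (- L (fun t => (RtoC t * f t)%C))%C.
Proof.
  intros (K & lam & Ht). assert (Hl := proj1 Ht).
  assert (HK : 0 <= K).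
  { destruct Ht as (_ & _ & Hb). specialize (Hb 0 (Rle_refl 0)). rewrite Rmult_0_r, exp_0 in Hb.
    generalize (Cmod_ge_0 (f 0)); lra. }
  destruct (power_le_exp 1 (lam / 4) ltac:(lra) ltac:(lra)) as (K1 & HK1 & HG).
  assert (HG' : forall t, 0 <= t -> t <= K1 * exp (lam / 4 * t)).
  { intros t H. specialize (HG t H). rewrite Rmult_1_l, exp_ln in HG by lra. lra. }
  pose (dq := fun h t => (exp (- (h * t)) - 1) / h).
  assert (Hdq : forall h t, 0 <= t -> h <> 0 -> Rabs h <= lam / 4 ->
            Rabs (dq h t) <= K1 * exp (lam / 2 * t)).
  { intros h t H Hh Hh2. unfold dq.
    apply Rle_trans with (t * exp (lam / 4 * t)).
    - rewrite Rabs_div by exact Hh. apply Rle_div_l; [apply Rabs_pos_lt, Hh|].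
      assert (M : forall s, Rabs (exp s - 1) <= Rabs s * exp (Rabs s)).
      { intros s. destruct (Rle_dec 0 s) as [Hs|Hs].
        - assert (A := exp_ineq1_le s). assert (B := exp_ineq1_le (- s)).
          rewrite !Rabs_pos_eq by lra. rewrite exp_Ropp in B. assert (P := exp_pos s).
          assert (exp s * (1 - s) <= 1).
          { apply Rmult_le_reg_l with (/ exp s); [apply Rinv_0_lt_compat, P|].
            rewrite <- Rmult_assoc, Rinv_l by lra. lra. }
          lra.
        - assert (A := exp_ineq1_le s). rewrite (Rabs_left s) by lra.
          assert (exp s < 1) by (rewrite <- exp_0; apply exp_increasing; lra).
          rewrite Rabs_left by lra. assert (B := exp_ineq1_le (- s)). nra. }
      eapply Rle_trans; [apply M|].
      rewrite Rabs_Ropp, Rabs_mult, (Rabs_pos_eq t) by exact H.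
      replace (t * exp (lam / 4 * t) * Rabs h) with (Rabs h * t * exp (lam / 4 * t)) by ring.
      apply Rmult_le_compat_l; [generalize (Rabs_pos h); nra|]. apply exp_le_compat. nra.
    - replace (lam / 2 * t) with (lam / 4 * t + lam / 4 * t) by lra. rewrite exp_plus, <- Rmult_assoc.
      apply Rmult_le_compat_r; [left; apply exp_pos|]. apply HG', H. }
  assert (Tq : forall (g : R -> R) (c : R), (forall t, 0 <= t -> continuous g t) -> 0 <= c <= lam / 2 ->
     (forall t, 0 <= t -> Rabs (g t) <= (K1 + 1) * exp (c * t)) ->
     tame (fun t => (f t * RtoC (g t))%C) (K * (K1 + 1)) (lam / 2)).
  { intros g c Hg Hc Hb. split; [lra|]. split.
    - intros t H. apply ccont_mult; [apply Ht, H|]. apply ctends_RtoC, Hg, H.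
    - intros t H. rewrite Cmod_mult, Cmod_R.
      apply Rle_trans with (K * exp (- lam * t) * ((K1 + 1) * exp (c * t))).
      + apply Rmult_le_compat; [apply Cmod_ge_0|apply Rabs_pos|apply Ht, H|apply Hb, H].
      + replace (K * exp (- lam * t) * ((K1 + 1) * exp (c * t)))
          with (K * (K1 + 1) * (exp (- lam * t) * exp (c * t))) by ring.
        rewrite <- exp_plus. apply Rmult_le_compat_l; [nra|]. apply exp_le_compat. nra. }
  assert (Tf : tame (fun t => (f t * RtoC (exp (- (0 * t))))%C) (K * (K1 + 1)) (lam / 2)).
  { apply Tq with 0; [|lra|].
    - intros t _. apply (ex_derive_continuous (fun t => exp (- (0 * t)))). auto_derive. trivial.
    - intros t _. rewrite !Rmult_0_l, Ropp_0, exp_0, Rabs_R1. lra. }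
  assert (Th : forall h, Rabs h <= lam / 4 -> istame (fun t => (f t * RtoC (exp (- (h * t))))%C)).
  { intros h Hh. exists (K * (K1 + 1)), (lam / 2). apply Tq with (lam / 2); [|lra|].
    - intros t _. apply (ex_derive_continuous (fun t => exp (- (h * t)))). auto_derive. trivial.
    - intros t H. rewrite Rabs_pos_eq by (left; apply exp_pos).
      assert (exp (- (h * t)) <= exp (lam / 2 * t)).
      { apply exp_le_compat. apply Rabs_le_between in Hh. nra. }
      assert (0 < exp (lam / 2 * t)) by apply exp_pos. nra. }
  assert (Tt : tame (fun t => (f t * RtoC (- t))%C) (K * (K1 + 1)) (lam / 2)).
  { apply Tq with (lam / 4); [|lra|].
    - intros t _. apply (ex_derive_continuous (fun t => - t)). auto_derive. trivial.
    - intros t H. rewrite Rabs_Ropp, Rabs_pos_eq by exact H.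
      specialize (HG' t H). assert (0 < exp (lam / 4 * t)) by apply exp_pos. nra. }
  assert (Tf' : istame (fun t => (f t * RtoC (exp (- (0 * t))))%C)) by (eexists; eexists; apply Tf).
  assert (Tt' : istame (fun t => (f t * RtoC (- t))%C)) by (eexists; eexists; apply Tt).
  apply ctends_cder.
  replace (- L (fun t => RtoC t * f t))%C with (L (fun t => (f t * RtoC (- t))%C)).
  2: { rewrite (L_ext _ (fun t => (RtoC (-1) * (RtoC t * f t))%C)); [|intros t _; rewrite RtoC_opp; ring|exact Tt'].
       rewrite L_scal; [ring|]. apply istame_ext with (fun t => (RtoC (-1) * (f t * RtoC (- t)))%C).
       - intros t. rewrite RtoC_opp. ring.
       - apply istame_scal, Tt'. }
  apply ctends_ext_loc with (fun h => L (fun t => (f t * RtoC (dq h t))%C)).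
  - exists (mkposreal (lam / 4) ltac:(lra)). intros h Hh Hh0. change (Rabs (h - 0) < lam / 4) in Hh.
    rewrite Rminus_0_r in Hh. rewrite Rplus_0_l.
    assert (Th' := Th h ltac:(lra)).
    rewrite <- (L_ext (fun t => (RtoC (/ h) * (f t * RtoC (exp (- (h * t)))
                       + RtoC (-1) * (f t * RtoC (exp (- (0 * t))))))%C)).
    + rewrite L_scal, L_plus, L_scal; auto using istame_plus, istame_scal.
      rewrite RtoC_inv by exact Hh0. field. apply RtoC_neq_0, Hh0.
    + intros t _. unfold dq. rewrite Rmult_0_l, Ropp_0, exp_0.
      rewrite RtoC_div, RtoC_minus, RtoC_inv by exact Hh0. field. apply RtoC_neq_0, Hh0.
    + auto using istame_plus, istame_scal.
  - apply L_dominated with (K * (K1 + 1)) (lam / 2); [|exact Tt|].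
    + exists (mkposreal (lam / 4) ltac:(lra)). intros h Hh Hh0. change (Rabs (h - 0) < lam / 4) in Hh.
      rewrite Rminus_0_r in Hh. apply Tq with (lam / 2); [|lra|].
      * intros t _. apply (ex_derive_continuous (dq h)). unfold dq. auto_derive. trivial.
      * intros t H. eapply Rle_trans; [apply Hdq; [exact H|exact Hh0|lra]|].
        apply Rmult_le_compat_r; [left; apply exp_pos|lra].
    + intros t0 Ht0.
      apply (ctends_mult (F := filter_prod (locally' 0) (locally t0)) (fun p => f (snd p)) (fun p => RtoC (dq (fst p) (snd p)))).
      * apply (ctends_comp (F := filter_prod (locally' 0) (locally t0)) (G := locally t0) f snd (f t0)).
        -- apply filterlim_snd.
        -- apply Ht, Ht0.
      * apply ctends_RtoC.
        (* The difference quotient is - X h t, so its joint limit - t is that of the deformed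
           variable already studied. *)
        apply filterlim_ext_loc with (fun p => - X (fst p) (snd p)).
        -- apply Filter_prod with (fun h => h <> 0) (fun _ => True).
           ++ exists (mkposreal 1 Rlt_0_1). intros h _ Hh. exact Hh.
           ++ apply filter_true.
           ++ intros h t Hh _. simpl. unfold dq. rewrite X_e by exact Hh. field. exact Hh.
        -- assert (HX : filterlim (fun p => X (fst p) (snd p)) (filter_prod (locally' 0) (locally t0)) (locally t0)).
           { apply (X_tends (fun h => h)). intros P HP. apply filter_le_within, HP. }
           apply (filterlim_comp _ _ _ _ Ropp _ _ _ HX).
           apply (continuous_opp (V := R_NormedModule) (fun t => t)). apply continuous_id.
Qed.

(** * Beta integrals *)

Definition dens (a : C) (e : R) (z : C) (t : R) : C :=
  (pw (X e t) (a - 1) * Cexp ((a * RtoC e - z) * RtoC t))%C.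

(** Under [y = e * X e t] this is
    [e^(-a) int_0^1 y^(a - 1) (1 - y)^(z / e - a - 1) G y dy]. *)
Definition Lam (a : C) (e : R) (z : C) (G : R -> C) : C :=
  L (fun t => (dens a e z t * G (e * X e t)%R)%C).

Definition beta (a : C) (e : R) (z : C) : C := Lam a e z (fun _ => RtoC 1).

(** The interval is half-open because e X e t stays below 1 for every t >= 0; nothing is asked at
    the endpoint y = 1. *)
Definition bcont (G : R -> C) (B : R) : Prop :=
  (forall y, 0 <= y < 1 -> ccont G y) /\ (forall y, 0 <= y < 1 -> Cmod (G y) <= B).

Lemma bcont_1 : bcont (fun _ => RtoC 1) 1.
Proof. split; intros; [apply ccont_const|]. right. apply Cmod_1. Qed.

Lemma Cexp_lin_ccont (c : C) (t : R) : ccont (fun s => Cexp (c * RtoC s)%C) t.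
Proof.
  apply ctends_Cexp. apply ctends_mult; [apply ctends_const|]. apply ctends_RtoC, continuous_id.
Qed.

Lemma Cexp_lin_0_ctends (c : C) : Re c < 0 ->
  ctends (Rbar_locally p_infty) (fun s => Cexp (c * RtoC s)%C) 0%C.
Proof.
  intros Hc e He. destruct (exp_decay_small 1 (- Re c) e ltac:(lra) He) as (A0 & _ & HA).
  exists A0. intros s Hs. replace (Cexp (c * s) - 0)%C with (Cexp (c * s)%C) by ring.
  rewrite Cmod_Cexp, re_scal_r. specialize (HA s ltac:(lra)). rewrite Ropp_involutive in HA. lra.
Qed.

Lemma ctends_0_mult_bdd {I : Type} {F : (I -> Prop) -> Prop} {FF : Filter F} (f g : I -> C) (B : R) :
  ctends F f 0%C -> F (fun i => Cmod (g i) <= B) -> ctends F (fun i => (g i * f i)%C) 0%C.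
Proof.
  intros Hf Hg e He.
  assert (HB : 0 < Rmax B 1) by (eapply Rlt_le_trans; [apply Rlt_0_1|apply Rmax_r]).
  generalize (filter_and _ _ Hg (Hf (e / Rmax B 1) ltac:(apply Rdiv_lt_0_compat; lra))).
  apply filter_imp. intros i [H1 H2]. replace (f i - 0)%C with (f i) in H2 by ring.
  replace (g i * f i - 0)%C with (g i * f i)%C by ring. rewrite Cmod_mult.
  apply Rlt_div_r in H2; [|exact HB].
  eapply Rle_lt_trans; [|exact H2]. rewrite (Rmult_comm (Cmod (f i))).
  apply Rmult_le_compat_r; [apply Cmod_ge_0|]. eapply Rle_trans; [exact H1|apply Rmax_l].
Qed.

Lemma pwX_ccont (p : C) (e t : R) : 0 < Re p -> ccont (fun s => pw (X e s) p) t.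
Proof. intros Hp. apply (pw_tends (X e)); [exact Hp|apply continuous_X]. Qed.

Lemma pwX_bound (p : C) (e t : R) : 0 < e -> 0 <= Re p -> 0 <= t ->
  Cmod (pw (X e t) p) <= exp (Re p * ln (/ e)).
Proof.
  intros He Hp Ht. apply Cmod_pw_le; [|apply Rinv_0_lt_compat, He|exact Hp].
  assert (Q := eX_range e t ltac:(lra) Ht).
  apply Rmult_le_reg_l with e; [exact He|]. rewrite Rinv_r by lra. lra.
Qed.

Lemma dens_tame (a : C) (e : R) (z : C) : 0 < e -> 1 < Re a -> e * Re a < Re z -> istame (dens a e z).
Proof.
  intros He Ha Hz. exists (exp ((Re a - 1) * ln (/ e))), (Re z - e * Re a). split; [lra|]. split.
  - intros t Ht. apply ccont_mult; [apply pwX_ccont; rewrite Re_minus, re_RtoC; lra|apply Cexp_lin_ccont].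
  - intros t Ht. unfold dens. rewrite Cmod_mult, Cmod_Cexp, re_scal_r, Re_minus, re_scal_r.
    apply Rmult_le_compat; [apply Cmod_ge_0|left; apply exp_pos| |right; f_equal; ring].
    assert (Q := pwX_bound (a - 1)%C e t He). rewrite Re_minus, re_RtoC in Q. apply Q; lra.
Qed.

Lemma bcont_eX (G : R -> C) B e t : 0 < e -> 0 <= t -> bcont G B -> ccont (fun s => G (e * X e s)) t.
Proof.
  intros He Ht [Hc _].
  apply (ctends_comp (F := locally t) (G := locally (e * X e t)) G (fun s => e * X e s)).
  - apply (ex_derive_continuous (fun s => e * X e s)). auto_derive. eexists. apply is_derive_X.
  - apply Hc. apply eX_range; lra.
Qed.

Lemma dens_G_tame (a : C) (e : R) (z : C) (G : R -> C) B :
  0 < e -> 1 < Re a -> e * Re a < Re z -> bcont G B ->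
  istame (fun t => (dens a e z t * G (e * X e t)%R)%C).
Proof.
  intros He Ha Hz HG. apply istame_mult_bdd with B.
  - apply dens_tame; assumption.
  - intros t Ht. eapply bcont_eX; eassumption.
  - intros t Ht. apply HG. apply eX_range; lra.
Qed.

Lemma parts_bcont (a k : C) (G G' : R -> C) B B' : bcont G B -> bcont G' B' ->
  bcont (fun y => ((a - k * RtoC y) * G y + RtoC (y * (1 - y)) * G' y)%C) ((Cmod a + Cmod k) * B + B').
Proof.
  intros HG HG'. split.
    - intros y Hy. apply ccont_plus; apply ccont_mult.
      + apply ctends_minus; [apply ctends_const|]. apply ctends_mult; [apply ctends_const|].
        apply ctends_RtoC, continuous_id.
      + apply HG, Hy.
      + apply ctends_RtoC. apply (ex_derive_continuous (fun y => y * (1 - y))). auto_derive. trivial.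
      + apply HG', Hy.
    - intros y Hy. eapply Rle_trans; [apply Cmod_triangle|]. rewrite !Cmod_mult, Cmod_R.
      assert (B1 := proj2 HG y Hy). assert (B2 := proj2 HG' y Hy).
      assert (C1 := Cmod_ge_0 (G y)). assert (C2 := Cmod_ge_0 (G' y)).
      assert (Cmod (a - k * y)%C <= Cmod a + Cmod k).
      { eapply Rle_trans; [apply Cmod_triangle|]. rewrite Cmod_opp, Cmod_mult, Cmod_R, Rabs_pos_eq by lra.
        assert (0 <= Cmod k) by apply Cmod_ge_0. nra. }
      assert (Rabs (y * (1 - y)) <= 1) by (rewrite Rabs_pos_eq; nra).
      assert (0 <= Rabs (y * (1 - y))) by apply Rabs_pos.
      assert (0 <= Cmod (a - k * y)%C) by apply Cmod_ge_0.
      apply Rplus_le_compat; [apply Rmult_le_compat; assumption|nra].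
Qed.

Section LamTheory.
Variables (a : C) (e : R) (z : C).
Hypotheses (He : 0 < e) (Ha : 1 < Re a) (Hz : e * Re a < Re z).

Lemma Lam_ext (G H : R -> C) B : bcont G B -> (forall y, 0 <= y < 1 -> G y = H y) ->
  Lam a e z G = Lam a e z H.
Proof.
  intros HG E. apply L_ext; [|eapply dens_G_tame; eassumption].
  intros t Ht. rewrite E; [reflexivity|]. apply eX_range; lra.
Qed.

Lemma Lam_plus (G H : R -> C) B B' : bcont G B -> bcont H B' ->
  Lam a e z (fun y => (G y + H y)%C) = (Lam a e z G + Lam a e z H)%C.
Proof.
  intros HG HH. unfold Lam. rewrite <- L_plus by (eapply dens_G_tame; eassumption).
  symmetry. apply L_ext; [intros; ring|]. apply istame_plus; eapply dens_G_tame; eassumption.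
Qed.

Lemma Lam_scal (c : C) (G : R -> C) B : bcont G B ->
  Lam a e z (fun y => (c * G y)%C) = (c * Lam a e z G)%C.
Proof.
  intros HG. unfold Lam. rewrite <- L_scal by (eapply dens_G_tame; eassumption).
  symmetry. apply L_ext; [intros; ring|]. apply istame_scal; eapply dens_G_tame; eassumption.
Qed.

(** The constant depends on the density alone, so uniform estimates on G pass through the integral;
    Taylor and series remainders are handled this way. *)
Lemma Lam_bound : exists M, 0 <= M /\ forall G B, bcont G B -> Cmod (Lam a e z G) <= M * B.
Proof.
  destruct (dens_tame a e z He Ha Hz) as (K & lam & HT). assert (HK := tame_nonneg _ _ _ HT).
  assert (Hl := proj1 HT).
  exists (2 * (K / lam)). split; [assert (0 <= K / lam) by (apply Rdiv_le_0_compat; lra); lra|].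
  intros G B HG.
  replace (2 * (K / lam) * B) with (2 * (K * B / lam)) by (field; lra).
  apply L_bound. split; [exact Hl|]. split.
  - intros t Ht. apply ccont_mult; [apply HT, Ht|eapply bcont_eX; eassumption].
  - intros t Ht. rewrite Cmod_mult.
    replace (K * B * exp (- lam * t)) with (K * exp (- lam * t) * B) by ring.
    apply Rmult_le_compat; try apply Cmod_ge_0; [apply HT, Ht|]. apply HG, eX_range; lra.
Qed.

(** Integration by parts against [y^a (1 - y)^(c - a)] with [c = z / e]; the boundary terms vanish. *)
Lemma Lam_parts (G G' : R -> C) B B' : bcont G B -> bcont G' B' ->
  (forall y, 0 <= y < 1 -> cder G y (G' y)) ->
  Lam a e z (fun y => ((a - z / RtoC e * RtoC y) * G y + RtoC (y * (1 - y)) * G' y)%C) = 0%C.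
Proof.
  intros HG HG' Hd. assert (HeC : RtoC e <> 0%C) by (apply RtoC_neq_0; lra).
  assert (HB := parts_bcont a (z / RtoC e)%C G G' B B' HG HG').
  pose (f := fun t => (pw (X e t) a * Cexp ((a * RtoC e - z) * RtoC t) * G (e * X e t)%R)%C).
  assert (E0 : f 0 = 0%C).
  { unfold f. rewrite X_at_0, (pw_nonpos 0) by lra. ring. }
  unfold Lam. rewrite (L_ftc f _ 0%C).
  - rewrite E0. ring.
  - intros t Ht. assert (HX := is_derive_X e t).
    assert (D1 := cder_comp _ _ _ _ _ (cder_pw a (X e t) Ha) HX).
    assert (D2 : cder (fun t => Cexp ((a * RtoC e - z) * RtoC t)%C) t
                 ((a * RtoC e - z) * Cexp ((a * RtoC e - z) * RtoC t))%C).
    { apply cder_Cexp. eapply cder_eq; [|apply cder_mult; [apply cder_const|apply cder_RtoC]].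
      2: apply (is_derive_id (K := R_AbsRing)). cbv beta. unfold one; simpl. ring. }
    assert (HeX : is_derive (fun s => e * X e s) t (e * (1 - e * X e t))).
    { apply is_derive_Reals, derivable_pt_lim_scal, is_derive_Reals, HX. }
    assert (D3 := cder_comp _ _ _ _ _ (Hd (e * X e t) (eX_range e t ltac:(lra) Ht)) HeX).
    eapply cder_eq; [|apply (cder_mult _ _ _ _ _ (cder_mult _ _ _ _ _ D1 D2) D3)].
    cbv beta. unfold dens.
    assert (P : pw (X e t) a = (RtoC (X e t) * pw (X e t) (a - 1))%C).
    { rewrite <- pw_plus_1 by (apply X_nonneg; lra). f_equal. ring. }
    rewrite P. rewrite !RtoC_mult, !RtoC_minus, !RtoC_mult. field. exact HeC.
  - exact (dens_G_tame a e z _ _ He Ha Hz HB).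
  - unfold f. apply ctends_ext with (fun t => (pw (X e t) a * G (e * X e t)%R * Cexp ((a * RtoC e - z) * RtoC t))%C).
    { intros t. ring. }
    apply ctends_0_mult_bdd with (exp (Re a * ln (/ e)) * B).
    + apply Cexp_lin_0_ctends. rewrite Re_minus, re_scal_r. lra.
    + exists 0. intros t Ht. rewrite Cmod_mult.
      apply Rmult_le_compat; try apply Cmod_ge_0; [apply pwX_bound; lra|]. apply HG, eX_range; lra.
Qed.

Lemma bcont_pow (n : nat) : bcont (fun y => RtoC (y ^ n)) 1.
Proof.
  split.
  - intros y _. apply ctends_RtoC. apply (ex_derive_continuous (fun y => y ^ n)). auto_derive. trivial.
  - intros y Hy. rewrite Cmod_R, <- RPow_abs, Rabs_pos_eq by lra.
    rewrite <- (pow1 n). apply pow_incr. lra.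
Qed.

Lemma bcont_scal (c : C) (G : R -> C) B : bcont G B -> bcont (fun y => (c * G y)%C) (Cmod c * B).
Proof.
  intros [H1 H2]. split.
  - intros y Hy. apply ccont_mult; [apply ccont_const|auto].
  - intros y Hy. rewrite Cmod_mult. apply Rmult_le_compat_l; [apply Cmod_ge_0|auto].
Qed.

Lemma bcont_plus (G H : R -> C) B B' : bcont G B -> bcont H B' -> bcont (fun y => (G y + H y)%C) (B + B').
Proof.
  intros [H1 H2] [H3 H4]. split.
  - intros y Hy. apply ccont_plus; auto.
  - intros y Hy. eapply Rle_trans; [apply Cmod_triangle|]. apply Rplus_le_compat; auto.
Qed.

(** Integration by parts with G = y^n. With c = z / e the density is that of the beta law with
    parameters a and c - a, and this is its moment recursion. *)
Lemma Lam_moment_step (n : nat) :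
  ((a + RtoC (INR n)) * Lam a e z (fun y => RtoC (y ^ n))
   = (z / RtoC e + RtoC (INR n)) * Lam a e z (fun y => RtoC (y ^ (S n))))%C.
Proof.
  (* The derivative of y^n in a form valid at n = 0, where the factor [INR n] vanishes and [pred 0]
     is harmless. *)
  assert (Hn : bcont (fun y => RtoC (INR n * y ^ (pred n))) (INR n)).
  { split.
    - intros y _. apply ctends_RtoC. apply (ex_derive_continuous (fun y => INR n * y ^ pred n)). auto_derive. trivial.
    - intros y Hy. rewrite Cmod_R, Rabs_mult, (Rabs_pos_eq (INR n)) by apply pos_INR.
      rewrite <- (Rmult_1_r (INR n)) at 2. apply Rmult_le_compat_l; [apply pos_INR|].
      rewrite <- RPow_abs, Rabs_pos_eq by lra. rewrite <- (pow1 (pred n)). apply pow_incr. lra. }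
  assert (H := Lam_parts _ _ _ _ (bcont_pow n) Hn).
  assert (E : ((a + RtoC (INR n)) * Lam a e z (fun y => RtoC (y ^ n))
     + - (z / RtoC e + RtoC (INR n)) * Lam a e z (fun y => RtoC (y ^ (S n))) = 0)%C).
  { rewrite <- (Lam_scal _ _ _ (bcont_pow n)), <- (Lam_scal _ _ _ (bcont_pow (S n))).
    rewrite <- (Lam_plus _ _ _ _ (bcont_scal _ _ _ (bcont_pow n)) (bcont_scal _ _ _ (bcont_pow (S n)))).
    rewrite <- H.
    - eapply Lam_ext; [apply (bcont_plus _ _ _ _ (bcont_scal _ _ _ (bcont_pow n)) (bcont_scal _ _ _ (bcont_pow (S n))))|].
      intros y _.
      assert (P : INR n * y ^ n = INR n * y ^ pred n * y) by (destruct n; simpl; ring).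
      rewrite <- tech_pow_Rmult.
      replace (y * (1 - y)) with (y - y * y) by ring.
      rewrite RtoC_minus, !RtoC_mult.
      transitivity ((a - z / e * y) * (y ^ n)%R + RtoC (INR n * y ^ n) * (1 - y))%C.
      { rewrite RtoC_mult. ring. }
      rewrite P, !RtoC_mult. ring.
    - intros y _. apply cder_RtoC. auto_derive; [trivial|]. destruct n; simpl; ring. }
  match goal with |- ?u = ?v => replace u with (u + - v + v)%C by ring end.
  replace (- ((z / e + INR n) * Lam a e z (fun y : R => (y ^ S n)%R)))%C
    with (- (z / e + INR n) * Lam a e z (fun y : R => (y ^ S n)%R))%C by ring.
  rewrite E. ring.
Qed.

(** The source of the quotient (a)_n / (c)_n in the Gauss coefficients. *)
Lemma Lam_moment (n : nat) : (forall k : nat, z / RtoC e + RtoC (INR k) <> 0)%C ->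
  (poch (z / RtoC e) n * Lam a e z (fun y => RtoC (y ^ n)) = poch a n * beta a e z)%C.
Proof.
  intros Hc. induction n as [|n IH].
  - simpl. reflexivity.
  - change (poch (z / e)%C (S n)) with (poch (z / e) n * (z / e + INR n))%C.
    change (poch a (S n)) with (poch a n * (a + INR n))%C.
    replace (poch (z / e) n * (z / e + INR n) * Lam a e z (fun y => RtoC (y ^ S n)))%C
      with (poch (z / e) n * ((z / e + INR n) * Lam a e z (fun y => RtoC (y ^ S n))))%C by ring.
    rewrite <- Lam_moment_step.
    replace (poch (z / e) n * ((a + INR n) * Lam a e z (fun y => RtoC (y ^ n))))%C
      with ((a + INR n) * (poch (z / e) n * Lam a e z (fun y => RtoC (y ^ n))))%C by ring.
    rewrite IH. ring.
Qed.

(** Raising z by e raises c by 1 and multiplies the integrand by exp (- e t) = 1 - y; the first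
    moment then gives the classical c B(a, c - a + 1) = (c - a) B(a, c - a). *)
Lemma beta_shift : (z / RtoC e * beta a e (z + RtoC e) = (z / RtoC e - a) * beta a e z)%C.
Proof.
  assert (HeC : RtoC e <> 0%C) by (apply RtoC_neq_0; lra).
  assert (E : beta a e (z + RtoC e)%C = (beta a e z + RtoC (-1) * Lam a e z (fun y => RtoC (y ^ 1)))%C).
  { unfold beta. rewrite <- (Lam_scal _ _ _ (bcont_pow 1)).
    rewrite <- (Lam_plus (fun _ => RtoC 1) _ 1 _ bcont_1
                   (bcont_scal _ _ _ (bcont_pow 1))).
    unfold Lam. symmetry. apply L_ext.
    - intros t Ht. rewrite pow_1, eX, RtoC_minus. unfold dens.
      rewrite <- Cexp_RtoC.
      replace ((a * e - (z + e)) * t)%C with ((a * e - z) * t + RtoC (- (e * t)))%C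
        by (rewrite RtoC_opp, RtoC_mult; ring).
      rewrite Cexp_plus. ring.
    - refine (dens_G_tame a e z (fun y => (1 + RtoC (-1) * RtoC (y ^ 1))%C) _ He Ha Hz _).
      apply bcont_plus; [|apply bcont_scal, bcont_pow].
      apply bcont_1. }
  assert (M := Lam_moment_step 0). simpl INR in M.
  change (Lam a e z (fun y => RtoC (y ^ 0))) with (beta a e z) in M.
  rewrite E.
  replace (z / e * (beta a e z + RtoC (-1) * Lam a e z (fun y => RtoC (y ^ 1))))%C
    with (z / e * beta a e z - (z / e + 0) * Lam a e z (fun y => RtoC (y ^ 1)))%C.
  - rewrite <- M. ring.
  - ring.
Qed.
End LamTheory.

(** The sequence whose limit is [Gamma], not to be confused with Euler's integral. *)
Definition euler (a : C) (n : nat) : C :=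
  (RtoC (INR (fact n)) * Rcpow (INR n) a / poch a (S n))%C.

Lemma poch_shift (a : C) (n : nat) : poch a (S n) = (a * poch (a + 1) n)%C.
Proof.
  induction n as [|n IH].
  - simpl. ring.
  - change (poch a (S (S n))) with (poch a (S n) * (a + INR (S n)))%C.
    change (poch (a + 1) (S n))%C with (poch (a + 1) n * (a + 1 + INR n))%C.
    rewrite IH, S_INR, RtoC_plus. ring.
Qed.

Lemma poch_neq_0 (a : C) (n : nat) : (forall k : nat, a + RtoC (INR k) <> 0)%C -> poch a n <> 0%C.
Proof.
  intros H. induction n; simpl; [apply RtoC_neq_0; lra|]. apply Cmult_neq_0; auto.
Qed.

Lemma Re_pos_shift_neq_0 (a : C) (k : nat) : 0 < Re a -> (a + RtoC (INR k) <> 0)%C.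
Proof.
  intros H E. apply (f_equal Re) in E. rewrite re_plus, !re_RtoC in E. generalize (pos_INR k). lra.
Qed.

(** At c = a + 1 the integrand times a is the exact derivative of (X e t)^a, and X e t increases to
    1 / e. *)
Lemma beta_gauss_0 (a : C) (e : R) : 0 < e -> 1 < Re a ->
  (a * beta a e (RtoC e * (1 + a)) = Rcpow (/ e) a)%C.
Proof.
  intros He Ha.
  assert (HeC : RtoC e <> 0%C) by (apply RtoC_neq_0; lra).
  assert (Hz : e * Re a < Re (RtoC e * (1 + a))%C).
  { rewrite Cmult_comm, re_scal_r, re_plus, re_RtoC. lra. }
  unfold beta, Lam.
  assert (T : istame (fun t => (dens a e (RtoC e * (1 + a)) t * RtoC 1)%C)).
  { refine (dens_G_tame a e _ (fun _ => RtoC 1) 1 He Ha Hz _).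
    apply bcont_1. }
  rewrite <- L_scal by exact T.
  rewrite (L_ftc (fun t => pw (X e t) a) _ (Rcpow (/ e) a)).
  - rewrite X_at_0, (pw_nonpos 0) by lra. ring.
  - intros t Ht. eapply cder_eq; [|apply (cder_comp _ _ _ _ _ (cder_pw a (X e t) Ha) (is_derive_X e t))].
    unfold dens. rewrite eX. replace (1 - (1 - exp (- (e * t)))) with (exp (- (e * t))) by ring.
    replace ((a * e - e * (1 + a)) * t)%C with (RtoC (- (e * t))) by (rewrite RtoC_opp, RtoC_mult; ring).
    rewrite Cexp_RtoC. ring.
  - apply istame_scal, T.
  - rewrite <- (pw_pos (/ e)) by (apply Rinv_0_lt_compat, He).
    apply pw_tends; [lra|]. apply filterlim_locally. intros eps.
    destruct (exp_decay_small (/ e) e eps He (cond_pos eps)) as (A0 & H0 & HA).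
    exists A0. intros t Ht. change (Rabs (X e t - / e) < eps).
    replace (X e t - / e) with (- (/ e * exp (- e * t))).
    + rewrite Rabs_Ropp, Rabs_pos_eq; [apply HA; lra|].
      apply Rmult_le_pos; [left; apply Rinv_0_lt_compat, He|left; apply exp_pos].
    + rewrite X_e by lra. replace (- e * t) with (- (e * t)) by ring. field. lra.
Qed.

(** This is B(a, n + 1) = n! / (a)_(n + 1), up to the scaling e^(-a); at e = 1 / n it expresses
    [euler a n] as an integral. *)
Lemma beta_gauss (a : C) (e : R) (n : nat) : 0 < e -> 1 < Re a ->
  (poch a (S n) * beta a e (RtoC e * (1 + RtoC (INR n) + a)) = RtoC (INR (fact n)) * Rcpow (/ e) a)%C.
Proof.
  intros He Ha.
  assert (HeC : RtoC e <> 0%C) by (apply RtoC_neq_0; lra).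
  induction n as [|n IH].
  - simpl. rewrite <- (beta_gauss_0 a e He Ha). rewrite !Cmult_1_l.
    replace (1 + 0 + a)%C with (1 + a)%C by ring. ring.
  - assert (Hz : e * Re a < Re (RtoC e * (1 + RtoC (INR n) + a))%C).
    { rewrite Cmult_comm, re_scal_r, !re_plus, !re_RtoC. generalize (pos_INR n). nra. }
    assert (S1 := beta_shift a e _ He Ha Hz).
    replace (RtoC e * (1 + RtoC (INR n) + a) / RtoC e)%C with (1 + RtoC (INR n) + a)%C in S1 by (field; exact HeC).
    replace (RtoC e * (1 + RtoC (INR n) + a) + RtoC e)%C
      with (RtoC e * (1 + RtoC (INR (S n)) + a))%C in S1 by (rewrite S_INR, RtoC_plus; ring).
    change (poch a (S (S n))) with (poch a (S n) * (a + INR (S n)))%C.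
    rewrite fact_simpl, mult_INR, RtoC_mult, <- Cmult_assoc, <- Cmult_assoc, <- IH.
    replace (a + INR (S n))%C with (1 + INR n + a)%C by (rewrite S_INR, RtoC_plus; ring).
    rewrite S1, S_INR, RtoC_plus. ring.
Qed.

(** Euler's integral of t^(a - 1) exp (- t), written as a value of [kern] so that the limit theorem
    for [kern] applies to it. *)
Definition GI (a : C) : C := L (kern (a - 1) 0%C 0%C 0 0 1).

Lemma filterlim_inv_INR : filterlim (fun n : nat => / INR n) eventually (locally 0).
Proof.
  apply (is_lim_seq_inv INR p_infty); [apply is_lim_seq_INR|discriminate].
Qed.

(** With e = 1 / n the beta integral for [euler a n] has exponent - (1 + 1 / n) t, that is, it is
    [kern] at x = 1 + 1 / n; letting n grow is the limit e to 0. *)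
Lemma gauss_tends (a : C) : 1 < Re a -> ctends eventually (euler a) (GI a).
Proof.
  intros Ha.
  apply ctends_ext_loc with (fun n => L (kern (a - 1) 0%C 0%C 0 (/ INR n) (1 + / INR n))).
  - exists 1%nat. intros n Hn.
    assert (Hn0 : 0 < INR n) by (apply lt_0_INR; lia).
    assert (HnC : RtoC (INR n) <> 0%C) by (apply RtoC_neq_0; lra).
    assert (He : 0 < / INR n) by (apply Rinv_0_lt_compat, Hn0).
    assert (B := beta_gauss a (/ INR n) n He Ha). rewrite Rinv_inv in B.
    assert (Hp : poch a (S n) <> 0%C).
    { apply poch_neq_0. intros k. apply Re_pos_shift_neq_0. lra. }
    unfold euler. rewrite <- B.
    transitivity (beta a (/ INR n) (RtoC (/ INR n) * (1 + RtoC (INR n) + a))%C); [|field; exact Hp].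
    unfold beta, Lam. symmetry. apply L_ext.
    + intros t Ht. unfold dens, kern. rewrite Copp_0, Rcpow_0. simpl pow.
      replace ((a * RtoC (/ INR n) - RtoC (/ INR n) * (1 + RtoC (INR n) + a)) * t)%C
        with ((0 * RtoC (/ INR n) - RtoC (1 + / INR n)) * t)%C; [ring|].
      rewrite RtoC_plus, RtoC_inv by lra. field. exact HnC.
    + refine (dens_G_tame a _ _ (fun _ => RtoC 1) 1 He Ha _ _).
      * rewrite Cmult_comm, re_scal_r, !re_plus, !re_RtoC. rewrite Rmult_comm. apply Rmult_lt_compat_r; lra.
      * apply bcont_1.
  - apply L_kern_tends.
    + rewrite Re_minus, re_RtoC. lra.
    + lra.
    + exists 1%nat. intros n Hn. left. apply Rinv_0_lt_compat, lt_0_INR. lia.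
    + apply filterlim_inv_INR.
    + assert (H := is_lim_seq_plus' (fun _ => 1) (fun n => / INR n) 1 0 (is_lim_seq_const 1) filterlim_inv_INR).
      rewrite Rplus_0_r in H. exact H.
Qed.

(** * The Gamma function *)

Lemma Lr_pos (g : R -> R) K lam : rtame g K lam -> (forall t, 0 <= t -> 0 <= g t) ->
  (forall t, 0 < t < 1 -> 0 < g t) -> 0 < Lr g.
Proof.
  intros Ht H0 H1.
  assert (P : 0 < RInt g 0 1).
  { apply RInt_gt_0; [lra|exact H1|]. intros x Hx. apply Ht. lra. }
  apply Rlt_le_trans with (RInt g 0 1); [exact P|].
  refine (filterlim_le (F := Rbar_locally p_infty) (fun _ => RInt g 0 1) (fun A => RInt g 0 A)
     (Finite (RInt g 0 1)) (Finite (Lr g)) _ _ _).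
  - exists 1. intros A HA. rewrite (RInt_Chasles_cont g 0 1 A) by (apply Ht || lra).
    assert (0 <= RInt g 1 A); [|lra].
    apply RInt_ge_0; [lra|apply ex_RInt_cont; [lra|lra|apply Ht]|]. intros x Hx. apply H0. lra.
  - apply filterlim_const.
  - exact (Lr_lim g K lam Ht).
Qed.

Lemma kern_istame (p b q : C) (j : nat) (e x : R) : 0 < Re p -> 0 <= e <= 1 -> Re q * e < x ->
  istame (kern p b q j e x).
Proof.
  intros Hp He Hx.
  assert (Hpp : 0 <= Re p + Rabs (Re b) + INR j).
  { generalize (Rabs_pos (Re b)) (pos_INR j). lra. }
  destruct (power_le_exp _ ((x - Re q * e) / 2) Hpp ltac:(lra)) as (K & HK & HG).
  exists K, ((x - Re q * e) / 2). split; [lra|]. split.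
  - intros t Ht. apply kern_ccont; assumption.
  - intros t Ht. eapply Rle_trans; [apply kern_bound; [lra|lra|exact Ht]|].
    apply Rle_trans with (K * exp ((x - Re q * e) / 2 * t) * exp ((Re q * e - x) * t)).
    + apply Rmult_le_compat_r; [left; apply exp_pos|apply HG, Ht].
    + right. rewrite Rmult_assoc, <- exp_plus. f_equal. f_equal. lra.
Qed.

Lemma GI_real_neq_0 (a : R) : 1 < a -> GI (RtoC a) <> 0%C.
Proof.
  intros Ha E. apply (f_equal Re) in E. rewrite re_RtoC in E.
  change (Lr (fun t => Re (kern (RtoC a - 1) 0%C 0%C 0 0 1 t)) = 0) in E.
  assert (T : istame (kern (RtoC a - 1) 0%C 0%C 0 0 1)).
  { apply kern_istame; [rewrite Re_minus, !re_RtoC; lra|lra|rewrite re_RtoC; lra]. }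
  destruct T as (K & lam & T). apply tame_re in T.
  assert (V : forall t, 0 < t -> Re (kern (RtoC a - 1) 0%C 0%C 0 0 1 t) = Rpower t (a - 1) * exp (- t)).
  { intros t Ht. unfold kern. rewrite X_0, pw_pos, Copp_0, Rcpow_0 by exact Ht.
    rewrite <- RtoC_minus, Rcpow_RtoC.
    replace ((0 * 0 - 1) * t)%C with (RtoC (- t)) by (rewrite RtoC_opp; ring).
    rewrite Cexp_RtoC, Cmult_1_r, <- !RtoC_mult, re_RtoC. simpl. ring. }
  assert (P := Lr_pos _ _ _ T). rewrite E in P. apply (Rlt_irrefl 0). apply P.
  - intros t [Ht| <-].
    + rewrite V by exact Ht. left. apply Rmult_lt_0_compat; apply exp_pos.
    + unfold kern. rewrite X_0, (pw_nonpos 0), !Cmult_0_l, Cmult_0_r, re_RtoC by lra. lra.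
  - intros t Ht. rewrite V by lra. apply Rmult_lt_0_compat; apply exp_pos.
Qed.

(** The modulus of [(a)_n] exceeds [(Re a)_n] by a factor that stays bounded, since
    [sum_j (Im a / (Re a + j))^2] converges. *)
Lemma Cmod_poch_le (a : C) (n : nat) : 1 < Re a ->
  Cmod (poch a n) <= Cmod (poch (RtoC (Re a)) n)
    * exp (Im a ^ 2 / 2 * (/ (Re a - 1) - / (Re a - 1 + INR n))).
Proof.
  intros Ha. induction n as [|n IH].
  - simpl. rewrite Rplus_0_r, Rminus_diag, Rmult_0_r, exp_0, Cmod_1. lra.
  - simpl poch. rewrite !Cmod_mult.
    assert (Hn := pos_INR n).
    set (s := Re a + INR n). assert (Hs : 1 < s) by (unfold s; lra).
    (* With s = Re a + n, |a + n|^2 = s^2 (1 + (Im a)^2 / s^2), and 1 / s^2 <= 1 / (s - 1) - 1 / s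
       makes the exponents telescope. *)
    assert (M : Cmod (a + INR n)%C <= s * exp (Im a ^ 2 / 2 * (/ (s - 1) - / s))).
    { apply Rsqr_incr_0_var; [|apply Rmult_le_pos; [lra|left; apply exp_pos]].
      rewrite Rsqr_pow2, Cmod2_alt.
      replace (Re (a + INR n)%C) with s by reflexivity.
      replace (Im (a + INR n)%C) with (Im a) by (simpl; unfold Im; ring).
      unfold Rsqr.
      replace (s * exp (Im a ^ 2 / 2 * (/ (s - 1) - / s)) * (s * exp (Im a ^ 2 / 2 * (/ (s - 1) - / s))))
        with (s ^ 2 * exp (Im a ^ 2 * (/ (s - 1) - / s))).
      2: { rewrite <- (Rmult_1_r (Im a ^ 2)) at 1. replace 1 with (/ 2 + / 2) at 1 by lra.
           replace (Im a ^ 2 * (/ 2 + / 2) * (/ (s - 1) - / s))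
             with (Im a ^ 2 / 2 * (/ (s - 1) - / s) + Im a ^ 2 / 2 * (/ (s - 1) - / s)) by (unfold Rdiv; ring).
           rewrite exp_plus. ring. }
      assert (E := exp_ineq1_le (Im a ^ 2 * (/ (s - 1) - / s))).
      apply Rle_trans with (s ^ 2 * (1 + Im a ^ 2 * (/ (s - 1) - / s))); [|apply Rmult_le_compat_l; nra].
      replace (s ^ 2 * (1 + Im a ^ 2 * (/ (s - 1) - / s))) with (s ^ 2 + Im a ^ 2 * (s / (s - 1))) by (field; lra).
      assert (1 <= s / (s - 1)) by (apply Rle_div_r; lra).
      assert (0 <= Im a ^ 2) by nra. nra. }
    assert (N : Cmod (RtoC (Re a) + INR n)%C = s).
    { rewrite <- RtoC_plus, Cmod_R, Rabs_pos_eq; [reflexivity|lra]. }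
    rewrite N, S_INR.
    apply Rle_trans with (Cmod (poch (RtoC (Re a)) n) * exp (Im a ^ 2 / 2 * (/ (Re a - 1) - / (Re a - 1 + INR n)))
       * (s * exp (Im a ^ 2 / 2 * (/ (s - 1) - / s)))).
    + apply Rmult_le_compat; auto using Cmod_ge_0.
    + right.
      replace (Im a ^ 2 / 2 * (/ (Re a - 1) - / (Re a - 1 + (INR n + 1))))
        with (Im a ^ 2 / 2 * (/ (Re a - 1) - / (Re a - 1 + INR n)) + Im a ^ 2 / 2 * (/ (s - 1) - / s)).
      * rewrite exp_plus. ring.
      * unfold s. field. lra.
Qed.

(** [Cmod_poch_le] bounds |euler a n| from below by |euler (Re a) n| / B with B independent of n,
    and at the real point the integral is positive. *)
Lemma GI_neq_0 (a : C) : 1 < Re a -> GI a <> 0%C.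
Proof.
  intros Ha. apply Cmod_gt_0.
  pose (B := exp (Im a ^ 2 / 2 * / (Re a - 1))). assert (HB : 0 < B) by apply exp_pos.
  assert (P : 0 < Cmod (GI (RtoC (Re a)))) by (apply Cmod_gt_0, GI_real_neq_0, Ha).
  apply Rlt_le_trans with (Cmod (GI (RtoC (Re a))) * / B).
  { apply Rmult_lt_0_compat; [exact P|apply Rinv_0_lt_compat, HB]. }
  assert (L1 := ctends_Cmod _ _ (gauss_tends a Ha)).
  assert (L2 := ctends_Cmod _ _ (gauss_tends (RtoC (Re a)) Ha)).
  refine (is_lim_seq_le (fun n => Cmod (euler (RtoC (Re a)) n) * / B) (fun n => Cmod (euler a n)) (Finite _) (Finite _) _ _ _).
  - intros n. apply Rle_div_l; [exact HB|].
    assert (N1 : poch a (S n) <> 0%C) by (apply poch_neq_0; intros k; apply Re_pos_shift_neq_0; lra).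
    assert (N2 : poch (RtoC (Re a)) (S n) <> 0%C)
      by (apply poch_neq_0; intros k; apply Re_pos_shift_neq_0; rewrite re_RtoC; lra).
    unfold euler. rewrite !Cmod_div, !Cmod_mult, !Cmod_Rcpow, re_RtoC by assumption.
    assert (Q1 : 0 < Cmod (poch a (S n))) by (apply Cmod_gt_0, N1).
    assert (Q2 : 0 < Cmod (poch (RtoC (Re a)) (S n))) by (apply Cmod_gt_0, N2).
    assert (M := Cmod_poch_le a (S n) Ha).
    assert (M2 : Cmod (poch a (S n)) <= Cmod (poch (RtoC (Re a)) (S n)) * B).
    { eapply Rle_trans; [exact M|]. apply Rmult_le_compat_l; [lra|]. apply exp_le_compat.
      apply Rmult_le_compat_l; [nra|].
      assert (0 < / (Re a - 1 + INR (S n))) by (apply Rinv_0_lt_compat; generalize (pos_INR (S n)); lra). lra. }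
    set (T := Cmod (INR (fact n)) * exp (Re a * ln (INR n))).
    assert (HT : 0 <= T) by (apply Rmult_le_pos; [apply Cmod_ge_0|left; apply exp_pos]).
    set (p1 := Cmod (poch a (S n))) in *. set (p2 := Cmod (poch (RtoC (Re a)) (S n))) in *.
    unfold Rdiv. rewrite Rmult_assoc. apply Rmult_le_compat_l; [exact HT|].
    apply Rmult_le_reg_r with (p1 * p2); [apply Rmult_lt_0_compat; assumption|].
    replace (/ p2 * (p1 * p2)) with p1 by (field; lra).
    replace (/ p1 * B * (p1 * p2)) with (p2 * B) by (field; lra). exact M2.
  - apply is_lim_seq_mult'; [exact L2|apply is_lim_seq_const].
  - exact L1.
Qed.

Lemma ctends_eventually_Clim_seq (f : nat -> C) (l : C) : ctends eventually f l -> Clim_seq f = l.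
Proof.
  intros H. unfold Clim_seq. apply Ceq; simpl.
  - rewrite (is_lim_seq_unique _ (Finite (Re l))); [reflexivity|]. exact (ctends_re _ _ H).
  - rewrite (is_lim_seq_unique _ (Finite (Im l))); [reflexivity|]. exact (ctends_im _ _ H).
Qed.

Definition regular (a : C) : Prop := forall k : nat, (a + RtoC (INR k) <> 0)%C.

Lemma regular_succ (a : C) : regular a -> regular (a + 1)%C.
Proof.
  intros H k. replace (a + 1 + INR k)%C with (a + INR (S k))%C by (rewrite S_INR, RtoC_plus; ring).
  apply H.
Qed.

(** Gamma(a) = Gamma(a + 1) / a before the limit; the correction 1 + (a + 1) / n tends to 1. *)
Lemma euler_succ (a : C) (n : nat) : regular a -> (0 < n)%nat ->
  euler a n = (euler (a + 1) n * ((1 + (a + 1) * RtoC (/ INR n)) / a))%C.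
Proof.
  intros Ha Hn. assert (Hn0 : 0 < INR n) by (apply lt_0_INR, Hn).
  assert (HnC : RtoC (INR n) <> 0%C) by (apply RtoC_neq_0; lra).
  assert (N0 : a <> 0%C) by (intros E; apply (Ha 0%nat); simpl; rewrite E; ring).
  unfold euler. rewrite Rcpow_plus, Rcpow_1 by exact Hn0.
  assert (P1 : poch a (S n) <> 0%C) by (apply poch_neq_0, Ha).
  assert (P2 : poch (a + 1)%C (S n) <> 0%C) by (apply poch_neq_0, regular_succ, Ha).
  assert (E : (poch (a + 1) (S n) * a = poch a (S n) * (a + 1 + INR n))%C).
  { rewrite Cmult_comm, <- poch_shift. simpl poch.
    change (match n with 0%nat => 1 | S _ => INR n + 1 end) with (INR (S n)).
    rewrite S_INR, RtoC_plus. ring. }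
  rewrite RtoC_inv by lra.
  assert (P3 : (a + 1 + INR n)%C <> 0%C) by (apply regular_succ, Ha).
  replace (poch (a + 1)%C (S n)) with (poch a (S n) * (a + 1 + INR n) / a)%C by (rewrite <- E; field; exact N0).
  field. repeat split; assumption.
Qed.

(** Induction on the number of unit shifts needed to bring a into Re a > 1, where the integral is
    available. Nonvanishing of the limit is carried along since Gamma values are later inverted. *)
Lemma euler_conv (a : C) : regular a -> exists l : C, l <> 0%C /\ ctends eventually (euler a) l.
Proof.
  intros Ha.
  assert (G : forall (N : nat) (a : C), regular a -> 1 < Re a + INR N ->
                exists l : C, l <> 0%C /\ ctends eventually (euler a) l).
  { clear a Ha. induction N as [|N IH]; intros a Ha HN.
    - rewrite Rplus_0_r in HN. exists (GI a). split; [apply GI_neq_0, HN|apply gauss_tends, HN].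
    - destruct (IH (a + 1)%C (regular_succ a Ha)) as (l & Hl & H).
      { rewrite re_plus, re_RtoC. rewrite S_INR in HN. lra. }
      assert (N0 : a <> 0%C) by (intros E; apply (Ha 0%nat); simpl; rewrite E; ring).
      exists (l * ((1 + (a + 1) * 0) / a))%C. split.
      + apply Cmult_neq_0; [exact Hl|]. replace ((1 + (a + 1) * 0) / a)%C with (/ a)%C by (field; exact N0).
        intros E. apply (Cmult_neq_0 a (/ a)); try exact N0; [|].
        * intros E'. apply C1_nz. rewrite <- (Cinv_r a N0), E'. ring.
        * rewrite E. ring.
      + apply ctends_ext_loc with (fun n => (euler (a + 1) n * ((1 + (a + 1) * RtoC (/ INR n)) / a))%C).
        * exists 1%nat. intros n Hn. symmetry. apply euler_succ; [exact Ha|lia].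
        * apply ctends_mult; [exact H|]. apply ctends_div; [exact N0| |apply ctends_const].
          apply ctends_plus; [apply ctends_const|]. apply ctends_mult; [apply ctends_const|].
          apply ctends_RtoC, filterlim_inv_INR. }
  destruct (nfloor_ex (Rabs (Re a) + 2)) as (N & _ & HN); [generalize (Rabs_pos (Re a)); lra|].
  apply (G (S N) a Ha). rewrite S_INR. generalize (Rle_abs (- Re a)). rewrite Rabs_Ropp. lra.
Qed.

Lemma Gamma_spec (a : C) : regular a -> Gamma a <> 0%C /\ ctends eventually (euler a) (Gamma a).
Proof.
  intros Ha. destruct (euler_conv a Ha) as (l & Hl & H).
  replace (Gamma a) with l; [split; assumption|].
  symmetry. apply ctends_eventually_Clim_seq. exact H.
Qed.

Lemma Re_pos_regular (a : C) : 0 < Re a -> regular a.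
Proof. intros H k. apply Re_pos_shift_neq_0, H. Qed.

Lemma Gamma_GI (a : C) : 1 < Re a -> Gamma a = GI a.
Proof.
  intros Ha. apply (ctends_unique (F := eventually) (euler a)); [|apply gauss_tends, Ha].
  apply Gamma_spec, Re_pos_regular. lra.
Qed.

Lemma Gamma_succ (a : C) : regular a -> Gamma (a + 1)%C = (a * Gamma a)%C.
Proof.
  intros Ha. assert (N0 : a <> 0%C) by (intros E; apply (Ha 0%nat); simpl; rewrite E; ring).
  destruct (Gamma_spec a Ha) as [_ H1]. destruct (Gamma_spec _ (regular_succ a Ha)) as [_ H2].
  assert (E : Gamma a = (Gamma (a + 1) * ((1 + (a + 1) * 0) / a))%C).
  { apply (ctends_unique (F := eventually) (euler a)); [exact H1|].
    apply ctends_ext_loc with (fun n => (euler (a + 1) n * ((1 + (a + 1) * RtoC (/ INR n)) / a))%C).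
    - exists 1%nat. intros n Hn. symmetry. apply euler_succ; [exact Ha|lia].
    - apply ctends_mult; [exact H2|]. apply ctends_div; [exact N0| |apply ctends_const].
      apply ctends_plus; [apply ctends_const|]. apply ctends_mult; [apply ctends_const|].
      apply ctends_RtoC, filterlim_inv_INR. }
  rewrite E. field. exact N0.
Qed.

Lemma Gamma_poch (a : C) (n : nat) : regular a -> Gamma (a + RtoC (INR n))%C = (poch a n * Gamma a)%C.
Proof.
  intros Ha. induction n as [|n IH].
  - simpl. rewrite Cplus_0_r. ring.
  - replace (a + INR (S n))%C with (a + INR n + 1)%C by (rewrite S_INR, RtoC_plus; ring).
    rewrite Gamma_succ, IH.
    + simpl. ring.
    + intros k. replace (a + INR n + INR k)%C with (a + INR (n + k))%C by (rewrite plus_INR, RtoC_plus; ring).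
      apply Ha.
Qed.

Lemma poch_1 (n : nat) : poch 1%C n = RtoC (INR (fact n)).
Proof.
  induction n as [|n IH]; [reflexivity|].
  simpl poch. rewrite IH, fact_simpl, mult_INR, S_INR, RtoC_mult, RtoC_plus. ring.
Qed.

Lemma Gamma_1 : Gamma 1%C = 1%C.
Proof.
  apply (ctends_unique (F := eventually) (euler 1%C)).
  - apply Gamma_spec, Re_pos_regular. rewrite re_RtoC. lra.
  - assert (FN : forall n, RtoC (INR (fact n)) <> 0%C) by (intros; apply RtoC_neq_0, INR_fact_neq_0).
    apply ctends_ext_loc with (fun n => (/ (1 + RtoC (/ INR n)))%C).
    + exists 1%nat. intros n Hn. assert (Hn0 : 0 < INR n) by (apply lt_0_INR; lia).
      assert (HnC : RtoC (INR n) <> 0%C) by (apply RtoC_neq_0; lra).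
      assert (HnC1 : RtoC (INR n + 1) <> 0%C) by (apply RtoC_neq_0; lra). rewrite RtoC_plus in HnC1.
      unfold euler. rewrite poch_1, Rcpow_1, fact_simpl, mult_INR, RtoC_mult, S_INR, RtoC_plus, RtoC_inv by lra.
      field. repeat split; auto.
    + enough (Q : ctends eventually (fun n => (/ (1 + RtoC (/ INR n)))%C) (/ (1 + 0))%C).
      { replace (/ (1 + 0))%C with (RtoC 1) in Q; [exact Q|].
        rewrite Cplus_0_r. field. }
      apply ctends_inv; [rewrite Cplus_0_r; apply C1_nz|].
      apply ctends_plus; [apply ctends_const|]. apply ctends_RtoC, filterlim_inv_INR.
Qed.

(** The substitution t to t / n in B(b, x + n + 1): it shows that n^b B(b, x + n + 1) tends to
    Gamma(b). *)
Lemma beta_scaled (b x : C) (n : nat) : 1 < Re b -> 0 < Re x -> (0 < n)%nat ->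
  beta b 1 (x + RtoC (INR (S n)) + b)%C
   = (Rcpow (/ INR n) b * L (kern (b - 1) 0%C (- x) 0 (/ INR n) (1 + / INR n)))%C.
Proof.
  intros Hb Hx Hn. assert (Hn0 : 0 < INR n) by (apply lt_0_INR, Hn).
  assert (He : 0 < / INR n) by (apply Rinv_0_lt_compat, Hn0).
  assert (HnC : RtoC (INR n) <> 0%C) by (apply RtoC_neq_0; lra).
  set (f := fun t => (dens b 1 (x + RtoC (INR (S n)) + b) t * RtoC 1)%C).
  assert (Tf : istame f).
  { refine (dens_G_tame b 1 _ (fun _ => RtoC 1) 1 Rlt_0_1 Hb _ _).
    - rewrite !re_plus, !re_RtoC. generalize (pos_INR (S n)). lra.
    - apply bcont_1. }
  change (beta b 1 (x + INR (S n) + b)%C) with (L f).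
  rewrite <- (L_scale f (/ INR n) He Tf).
  assert (E : forall t, 0 < t -> (Rcpow (/ INR n) b * kern (b - 1) 0%C (- x) 0 (/ INR n) (1 + / INR n) t
              = RtoC (/ INR n) * f (/ INR n * t)%R)%C).
  { intros t Ht. unfold f, kern, dens. rewrite Copp_0, Rcpow_0.
    assert (HX : X 1 (/ INR n * t) = / INR n * X (/ INR n) t).
    { rewrite eX, X_e by lra. rewrite Rmult_1_l. field. }
    rewrite HX, pw_mult; [|exact He|apply X_nonneg; lra].
    replace (Rcpow (/ INR n) b) with (RtoC (/ INR n) * Rcpow (/ INR n) (b - 1))%C.
    2: { rewrite <- (Rcpow_1 (/ INR n) He) at 1. rewrite <- Rcpow_plus. f_equal. ring. }
    replace ((b * 1 - (x + INR (S n) + b)) * RtoC (/ INR n * t))%C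
      with ((- x * RtoC (/ INR n) - RtoC (1 + / INR n)) * t)%C.
    - simpl pow. ring.
    - rewrite RtoC_mult, S_INR, !RtoC_plus, RtoC_inv by lra. field. exact HnC. }
  assert (TK : istame (kern (b - 1) 0%C (- x) 0 (/ INR n) (1 + / INR n))).
  { apply kern_istame.
    - rewrite Re_minus, re_RtoC. lra.
    - split; [lra|]. rewrite <- Rinv_1. apply Rinv_le_contravar; [lra|].
      apply (le_INR 1). lia.
    - rewrite re_opp. nra. }
  rewrite <- (L_ext _ _ E).
  - apply L_scal, TK.
  - apply istame_scal, TK.
Qed.

Lemma beta_recur (b x : C) (n : nat) : 1 < Re b -> 0 < Re x ->
  (poch x n * beta b 1 (x + b) = poch (x + b) n * beta b 1 (x + RtoC (INR n) + b))%C.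
Proof.
  intros Hb Hx. induction n as [|n IH].
  - simpl. rewrite Cplus_0_r. reflexivity.
  - assert (Hz : 1 * Re b < Re (x + RtoC (INR n) + b)%C).
    { rewrite !re_plus, re_RtoC. generalize (pos_INR n). lra. }
    assert (S1 := beta_shift b 1 _ Rlt_0_1 Hb Hz).
    replace ((x + RtoC (INR n) + b) / 1)%C with (x + RtoC (INR n) + b)%C in S1 by (field; apply C1_nz).
    simpl poch.
    transitivity ((x + INR n) * (poch x n * beta b 1 (x + b)))%C; [ring|]. rewrite IH.
    replace (x + INR (S n) + b)%C with (x + INR n + b + 1)%C by (rewrite S_INR, RtoC_plus; ring).
    replace (poch (x + b) n * (x + b + INR n) * beta b 1 (x + INR n + b + 1))%C
      with (poch (x + b) n * ((x + INR n + b) * beta b 1 (x + INR n + b + 1)))%C by ring.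
    rewrite S1. ring.
Qed.

(** B(b, x) = Gamma(x) Gamma(b) / Gamma(x + b). The shift recursion relates B(b, x) to B(b, x + n +
    1) by a quotient of Pochhammer symbols, which is a quotient of Euler sequences up to n^b; the
    remaining integral tends to Gamma(b). *)
Lemma Gamma_beta (b x : C) : 1 < Re b -> 0 < Re x ->
  (beta b 1 (x + b) * Gamma (x + b) = Gamma x * Gamma b)%C.
Proof.
  intros Hb Hx.
  destruct (Gamma_spec x (Re_pos_regular x Hx)) as [N1 H1].
  assert (Hxb : 0 < Re (x + b)%C) by (rewrite re_plus; lra).
  destruct (Gamma_spec _ (Re_pos_regular _ Hxb)) as [N2 H2].
  rewrite (Gamma_GI b Hb).
  apply (ctends_unique (F := eventually) (fun n => (beta b 1 (x + b) * euler (x + b) n)%C)).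
  { apply ctends_mult; [apply ctends_const|exact H2]. }
  apply ctends_ext_loc with (fun n => (euler x n * L (kern (b - 1) 0%C (- x) 0 (/ INR n) (1 + / INR n)))%C).
  - exists 1%nat. intros n Hn. assert (Hn0 : 0 < INR n) by (apply lt_0_INR; lia).
    assert (R1 := beta_recur b x (S n) Hb Hx).
    rewrite beta_scaled in R1 by (assumption || lia).
    set (I := L _) in *.
    assert (P1 : poch x (S n) <> 0%C) by (apply poch_neq_0, Re_pos_regular, Hx).
    assert (P2 : poch (x + b)%C (S n) <> 0%C) by (apply poch_neq_0, Re_pos_regular, Hxb).
    assert (EI : (Rcpow (INR n) b * Rcpow (/ INR n) b = 1)%C).
    { rewrite <- Rcpow_mult, Rinv_r by (try apply Rinv_0_lt_compat; lra). apply Rcpow_base_1. }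
    unfold euler. rewrite Rcpow_plus.
    replace (beta b 1 (x + b)) with (poch (x + b) (S n) * (Rcpow (/ INR n) b * I) / poch x (S n))%C
      by (rewrite <- R1; field; exact P1).
    transitivity (INR (fact n) * Rcpow (INR n) x / poch x (S n) * I * (Rcpow (INR n) b * Rcpow (/ INR n) b))%C.
    + rewrite EI. ring.
    + field. split; assumption.
  - apply ctends_mult; [exact H1|].
    replace (GI b) with (L (kern (b - 1) 0%C (- x) 0 0 1)).
    + apply L_kern_tends.
      * rewrite Re_minus, re_RtoC. lra.
      * lra.
      * exists 1%nat. intros n Hn. left. apply Rinv_0_lt_compat, lt_0_INR. lia.
      * apply filterlim_inv_INR.
      * assert (H := is_lim_seq_plus' (fun _ => 1) (fun n => / INR n) 1 0 (is_lim_seq_const 1) filterlim_inv_INR).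
        rewrite Rplus_0_r in H. exact H.
    + unfold GI. apply L_ext.
      * intros t _. unfold kern. do 3 f_equal. ring.
      * apply kern_istame; [rewrite Re_minus, !re_RtoC; lra|lra|rewrite Rmult_0_r; lra].
Qed.

Lemma beta_neq_0 (b x : C) : 1 < Re b -> 0 < Re x -> beta b 1 (x + b) <> 0%C.
Proof.
  intros Hb Hx E. assert (G := Gamma_beta b x Hb Hx). rewrite E, Cmult_0_l in G.
  symmetry in G. revert G. apply Cmult_neq_0; apply Gamma_spec, Re_pos_regular; lra.
Qed.

(** Shifting x by h multiplies the integrand by exp (- h t). Differentiability of Gamma quotients,
    hence of [sqrt_psi], is drawn from this. *)
Lemma beta_cder (b x : C) (h0 : R) : 1 < Re b -> 0 < Re x + h0 ->
  exists l : C, cder (fun h => beta b 1 (x + RtoC h + b)%C) h0 l.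
Proof.
  intros Hb Hx.
  set (f := fun t => (dens b 1 (x + RtoC h0 + b) t * RtoC 1)%C).
  assert (Tf : istame f).
  { refine (dens_G_tame b 1 _ (fun _ => RtoC 1) 1 Rlt_0_1 Hb _ _).
    - rewrite !re_plus, !re_RtoC. lra.
    - apply bcont_1. }
  assert (D := L_der f Tf).
  assert (D' : is_derive (fun h => h - h0) h0 1) by (auto_derive; [trivial|ring]).
  replace 0 with ((fun h => h - h0) h0) in D by (simpl; ring).
  eexists. eapply cder_ext; [|exact (cder_comp _ (fun h => h - h0) _ _ _ D D')].
  intros h. cbv beta. unfold beta, Lam. f_equal. apply functional_extensionality. intros t.
  unfold f, dens. rewrite <- Cexp_RtoC.
  replace ((b * 1 - (x + h + b)) * t)%C with ((b * 1 - (x + h0 + b)) * t + RtoC (- ((h - h0) * t)))%C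
    by (rewrite RtoC_opp, RtoC_mult, RtoC_minus; ring).
  rewrite Cexp_plus. ring.
Qed.

(** * Uniqueness of the hypergeometric function *)

Fixpoint csum (f : nat -> C) (n : nat) : C :=
  match n with O => f O | S n' => (csum f n' + f (S n'))%C end.

Lemma pow_n_Cpow (w : C) (k : nat) : @pow_n C_AbsRing w k = (w ^ k)%C.
Proof. induction k as [|k IH]; [reflexivity|]. simpl. rewrite IH. reflexivity. Qed.

Lemma is_pseries_ctends (a : nat -> C) (w l : C) :
  @is_pseries C_AbsRing C_NormedModule a w l <->
  ctends eventually (csum (fun k => (w ^ k * a k)%C)) l.
Proof.
  assert (E : forall n, sum_n (fun k => scal (@pow_n C_AbsRing w k) (a k : C_NormedModule)) n
              = csum (fun k => (w ^ k * a k)%C) n).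
  { induction n as [|n IH].
    - rewrite sum_O. reflexivity.
    - rewrite sum_Sn, IH, pow_n_Cpow. reflexivity. }
  unfold is_pseries, is_series. split.
  - intros H. apply filterlim_ctends. intros P HP. destruct (H P HP) as [N HN]. exists N.
    intros n Hn. rewrite <- E. exact (HN n Hn).
  - intros H. apply ctends_filterlim in H. intros P HP. destruct (H P HP) as [N HN]. exists N.
    intros n Hn. rewrite E. exact (HN n Hn).
Qed.

Lemma ctends_csum_re (f : nat -> C) (l : C) :
  ctends eventually (csum f) l -> is_series (fun k => Re (f k)) (Re l).
Proof.
  intros H. apply ctends_re in H.
  assert (E : forall n, Re (csum f n) = sum_n (fun k => Re (f k)) n).
  { induction n as [|n IH]; [rewrite sum_O; reflexivity|].
    rewrite sum_Sn, <- IH. reflexivity. }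
  eapply filterlim_ext; [exact E|exact H].
Qed.

Lemma ctends_csum_im (f : nat -> C) (l : C) :
  ctends eventually (csum f) l -> is_series (fun k => Im (f k)) (Im l).
Proof.
  intros H. apply ctends_im in H.
  assert (E : forall n, Im (csum f n) = sum_n (fun k => Im (f k)) n).
  { induction n as [|n IH]; [rewrite sum_O; reflexivity|].
    rewrite sum_Sn, <- IH. reflexivity. }
  eapply filterlim_ext; [exact E|exact H].
Qed.

(** Vanishing on one side of 0 is enough: convergence at rho / 2 makes the radius positive, so the
    sum is continuous at 0 and its value there is a one-sided limit of zeros. *)
Lemma PSeries_zero_coef_0 (d : nat -> R) (rho : R) : 0 < rho ->
  (forall x, 0 < x < rho -> is_pseries d x 0) -> d 0%nat = 0.
Proof.
  intros Hr Hd. assert (R1 : Rbar_le (rho / 2) (CV_radius d)).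
  { apply Rbar_not_lt_le. intros Hlt. apply (CV_disk_outside d (rho / 2)).
    - rewrite Rabs_pos_eq by lra. exact Hlt.
    - apply ex_series_lim_0. exists 0. apply is_pseries_R. apply Hd. lra. }
  assert (Hc : continuity_pt (PSeries d) 0).
  { apply PSeries_continuity. rewrite Rabs_R0. eapply Rbar_lt_le_trans; [|exact R1]. simpl. lra. }
  apply continuity_pt_filterlim in Hc. rewrite PSeries_0 in Hc.
  assert (L1 : filterlim (PSeries d) (at_right 0) (locally (d 0%nat))).
  { intros P HP. apply filter_le_within. apply Hc, HP. }
  assert (L2 : filterlim (PSeries d) (at_right 0) (locally 0)).
  { apply filterlim_ext_loc with (fun _ => 0); [|apply filterlim_const].
    exists (mkposreal rho Hr). intros y Hy Hy0. change (Rabs (y - 0) < rho) in Hy.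
    symmetry. apply is_pseries_unique, Hd. rewrite Rminus_0_r, Rabs_pos_eq in Hy; lra. }
  exact (filterlim_locally_unique _ _ _ L1 L2).
Qed.

Lemma PSeries_zero_coef (n : nat) : forall (d : nat -> R) (rho : R), 0 < rho ->
  (forall x, 0 < x < rho -> is_pseries d x 0) -> d n = 0.
Proof.
  induction n as [|n IH]; intros d rho Hr Hd; [exact (PSeries_zero_coef_0 d rho Hr Hd)|].
  assert (D0 := PSeries_zero_coef_0 d rho Hr Hd).
  apply (IH (PS_decr_1 d) rho Hr).
  intros x Hx.
  assert (A := is_pseries_decr_1 d x (/ x) 0).
  replace 0 with (scal (/ x) (plus 0 (opp (d 0%nat)))).
  - apply A; [unfold mult, one; simpl; field; lra|]. apply Hd, Hx.
  - rewrite D0. unfold scal, plus, opp; simpl. unfold mult; simpl. ring.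
Qed.

Lemma csum_minus (f g : nat -> C) (n : nat) :
  csum (fun k => (f k - g k)%C) n = (csum f n - csum g n)%C.
Proof. induction n as [|n IH]; simpl; [reflexivity|]. rewrite IH. ring. Qed.

Lemma csum_ext (f g : nat -> C) (n : nat) : (forall k, f k = g k) -> csum f n = csum g n.
Proof. intros H. induction n as [|n IH]; simpl; rewrite H; [|rewrite IH]; reflexivity. Qed.

Lemma csum_0 (n : nat) : csum (fun _ => RtoC 0) n = 0%C.
Proof. induction n as [|n IH]; simpl; [reflexivity|]. rewrite IH. ring. Qed.

(** Agreement for s just below r0 is agreement on one side of the centre - r0. The real and
    imaginary parts of the difference are real power series vanishing on that side, so all Taylor
    coefficients agree and equality extends beyond r0. *)
Lemma analytic_local_identity (F G : C -> C) (r0 d : R) : 0 < d ->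
  analytic_at F (RtoC (- r0)) -> analytic_at G (RtoC (- r0)) ->
  (forall s, r0 - d < s < r0 -> F (RtoC (- s)) = G (RtoC (- s))) ->
  exists d', 0 < d' /\ forall s, Rabs (s - r0) < d' -> F (RtoC (- s)) = G (RtoC (- s)).
Proof.
  intros Hd (a & ra & Hra & HF) (b & rb & Hrb & HG) HE.
  pose (rho := Rmin d (Rmin ra rb)).
  assert (Hrho : 0 < rho) by (repeat apply Rmin_pos; assumption).
  assert (P : forall x, Rabs x < rho ->
     ctends eventually (csum (fun k => (RtoC x ^ k * (a k - b k))%C)) (F (RtoC (- r0 + x)) - G (RtoC (- r0 + x)))%C).
  { intros x Hx.
    assert (Hw : (RtoC (- r0 + x) - RtoC (- r0))%C = RtoC x) by (rewrite <- RtoC_minus; f_equal; ring).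
    assert (x1 : Rabs x < ra).
    { eapply Rlt_le_trans; [exact Hx|]. eapply Rle_trans; [apply Rmin_r|apply Rmin_l]. }
    assert (x2 : Rabs x < rb).
    { eapply Rlt_le_trans; [exact Hx|]. eapply Rle_trans; [apply Rmin_r|apply Rmin_r]. }
    assert (A := HF (RtoC (- r0 + x))). assert (B := HG (RtoC (- r0 + x))).
    rewrite Hw, Cmod_R in A, B. specialize (A x1). specialize (B x2).
    apply is_pseries_ctends in A. apply is_pseries_ctends in B.
    apply ctends_ext with (2 := ctends_minus _ _ _ _ A B).
    intros n. rewrite <- csum_minus. apply csum_ext. intros k. ring. }
  assert (Z : forall x, 0 < x < rho -> (F (RtoC (- r0 + x)) - G (RtoC (- r0 + x)))%C = 0%C).
  { intros x Hx. replace (- r0 + x) with (- (r0 - x)) by ring. rewrite HE; [ring|].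
    assert (rho <= d) by apply Rmin_l. lra. }
  assert (AB : forall k, (a k - b k)%C = 0%C).
  { intros k. apply Ceq.
    - apply (PSeries_zero_coef k (fun k => Re (a k - b k)%C) rho Hrho).
      intros x Hx. apply is_pseries_R. assert (Q := P x ltac:(rewrite Rabs_pos_eq; lra)).
      rewrite Z in Q by exact Hx. apply ctends_csum_re in Q.
      eapply is_series_ext; [|exact Q]. intros n. cbv beta. rewrite <- RtoC_pow, re_scal_l. apply Rmult_comm.
    - apply (PSeries_zero_coef k (fun k => Im (a k - b k)%C) rho Hrho).
      intros x Hx. apply is_pseries_R. assert (Q := P x ltac:(rewrite Rabs_pos_eq; lra)).
      rewrite Z in Q by exact Hx. apply ctends_csum_im in Q.
      eapply is_series_ext; [|exact Q]. intros n. cbv beta. rewrite <- RtoC_pow, im_scal_l. apply Rmult_comm. }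
  exists rho. split; [exact Hrho|]. intros s Hs.
  assert (Q := P (r0 - s) ltac:(rewrite Rabs_minus_sym; exact Hs)).
  replace (- r0 + (r0 - s)) with (- s) in Q by ring.
  assert (Q0 : (F (RtoC (- s)) - G (RtoC (- s)))%C = 0%C).
  { apply (ctends_unique (F := eventually) _ _ _ Q).
    apply ctends_ext with (fun _ => RtoC 0); [|apply ctends_const].
    intros n. rewrite <- (csum_0 n). apply csum_ext. intros k. rewrite AB. ring. }
  apply Ceq_minus. exact Q0.
Qed.

Lemma slit_neg (s : R) : 0 <= s -> slit_plane (RtoC (- s)).
Proof. intros Hs [_ H]. rewrite re_RtoC in H. lra. Qed.

(** Identity theorem along the negative half-line. *)
Lemma is_hyp2F1_unique (a b c : C) (F G : C -> C) (s : R) :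
  is_hyp2F1 a b c F -> is_hyp2F1 a b c G -> 0 <= s -> F (RtoC (- s)) = G (RtoC (- s)).
Proof.
  intros [HF1 HF2] [HG1 HG2] Hs.
  assert (Small : forall t, 0 <= t < 1 -> F (RtoC (- t)) = G (RtoC (- t))).
  { intros t Ht.
    assert (M : Cmod (RtoC (- t)) < 1) by (rewrite Cmod_R, Rabs_Ropp, Rabs_pos_eq; lra).
    assert (A := HF2 _ M). assert (B := HG2 _ M).
    apply is_pseries_ctends in A. apply is_pseries_ctends in B.
    exact (ctends_unique (F := eventually) _ _ _ A B). }
  pose (E := fun r => 0 <= r <= s /\ forall t, 0 <= t <= r -> F (RtoC (- t)) = G (RtoC (- t))).
  assert (E0 : E 0) by (split; [lra|]; intros t Ht; apply Small; lra).
  destruct (completeness E) as [m [Hub Hlub]].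
  { exists s. intros r [Hr _]. lra. }
  { exists 0. exact E0. }
  assert (Hm0 : 0 <= m) by (apply Hub, E0).
  assert (Hms : m <= s) by (apply Hlub; intros r [Hr _]; lra).
  assert (Below : forall t, 0 <= t < m -> F (RtoC (- t)) = G (RtoC (- t))).
  { intros t Ht. apply NNPP. intros N. assert (m <= t); [|lra]. apply Hlub. intros r [Hr1 Hr2].
    destruct (Rle_dec r t) as [L1|L1]; [exact L1|]. exfalso. apply N. apply Hr2. lra. }
  assert (Loc : exists d', 0 < d' /\ forall t, 0 <= t < m + d' -> F (RtoC (- t)) = G (RtoC (- t))).
  { destruct Hm0 as [Hm0|Hm0].
    - destruct (analytic_local_identity F G m m Hm0 (HF1 _ (slit_neg m ltac:(lra))) (HG1 _ (slit_neg m ltac:(lra))))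
        as (d' & Hd' & Hloc).
      + intros t Ht. apply Below. lra.
      + exists d'. split; [exact Hd'|]. intros t Ht.
        destruct (Rlt_le_dec t m) as [L1|L1]; [apply Below; lra|].
        apply Hloc. rewrite Rabs_pos_eq; lra.
    - exists 1. split; [lra|]. intros t Ht. apply Small. lra. }
  destruct Loc as (d' & Hd' & Hloc).
  destruct (Rle_lt_dec s m) as [L1|L1]; [apply Hloc; lra|].
  pose (r := Rmin s (m + d' / 2)).
  assert (Hr : E r).
  { split.
    - split; [apply Rmin_glb; lra|apply Rmin_l].
    - intros t Ht. apply Hloc. assert (r <= m + d' / 2) by apply Rmin_r. lra. }
  apply Hub in Hr. unfold r, Rmin in Hr. destruct (Rle_dec s (m + d' / 2)); lra.
Qed.

(** The bridge from the [epsilon] choice: at w <= 0 any function satisfying the specification may be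
    used in its place, and its existence is also what makes the choice meaningful. *)
Lemma hyp2F1_value (a b c : C) (F : C -> C) (s : R) :
  is_hyp2F1 a b c F -> 0 <= s -> hyp2F1 a b c (RtoC (- s)) = F (RtoC (- s)).
Proof.
  intros HF Hs. apply (is_hyp2F1_unique a b c); try assumption.
  unfold hyp2F1. apply epsilon_spec. exists F. exact HF.
Qed.

(** * Existence of the hypergeometric function *)

(** A Lipschitz constant together with a bound. Both survive the inner integration up to a constant
    factor, so the inner integral is automatically an admissible integrand for the outer one. *)
Definition lip (g : R -> C) (M B : R) : Prop :=
  (forall s s', Cmod (g s - g s')%C <= M * Rabs (s - s')) /\ (forall s, Cmod (g s) <= B).

Lemma lip_ccont (g : R -> C) M B s : lip g M B -> ccont g s.
Proof.
  intros [H _] eps He.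
  pose (K := Rabs M + 1). assert (HK : 0 < K) by (unfold K; generalize (Rabs_pos M); lra).
  exists (mkposreal (eps / K) (Rdiv_lt_0_compat _ _ He HK)). intros y Hy.
  change (Rabs (y - s) < eps / K) in Hy. apply Rlt_div_r in Hy; [|exact HK].
  eapply Rle_lt_trans; [apply H|]. eapply Rle_lt_trans; [|exact Hy].
  rewrite Rmult_comm. apply Rmult_le_compat_l; [apply Rabs_pos|].
  unfold K. generalize (Rle_abs M). lra.
Qed.

Lemma lip_const (c : C) : lip (fun _ => c) 0 (Cmod c).
Proof.
  split; intros; [|lra]. replace (c - c)%C with (RtoC 0) by ring. rewrite Cmod_0. lra.
Qed.

Lemma lip_plus (f g : R -> C) M B M' B' : lip f M B -> lip g M' B' ->
  lip (fun s => (f s + g s)%C) (M + M') (B + B').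
Proof.
  intros [H1 H2] [H3 H4]. split.
  - intros s s'. replace (f s + g s - (f s' + g s'))%C with ((f s - f s') + (g s - g s'))%C by ring.
    eapply Rle_trans; [apply Cmod_triangle|]. generalize (H1 s s') (H3 s s'). lra.
  - intros s. eapply Rle_trans; [apply Cmod_triangle|]. generalize (H2 s) (H4 s). lra.
Qed.

Lemma lip_mult (f g : R -> C) M B M' B' : lip f M B -> lip g M' B' ->
  lip (fun s => (f s * g s)%C) (M * B' + B * M') (B * B').
Proof.
  intros [H1 H2] [H3 H4].
  assert (HB : 0 <= B) by (generalize (Cmod_ge_0 (f 0)) (H2 0); lra).
  assert (HB' : 0 <= B') by (generalize (Cmod_ge_0 (g 0)) (H4 0); lra). split.
  - intros s s'. replace (f s * g s - f s' * g s')%C with ((f s - f s') * g s + f s' * (g s - g s'))%C by ring.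
    eapply Rle_trans; [apply Cmod_triangle|]. rewrite !Cmod_mult.
    assert (Cmod (f s - f s')%C * Cmod (g s) <= M * Rabs (s - s') * B')
      by (apply Rmult_le_compat; auto using Cmod_ge_0).
    assert (Cmod (f s') * Cmod (g s - g s')%C <= B * (M' * Rabs (s - s')))
      by (apply Rmult_le_compat; auto using Cmod_ge_0).
    lra.
  - intros s. rewrite Cmod_mult. apply Rmult_le_compat; auto using Cmod_ge_0.
Qed.

Lemma lip_pow (f : R -> C) M B (n : nat) : lip f M B -> exists M' B', lip (fun s => (f s ^ n)%C) M' B'.
Proof.
  intros Hf. induction n as [|n (M' & B' & IH)].
  - exists 0, (Cmod 1%C). exact (lip_const 1%C).
  - eexists; eexists. exact (lip_mult _ _ _ _ _ _ Hf IH).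
Qed.

Lemma lip_inv (f : R -> C) M B d : 0 < d -> lip f M B -> (forall s, d <= Cmod (f s)) ->
  lip (fun s => (/ f s)%C) (M / (d * d)) (/ d).
Proof.
  intros Hd [H1 H2] H3.
  assert (N : forall s, f s <> 0%C) by (intros s; apply Cmod_gt_0; generalize (H3 s); lra). split.
  - intros s s'. replace (/ f s - / f s')%C with (- ((f s - f s') / (f s * f s')))%C by (field; auto).
    rewrite Cmod_opp, Cmod_div, Cmod_mult by (apply Cmult_neq_0; auto).
    assert (Q : d * d <= Cmod (f s) * Cmod (f s')) by (apply Rmult_le_compat; auto; lra).
    assert (P : 0 < d * d) by nra.
    unfold Rdiv. apply Rle_trans with (M * Rabs (s - s') * / (d * d)); [|right; ring].
    apply Rmult_le_compat; [apply Cmod_ge_0|left; apply Rinv_0_lt_compat; lra|apply H1|].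
    apply Rinv_le_contravar; assumption.
  - intros s. rewrite Cmod_inv by auto. apply Rinv_le_contravar; auto.
Qed.

(** Clamping makes the Lipschitz bounds below hold on the whole line. *)
Definition clamp (s : R) : R := Rmax 0 (Rmin 1 s).

Lemma clamp_range (s : R) : 0 <= clamp s <= 1.
Proof. unfold clamp. split; [apply Rmax_l|]. apply Rmax_lub; [lra|apply Rmin_l]. Qed.

Lemma clamp_id (s : R) : 0 <= s <= 1 -> clamp s = s.
Proof. intros H. unfold clamp. rewrite Rmin_right, Rmax_right by lra. reflexivity. Qed.

Lemma clamp_lip (s s' : R) : Rabs (clamp s - clamp s') <= Rabs (s - s').
Proof.
  unfold clamp, Rmax, Rmin.
  destruct (Rle_dec 1 s), (Rle_dec 1 s');
  repeat (match goal with |- context [Rle_dec ?a ?b] => destruct (Rle_dec a b) end);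
  unfold Rabs; repeat (destruct Rcase_abs); lra.
Qed.

Lemma lip_clamp : lip (fun s => RtoC (clamp s)) 1 1.
Proof.
  split; intros.
  - rewrite <- RtoC_minus, Cmod_R, Rmult_1_l. apply clamp_lip.
  - rewrite Cmod_R. generalize (clamp_range s). intros. rewrite Rabs_pos_eq; lra.
Qed.

Definition hden (w : C) (s : R) : C := (1 - w * RtoC (clamp s))%C.

Lemma lip_hden (w : C) : exists M B, lip (hden w) M B.
Proof.
  eexists; eexists.
  assert (H := lip_plus _ _ _ _ _ _ (lip_const 1%C) (lip_mult _ _ _ _ _ _ (lip_const (- w)%C) lip_clamp)).
  replace (hden w) with (fun s : R => (1 + - w * RtoC (clamp s))%C); [exact H|].
  apply functional_extensionality. intros s. unfold hden. ring.
Qed.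

Lemma slit_lower_bound (w : C) : slit_plane w -> exists d, 0 < d /\ forall s, d <= Cmod (hden w s).
Proof.
  intros Hw. unfold slit_plane in Hw.
  assert (Hre : forall s, Re (hden w s) = 1 - Re w * clamp s).
  { intros s. unfold hden. rewrite Re_minus, re_scal_r, re_RtoC. reflexivity. }
  assert (Him : forall s, Im (hden w s) = - (Im w * clamp s)).
  { intros s. unfold hden, Im. simpl. ring. }
  destruct (Req_dec (Im w) 0) as [H0|H0].
  - assert (H1 : Re w < 1) by (apply Rnot_le_lt; intros N; apply Hw; split; assumption).
    exists (Rmin 1 (1 - Re w)). split; [apply Rmin_pos; lra|]. intros s.
    eapply Rle_trans; [|apply re_le_Cmod]. rewrite Hre.
    assert (C := clamp_range s).
    assert (Rmin 1 (1 - Re w) <= 1 - Re w * clamp s).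
    { destruct (Rle_dec 0 (Re w)).
      - eapply Rle_trans; [apply Rmin_r|]. nra.
      - eapply Rle_trans; [apply Rmin_l|]. nra. }
    eapply Rle_trans; [eassumption|apply Rle_abs].
  - pose (k := 2 * (1 + Rabs (Re w))). assert (Hk : 0 < k) by (unfold k; generalize (Rabs_pos (Re w)); lra).
    assert (Hi : 0 < Rabs (Im w)) by (apply Rabs_pos_lt, H0).
    exists (Rmin (1/2) (Rabs (Im w) / k)). split.
    { apply Rmin_pos; [lra|]. apply Rdiv_lt_0_compat; assumption. }
    intros s. assert (C := clamp_range s).
    destruct (Rle_dec (clamp s) (/ k)) as [L1|L1].
    + eapply Rle_trans; [apply Rmin_l|]. eapply Rle_trans; [|apply re_le_Cmod]. rewrite Hre.
      assert (Re w * clamp s <= 1/2).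
      { apply Rle_trans with (Rabs (Re w) * clamp s); [apply Rmult_le_compat_r; [lra|apply Rle_abs]|].
        apply Rle_trans with (Rabs (Re w) * / k); [apply Rmult_le_compat_l; [apply Rabs_pos|exact L1]|].
        apply (Rle_div_l (Rabs (Re w))); [exact Hk|]. unfold k. lra. }
      eapply Rle_trans; [|apply Rle_abs]. lra.
    + eapply Rle_trans; [apply Rmin_r|]. eapply Rle_trans; [|apply im_le_Cmod]. rewrite Him, Rabs_Ropp, Rabs_mult.
      apply Rmult_le_compat_l; [lra|]. rewrite Rabs_pos_eq; lra.
Qed.

(** * The binomial series of (1 - v)^(-m), with uniform remainder *)

Definition bcoef (m n : nat) : C := (poch (RtoC (INR m)) n / RtoC (INR (fact n)))%C.

Lemma INR_factC (n : nat) : RtoC (INR (fact n)) <> 0%C.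
Proof. apply RtoC_neq_0, INR_fact_neq_0. Qed.

Lemma bcoef_0_S (n : nat) : bcoef 0 (S n) = 0%C.
Proof. unfold bcoef. rewrite poch_shift. change (INR 0) with 0. unfold Cdiv. rewrite !Cmult_0_l. reflexivity. Qed.

Lemma bcoef_m_0 (m : nat) : bcoef m 0 = 1%C.
Proof. unfold bcoef. simpl. field. Qed.

Lemma bcoef_pascal (m n : nat) : bcoef (S m) (S n) = (bcoef (S m) n + bcoef m (S n))%C.
Proof.
  unfold bcoef. rewrite (poch_shift (INR m)).
  replace (RtoC (INR m) + 1)%C with (RtoC (INR (S m))) by (rewrite S_INR, RtoC_plus; reflexivity).
  change (poch (INR (S m)) (S n)) with (poch (INR (S m)) n * (INR (S m) + INR n))%C.
  rewrite fact_simpl, mult_INR, RtoC_mult. rewrite !S_INR, !RtoC_plus.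
  assert (RtoC (INR n) + 1 <> 0)%C by (rewrite <- RtoC_plus; apply RtoC_neq_0; generalize (pos_INR n); lra).
  field. split; [apply INR_factC|assumption].
Qed.

Lemma bcoef_bound (m : nat) : forall n, Cmod (bcoef m n) <= INR (S n) ^ m.
Proof.
  induction m as [|m IHm].
  - intros [|n]; [rewrite bcoef_m_0, Cmod_1; simpl; lra|]. rewrite bcoef_0_S, Cmod_0. simpl; lra.
  - induction n as [|n IHn].
    + rewrite bcoef_m_0, Cmod_1. simpl INR. rewrite pow1. lra.
    + rewrite bcoef_pascal. eapply Rle_trans; [apply Cmod_triangle|].
      specialize (IHm (S n)). rewrite <- tech_pow_Rmult in IHn |- *.
      assert (P : INR (S n) ^ m <= INR (S (S n)) ^ m).
      { apply pow_incr. split; [apply pos_INR|]. apply le_INR. lia. }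
      rewrite (S_INR (S n)). rewrite (S_INR (S n)) in P, IHm.
      assert (0 <= INR (S n)) by apply pos_INR.
      assert (0 <= (INR (S n) + 1) ^ m) by (apply pow_le; lra). nra.
Qed.

Lemma poly_geom_small (m : nat) (q eps : R) : 0 <= q < 1 -> 0 < eps ->
  exists N0, forall n, (N0 <= n)%nat -> INR (S n) ^ m * q ^ (S n) < eps.
Proof.
  intros [Hq0 Hq] He. destruct Hq0 as [Hq0| <-].
  2: { exists 0%nat. intros n _. simpl. lra. }
  pose (lam := - ln q). assert (Hl : 0 < lam).
  { unfold lam. rewrite <- (Ropp_0). apply Ropp_lt_contravar. rewrite <- ln_1. apply ln_increasing; lra. }
  destruct (power_le_exp (INR m) (lam / 2) (pos_INR m) ltac:(lra)) as (K & HK & HG).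
  destruct (exp_decay_small K (lam / 2) eps ltac:(lra) He) as (A0 & HA0 & HA).
  destruct (nfloor_ex A0 HA0) as (N & _ & HN).
  exists (S N). intros n Hn.
  assert (Hn' : A0 <= INR n) by (apply le_INR in Hn; rewrite S_INR in Hn; lra).
  specialize (HA _ Hn'). specialize (HG (INR n) (pos_INR n)).
  change (exp (INR m * ln (1 + INR n))) with (Rpower (1 + INR n) (INR m)) in HG.
  rewrite Rpower_pow in HG by (generalize (pos_INR n); lra).
  rewrite S_INR, (Rplus_comm (INR n)).
  eapply Rle_lt_trans; [|exact HA].
  assert (Q : q ^ S n <= exp (- lam * INR n)).
  { simpl. replace (exp (- lam * INR n)) with (q ^ n).
    - assert (0 <= q ^ n) by (apply pow_le; lra). nra.
    - rewrite <- Rpower_pow by exact Hq0. unfold Rpower, lam. f_equal. ring. }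
  apply Rle_trans with (K * exp (lam / 2 * INR n) * exp (- lam * INR n)).
  - apply Rmult_le_compat; [apply pow_le; generalize (pos_INR n); lra|apply pow_le; lra|exact HG|exact Q].
  - right. rewrite Rmult_assoc, <- exp_plus. f_equal. f_equal. field.
Qed.

Definition brem (m n : nat) (v : C) : C := ((/ (1 - v)) ^ m - csum (fun k => (bcoef m k * v ^ k)%C) n)%C.

Lemma csum_bcoef_step (m n : nat) (v : C) :
  (csum (fun k => bcoef (S m) k * v ^ k) n * (1 - v)
   = csum (fun k => bcoef m k * v ^ k) n - bcoef (S m) n * v ^ (S n))%C.
Proof.
  induction n as [|n IH].
  - simpl csum. rewrite !bcoef_m_0. simpl. ring.
  - simpl csum. rewrite Cmult_plus_distr_r, IH, bcoef_pascal. simpl. ring.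
Qed.

Lemma brem_0 (n : nat) (v : C) : brem 0 n v = 0%C.
Proof.
  unfold brem. replace (csum (fun k => bcoef 0 k * v ^ k)%C n) with (RtoC 1); [simpl; ring|].
  induction n as [|n IH]; simpl csum.
  - rewrite bcoef_m_0. simpl. ring.
  - rewrite <- IH, bcoef_0_S. ring.
Qed.

Lemma brem_step (m n : nat) (v : C) : (1 - v <> 0)%C ->
  brem (S m) n v = ((brem m n v + bcoef (S m) n * v ^ (S n)) / (1 - v))%C.
Proof.
  intros Hv. unfold brem.
  replace (csum (fun k => bcoef (S m) k * v ^ k)%C n)
    with ((csum (fun k => bcoef m k * v ^ k) n - bcoef (S m) n * v ^ (S n)) / (1 - v))%C
    by (rewrite <- csum_bcoef_step; field; exact Hv).
  simpl. field. exact Hv.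
Qed.

(** Induction on m: the remainder for m + 1 is that for m plus one boundary term, divided by 1 - v;
    the boundary term is a polynomial in n times q^(n + 1). Uniformity over |v| <= q permits
    expansion under the double integral. *)
Lemma brem_uniform (m : nat) (q : R) : 0 <= q < 1 -> forall eps, 0 < eps ->
  exists N0, forall n, (N0 <= n)%nat -> forall v, Cmod v <= q -> Cmod (brem m n v) <= eps.
Proof.
  intros Hq. induction m as [|m IH]; intros eps He.
  - exists 0%nat. intros n _ v _. rewrite brem_0, Cmod_0. lra.
  - assert (He' : 0 < eps * (1 - q) / 2) by nra.
    destruct (IH _ He') as (N1 & H1). destruct (poly_geom_small (S m) q _ Hq He') as (N2 & H2).
    exists (max N1 N2). intros n Hn v Hv.
    assert (Hd : 1 - q <= Cmod (1 - v)%C).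
    { assert (G := Cmod_ge_sub (1 - v)%C 1%C). replace (1 - v - 1)%C with (- v)%C in G by ring.
      rewrite Cmod_opp, Cmod_1 in G. lra. }
    assert (Hn0 : (1 - v)%C <> 0%C) by (apply Cmod_gt_0; lra).
    rewrite brem_step, Cmod_div by exact Hn0.
    apply Rle_div_l; [lra|].
    eapply Rle_trans; [apply Cmod_triangle|].
    specialize (H1 n ltac:(lia) v Hv). specialize (H2 n ltac:(lia)).
    assert (Q : Cmod (bcoef (S m) n * v ^ S n)%C <= INR (S n) ^ S m * q ^ S n).
    { rewrite Cmod_mult, Cmod_pow. apply Rmult_le_compat; [apply Cmod_ge_0|apply pow_le, Cmod_ge_0|apply bcoef_bound|].
      apply pow_incr. split; [apply Cmod_ge_0|exact Hv]. }
    nra.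
Qed.

(** * The double beta integral and its expansions on the slit plane *)

Section DoubleBeta.
Variables (a b : C) (c d : R).
Hypotheses (Ha : 1 < Re a) (Hb : 1 < Re b) (Hc : Re a < c) (Hd : Re b < d).

(** The inner integral, for the second beta density with parameters b and d - b. This density
    supplies (b)_n / (d)_n; the denominator will cancel against the binomial coefficient (m)_n / n!
    once d = m. *)
Definition LLi (g : R -> C) (x : R) : C := Lam b 1 (RtoC d) (fun y => g (x * y)).
Definition LL (g : R -> C) : C := Lam a 1 (RtoC c) (LLi g).

Let Hc' : 1 * Re a < Re (RtoC c). Proof. rewrite re_RtoC; lra. Qed.
Let Hd' : 1 * Re b < Re (RtoC d). Proof. rewrite re_RtoC; lra. Qed.

Lemma lip_inner_bcont (g : R -> C) M B x : lip g M B -> bcont (fun y => g (x * y)) B.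
Proof.
  intros [H1 H2]. split; [|intros; apply H2].
  intros y _. apply (lip_ccont _ (Rabs M * Rabs x) B). split; [|intros; apply H2].
  intros s s'. eapply Rle_trans; [apply H1|]. rewrite <- Rmult_minus_distr_l, Rabs_mult, <- Rmult_assoc.
  apply Rmult_le_compat_r; [apply Rabs_pos|]. apply Rmult_le_compat_r; [apply Rabs_pos|apply Rle_abs].
Qed.

(** For 0 <= y < 1, changing x by h moves the argument x y by at most |h|, and the inner integral is
    a bounded functional. *)
Lemma LLi_lip : exists M0, 0 <= M0 /\ forall g M B, lip g M B -> lip (LLi g) (M0 * M) (M0 * B).
Proof.
  destruct (Lam_bound b 1 _ Rlt_0_1 Hb Hd') as (M0 & H0 & HM).
  exists M0. split; [exact H0|]. intros g M B Hg. split.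
  - intros x x'. unfold LLi.
    assert (B1 := lip_inner_bcont g M B x Hg). assert (B2 := lip_inner_bcont g M B x' Hg).
    replace (Lam b 1 d (fun y => g (x * y)%R) - Lam b 1 d (fun y => g (x' * y)%R))%C
      with (Lam b 1 d (fun y => g (x * y)%R + (- (1)) * g (x' * y)%R))%C.
    + rewrite Rmult_assoc. apply HM. split.
      * apply (bcont_plus _ _ _ _ B1 (bcont_scal (- (1))%C _ _ B2)).
      * intros y Hy. replace (g (x * y)%R + - (1) * g (x' * y)%R)%C with (g (x * y)%R - g (x' * y)%R)%C by ring.
        eapply Rle_trans; [apply Hg|]. rewrite <- Rmult_minus_distr_r, Rabs_mult, (Rabs_pos_eq y) by lra.
        assert (0 <= M).
        { destruct Hg as [Hg _]. specialize (Hg 1 0). rewrite Rminus_0_r, Rabs_R1 in Hg.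
          generalize (Cmod_ge_0 (g 1 - g 0)%C). lra. }
        apply Rmult_le_compat_l; [assumption|]. generalize (Rabs_pos (x - x')). nra.
    + rewrite (Lam_plus _ _ _ Rlt_0_1 Hb Hd' _ _ _ _ B1 (bcont_scal (- (1))%C _ _ B2)).
      rewrite (Lam_scal _ _ _ Rlt_0_1 Hb Hd' _ _ _ B2). ring.
  - intros x. unfold LLi. apply HM. eapply lip_inner_bcont, Hg.
Qed.

Lemma LLi_bcont (g : R -> C) M B : lip g M B -> exists B', bcont (LLi g) B'.
Proof.
  intros Hg. destruct LLi_lip as (M0 & H0 & HM). specialize (HM g M B Hg).
  eexists. split; [|intros; apply HM]. intros y _. exact (lip_ccont _ _ _ _ HM).
Qed.

Lemma LL_bound : exists M0, 0 <= M0 /\ forall g M B, lip g M B -> Cmod (LL g) <= M0 * B.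
Proof.
  destruct LLi_lip as (M1 & H1 & HM1). destruct (Lam_bound a 1 _ Rlt_0_1 Ha Hc') as (M2 & H2 & HM2).
  exists (M2 * M1). split; [nra|]. intros g M B Hg. rewrite Rmult_assoc. apply HM2.
  specialize (HM1 g M B Hg). split; [|intros; apply HM1]. intros y _. exact (lip_ccont _ _ _ _ HM1).
Qed.

Lemma LL_plus (f g : R -> C) M B M' B' : lip f M B -> lip g M' B' ->
  LL (fun s => (f s + g s)%C) = (LL f + LL g)%C.
Proof.
  intros Hf Hg. destruct (LLi_bcont f M B Hf) as (B1 & Q1). destruct (LLi_bcont g M' B' Hg) as (B2 & Q2).
  unfold LL. rewrite <- (Lam_plus a 1 c Rlt_0_1 Ha Hc' _ _ _ _ Q1 Q2).
  f_equal. apply functional_extensionality. intros x. unfold LLi.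
  apply (Lam_plus b 1 d Rlt_0_1 Hb Hd' _ _ B B').
  - exact (lip_inner_bcont f M B x Hf).
  - exact (lip_inner_bcont g M' B' x Hg).
Qed.

Lemma LL_scal (k : C) (f : R -> C) M B : lip f M B -> LL (fun s => (k * f s)%C) = (k * LL f)%C.
Proof.
  intros Hf. destruct (LLi_bcont f M B Hf) as (B1 & Q1).
  unfold LL. rewrite <- (Lam_scal a 1 c Rlt_0_1 Ha Hc' _ _ _ Q1).
  f_equal. apply functional_extensionality. intros x. unfold LLi.
  apply (Lam_scal b 1 d Rlt_0_1 Hb Hd' _ _ B).
  exact (lip_inner_bcont f M B x Hf).
Qed.

Lemma lip_csum (f : nat -> R -> C) (n : nat) : (forall k, exists M B, lip (f k) M B) ->
  exists M B, lip (fun s => csum (fun k => f k s) n) M B.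
Proof.
  intros H. induction n as [|n (M & B & IH)]; simpl; [apply H|].
  destruct (H (S n)) as (M' & B' & H'). eexists; eexists. exact (lip_plus _ _ _ _ _ _ IH H').
Qed.

Lemma LL_csum (f : nat -> R -> C) (n : nat) : (forall k, exists M B, lip (f k) M B) ->
  LL (fun s => csum (fun k => f k s) n) = csum (fun k => LL (f k)) n.
Proof.
  intros H. induction n as [|n IH]; simpl; [reflexivity|].
  destruct (lip_csum f n H) as (M & B & H1). destruct (H (S n)) as (M' & B' & H2).
  rewrite (LL_plus _ _ _ _ _ _ H1 H2), IH. reflexivity.
Qed.

Lemma regular_RtoC (x : R) : 0 < x -> regular (RtoC x).
Proof. intros H. apply Re_pos_regular. rewrite re_RtoC. exact H. Qed.

Lemma lip_clamp_pow (n : nat) : exists M B, lip (fun s => RtoC (clamp s ^ n)) M B.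
Proof.
  destruct (lip_pow _ _ _ n lip_clamp) as (M & B & H). exists M, B.
  replace (fun s => RtoC (clamp s ^ n)) with (fun s => (RtoC (clamp s) ^ n)%C); [exact H|].
  apply functional_extensionality. intros s. symmetry. apply RtoC_pow.
Qed.

Lemma LL_moment (n : nat) :
  (poch (RtoC c) n * poch (RtoC d) n * LL (fun s => RtoC (clamp s ^ n))
   = poch a n * poch b n * (beta a 1 (RtoC c) * beta b 1 (RtoC d)))%C.
Proof.
  assert (C1 : forall x : C, (x / 1)%C = x) by (intros; field).
  assert (M1 := Lam_moment a 1 c Rlt_0_1 Ha Hc' n). assert (M2 := Lam_moment b 1 d Rlt_0_1 Hb Hd' n).
  rewrite C1 in M1, M2. specialize (M1 (regular_RtoC c ltac:(lra))). specialize (M2 (regular_RtoC d ltac:(lra))).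
  set (m2 := Lam b 1 d (fun y => RtoC (y ^ n))) in *.
  assert (E : LL (fun s => RtoC (clamp s ^ n)) = (m2 * Lam a 1 c (fun x => RtoC (x ^ n)))%C).
  { rewrite <- (Lam_scal a 1 c Rlt_0_1 Ha Hc' _ _ _ (bcont_pow n)).
    destruct (lip_clamp_pow n) as (M & B & HL).
    destruct (LLi_bcont _ _ _ HL) as (B' & Q).
    apply (Lam_ext a 1 c Rlt_0_1 Ha Hc' _ _ B' Q).
    intros x Hx. unfold LLi, m2. rewrite Cmult_comm.
    rewrite <- (Lam_scal b 1 d Rlt_0_1 Hb Hd' _ _ _ (bcont_pow n)).
    apply (Lam_ext b 1 d Rlt_0_1 Hb Hd' _ _ B (lip_inner_bcont _ M B x HL)).
    intros y Hy. rewrite clamp_id by (split; nra). rewrite Rpow_mult_distr, RtoC_mult. reflexivity. }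
  rewrite E. transitivity ((poch d n * m2) * (poch c n * Lam a 1 c (fun x => RtoC (x ^ n))))%C; [ring|].
  rewrite M1, M2. ring.
Qed.

(** [int int (1 - w x y)^(-m)] against two beta densities, expanded around [w0]; as
    [m] is an integer, no branch of a complex power is involved. *)
Definition hypI (m : nat) (w : C) : C := LL (fun s => ((/ hden w s) ^ m)%C).

(** The n-th Taylor coefficient at w0 of (1 - w s)^(-m), namely (m)_n / n! * s^n (1 - w0 s)^(-m -
    n), integrated. *)
Definition hcoef (m : nat) (w0 : C) (n : nat) : C :=
  (bcoef m n * LL (fun s => RtoC (clamp s ^ n) * (/ hden w0 s) ^ (m + n)))%C.

Lemma lip_hden_pow (w : C) (m : nat) (dl : R) : 0 < dl -> (forall s, dl <= Cmod (hden w s)) ->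
  exists M B, lip (fun s => ((/ hden w s) ^ m)%C) M B.
Proof.
  intros Hdl Hb'. destruct (lip_hden w) as (M & B & H).
  exact (lip_pow _ _ _ m (lip_inv _ _ _ _ Hdl H Hb')).
Qed.

(** Factor 1 - w s = (1 - w0 s)(1 - v) with v = (w - w0) s / (1 - w0 s) and |v| <= q; the remainder
    of the series is the integral of (1 - w0 s)^(-m) times the binomial remainder, which is
    uniformly small in s. *)
Lemma hypI_expand (m : nat) (w0 w : C) (dl q : R) : 0 < dl -> (forall s, dl <= Cmod (hden w0 s)) ->
  0 <= q < 1 -> (forall s, Cmod ((w - w0) * RtoC (clamp s) / hden w0 s)%C <= q) ->
  @is_pseries C_AbsRing C_NormedModule (hcoef m w0) (w - w0)%C (hypI m w).
Proof.
  intros Hdl Hdb Hq Hv. apply is_pseries_ctends. intros eps He.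
  pose (v := fun s => ((w - w0) * RtoC (clamp s) / hden w0 s)%C).
  assert (N0 : forall s, hden w0 s <> 0%C) by (intros s; apply Cmod_gt_0; generalize (Hdb s); lra).
  assert (HV1 : forall s, 1 - q <= Cmod (1 - v s)%C).
  { intros s. assert (G := Cmod_ge_sub (1 - v s)%C 1%C). replace (1 - v s - 1)%C with (- v s)%C in G by ring.
    rewrite Cmod_opp, Cmod_1 in G. specialize (Hv s). fold (v s) in Hv. lra. }
  assert (NV : forall s, (1 - v s)%C <> 0%C) by (intros s; apply Cmod_gt_0; generalize (HV1 s); lra).
  assert (Hden : forall s, hden w s = (hden w0 s * (1 - v s))%C).
  { intros s. assert (N := N0 s). unfold v.
    transitivity (hden w0 s - (w - w0) * RtoC (clamp s))%C; [unfold hden; ring|]. field. exact N. }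
  assert (Hdb' : forall s, dl * (1 - q) <= Cmod (hden w s)).
  { intros s. rewrite Hden, Cmod_mult. apply Rmult_le_compat; auto; lra. }
  pose (term := fun k s => ((w - w0) ^ k * bcoef m k * (RtoC (clamp s ^ k) * (/ hden w0 s) ^ (m + k)))%C).
  assert (Lk : forall k, exists M B, lip (fun s => (RtoC (clamp s ^ k) * (/ hden w0 s) ^ (m + k))%C) M B).
  { intros k. destruct (lip_clamp_pow k) as (M1 & B1 & H1).
    destruct (lip_hden_pow w0 (m + k) dl Hdl Hdb) as (M2 & B2 & H2).
    eexists; eexists. exact (lip_mult _ _ _ _ _ _ H1 H2). }
  assert (Lt : forall k, exists M B, lip (term k) M B).
  { intros k. destruct (Lk k) as (M & B & H). eexists; eexists.
    exact (lip_mult _ _ _ _ _ _ (lip_const ((w - w0) ^ k * bcoef m k)%C) H). }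
  assert (E1 : forall n, csum (fun k => ((w - w0) ^ k * hcoef m w0 k)%C) n = LL (fun s => csum (fun k => term k s) n)).
  { intros n. rewrite (LL_csum term n Lt). apply csum_ext. intros k.
    destruct (Lk k) as (M & B & H). unfold term. rewrite (LL_scal _ _ _ _ H). unfold hcoef. ring. }
  destruct (lip_hden_pow w m (dl * (1 - q)) ltac:(nra) Hdb') as (Mw & Bw & Lw).
  destruct LL_bound as (M0 & HM0 & HM).
  assert (HD : 0 < (/ dl) ^ m) by (apply pow_lt, Rinv_0_lt_compat, Hdl).
  destruct (brem_uniform m q Hq (eps / ((M0 + 1) * (/ dl) ^ m)) ltac:(apply Rdiv_lt_0_compat; nra)) as (n0 & Hn0).
  exists n0. intros n Hn. rewrite E1.
  destruct (lip_csum term n Lt) as (Mt & Bt & Lct).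
  assert (E2 : (LL (fun s => csum (fun k => term k s) n) - hypI m w)%C
             = LL (fun s => (csum (fun k => term k s) n + (- (1)) * (/ hden w s) ^ m)%C)).
  { unfold hypI.
    rewrite (LL_plus _ _ _ _ _ _ Lct (lip_mult _ _ _ _ _ _ (lip_const (- (1))%C) Lw)).
    rewrite (LL_scal _ _ _ _ Lw). ring. }
  rewrite E2.
  assert (E3 : forall s, (csum (fun k => term k s) n + (- (1)) * (/ hden w s) ^ m)%C
            = (- ((/ hden w0 s) ^ m * brem m n (v s)))%C).
  { intros s. unfold brem. rewrite Hden.
    replace (/ (hden w0 s * (1 - v s)))%C with (/ hden w0 s * / (1 - v s))%C by (field; auto).
    rewrite Cpow_mult_l.
    replace (csum (fun k => term k s) n) with ((/ hden w0 s) ^ m * csum (fun k => bcoef m k * v s ^ k) n)%C; [ring|].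
    clear -N0. induction n as [|n IH]; simpl csum.
    - unfold term. rewrite Nat.add_0_r. simpl. ring.
    - rewrite <- IH. unfold term, v. rewrite Cpow_add_r.
      replace ((w - w0) * clamp s / hden w0 s)%C with ((w - w0) * clamp s * / hden w0 s)%C by reflexivity.
      rewrite !Cpow_mult_l, !RtoC_pow.
      assert (S1 : forall x : C, (x ^ S n = x * x ^ n)%C) by reflexivity.
      rewrite !S1. ring. }
  apply Rle_lt_trans with (M0 * (eps / (M0 + 1))).
  - assert (Lall := lip_plus _ _ _ _ _ _ Lct (lip_mult _ _ _ _ _ _ (lip_const (- (1))%C) Lw)).
    apply (HM _ (Mt + (0 * Bw + Cmod (- (1))%C * Mw))). split; [apply Lall|].
    intros s. rewrite E3, Cmod_opp, Cmod_mult, Cmod_pow, Cmod_inv by auto.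
    apply Rle_trans with ((/ dl) ^ m * (eps / ((M0 + 1) * (/ dl) ^ m))).
    + apply Rmult_le_compat; [apply pow_le; left; apply Rinv_0_lt_compat, Cmod_gt_0; auto|apply Cmod_ge_0| |].
      * apply pow_incr. split; [left; apply Rinv_0_lt_compat, Cmod_gt_0; auto|].
        apply Rinv_le_contravar; auto.
      * apply Hn0; [exact Hn|apply Hv].
    + right. field. split; lra.
  - apply Rlt_le_trans with ((M0 + 1) * (eps / (M0 + 1))); [|right; field; lra].
    apply Rmult_lt_compat_r; [|lra]. apply Rdiv_lt_0_compat; lra.
Qed.

Lemma clamp_abs (s : R) : Cmod (RtoC (clamp s)) <= 1.
Proof. rewrite Cmod_R. generalize (clamp_range s). intros. rewrite Rabs_pos_eq; lra. Qed.

Lemma is_pseries_scal_C (k : C) (f : nat -> C) (w l : C) :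
  @is_pseries C_AbsRing C_NormedModule f w l ->
  @is_pseries C_AbsRing C_NormedModule (fun n => (k * f n)%C) w (k * l)%C.
Proof.
  intros H. apply is_pseries_ctends. apply is_pseries_ctends in H.
  apply ctends_ext with (2 := ctends_mult _ _ _ _ (ctends_const k) H).
  intros n. induction n as [|n IH]; simpl csum; [ring|]. rewrite <- IH. ring.
Qed.

(** Around w0 the series converges in the disk whose radius is the lower bound of |1 - w0 s|. At w0
    = 0 that bound is 1, which gives the unit disk, and the moments identify the coefficients with
    those of Gauss. *)
Lemma hypI_is_hyp2F1 (m : nat) : d = INR m ->
  beta a 1 (RtoC c) <> 0%C -> beta b 1 (RtoC d) <> 0%C ->
  is_hyp2F1 a b (RtoC c) (fun w => / (beta a 1 (RtoC c) * beta b 1 (RtoC d)) * hypI m w)%C.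
Proof.
  intros Hm Na Nb. split.
  - intros w0 Hw0. destruct (slit_lower_bound w0 Hw0) as (dl & Hdl & Hdb).
    exists (fun n => / (beta a 1 (RtoC c) * beta b 1 (RtoC d)) * hcoef m w0 n)%C, dl.
    split; [exact Hdl|]. intros w Hw. apply is_pseries_scal_C.
    assert (W0 := Cmod_ge_0 (w - w0)%C).
    apply (hypI_expand m w0 w dl (Cmod (w - w0)%C / dl) Hdl Hdb).
    + split; [apply Rdiv_le_0_compat; lra|]. apply Rlt_div_l; lra.
    + intros s. assert (N0 : hden w0 s <> 0%C) by (apply Cmod_gt_0; generalize (Hdb s); lra).
      rewrite Cmod_div, Cmod_mult by exact N0.
      apply Rmult_le_compat; [apply Rmult_le_pos; apply Cmod_ge_0|left; apply Rinv_0_lt_compat, Cmod_gt_0, N0| |].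
      * generalize (clamp_abs s) (Cmod_ge_0 (clamp s)). nra.
      * apply Rinv_le_contravar; auto.
  - intros w Hw.
    assert (H0 : forall s, hden 0%C s = 1%C) by (intros s; unfold hden; ring).
    assert (Hd1 : forall s, 1 <= Cmod (hden 0%C s)) by (intros s; rewrite H0, Cmod_1; lra).
    assert (P := hypI_expand m 0%C w 1 (Cmod w) Rlt_0_1 Hd1 (conj (Cmod_ge_0 w) Hw)).
    replace (w - 0)%C with w in P by ring.
    eapply is_pseries_ext; [|apply is_pseries_scal_C, P].
    + intros n. cbv beta. unfold hcoef, gauss_coef, bcoef.
      assert (E : LL (fun s => RtoC (clamp s ^ n) * (/ hden 0 s) ^ (m + n))%C = LL (fun s => RtoC (clamp s ^ n))).
      { f_equal. apply functional_extensionality. intros s. rewrite H0.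
        replace (/ 1)%C with (RtoC 1) by field. rewrite Cpow_1_l. ring. }
      rewrite E. assert (M := LL_moment n). rewrite Hm in M |- *. rewrite Hm in Nb.
      assert (P1 : poch (RtoC c) n <> 0%C) by (apply poch_neq_0, regular_RtoC; lra).
      assert (P2 : poch (RtoC (INR m)) n <> 0%C) by (apply poch_neq_0, regular_RtoC; lra).
      replace (LL (fun s => RtoC (clamp s ^ n)))
        with (poch a n * poch b n * (beta a 1 c * beta b 1 (INR m)) / (poch c n * poch (INR m) n))%C.
      * match goal with |- ?x = ?y => change (@eq C x y) end. field. repeat split; try assumption. apply INR_factC.
      * rewrite <- M. field. split; assumption.
    + intros s. rewrite H0. replace (w * clamp s / 1)%C with (w * clamp s)%C by field.
      rewrite Cmod_mult. generalize (clamp_abs s) (Cmod_ge_0 w) (Cmod_ge_0 (clamp s)). nra.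
Qed.
End DoubleBeta.

(** * The inner beta integral as a power of 1 + s *)

Section InnerPower.
Variables (b : C) (m : nat).
Hypotheses (Hb : 1 < Re b) (Hm : Re b < INR m).

Let Hm' : 1 * Re b < Re (RtoC (INR m)). Proof. rewrite re_RtoC; lra. Qed.

Definition ipow (s y : R) : R := (/ (1 + s * y)) ^ m.
Definition ipow1 (s y : R) : R := - INR m * (y * (/ (1 + s * y)) ^ (S m)).

Lemma inv_bound (s y : R) : - (1/2) <= s -> 0 <= y <= 1 -> 0 < / (1 + s * y) <= 2.
Proof.
  intros Hs Hy. assert (1/2 <= 1 + s * y) by nra. split; [apply Rinv_0_lt_compat; lra|].
  replace 2 with (/ (1/2)) by field. apply Rinv_le_contravar; lra.
Qed.

Lemma pow_frac_derive (n : nat) (s y : R) : 1 + s * y <> 0 ->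
  is_derive (fun y => (/ (1 + s * y)) ^ n) y (- INR n * (s * (/ (1 + s * y)) ^ (S n))).
Proof.
  intros H. auto_derive; [exact H|]. destruct n; simpl; [ring|]. simpl. field. exact H.
Qed.

Lemma ipow_bcont (n : nat) (s : R) : - (1/2) <= s ->
  bcont (fun y => RtoC ((/ (1 + s * y)) ^ n)) (2 ^ n).
Proof.
  intros Hs. split.
  - intros y Hy. apply ctends_RtoC. apply (ex_derive_continuous (fun y => (/ (1 + s * y)) ^ n)).
    eexists. apply pow_frac_derive. nra.
  - intros y Hy. assert (B := inv_bound s y Hs ltac:(lra)).
    rewrite Cmod_R, Rabs_pos_eq by (apply pow_le; lra). apply pow_incr. lra.
Qed.

Lemma y_bcont (g : R -> C) B : bcont g B -> bcont (fun y => (RtoC y * g y)%C) B.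
Proof.
  intros [H1 H2]. split.
  - intros y Hy. apply ccont_mult; [apply ctends_RtoC, continuous_id|auto].
  - intros y Hy. rewrite Cmod_mult, Cmod_R, Rabs_pos_eq by lra.
    specialize (H2 y Hy). generalize (Cmod_ge_0 (g y)). nra.
Qed.

Lemma ipow1_bcont (s : R) : - (1/2) <= s -> exists B, bcont (fun y => RtoC (ipow1 s y)) B.
Proof.
  intros Hs. eexists.
  assert (Q := bcont_scal (RtoC (- INR m)) _ _ (y_bcont _ _ (ipow_bcont (S m) s Hs))).
  replace (fun y => RtoC (ipow1 s y)) with (fun y => (RtoC (- INR m) * (RtoC y * RtoC ((/ (1 + s * y)) ^ S m)))%C);
    [exact Q|].
  apply functional_extensionality. intros y. unfold ipow1. rewrite !RtoC_mult. reflexivity.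
Qed.

(** A quadratic remainder uniform in s and y, which justifies differentiating [ig] under the
    integral. The restriction |h| <= 1/2 keeps 1 + (s + h) y >= 1/2, so the derivative at s = 0 can
    be two-sided. *)
Lemma pow_taylor (n : nat) : exists K, 0 <= K /\ forall s h y, 0 <= s -> Rabs h <= 1/2 -> 0 <= y <= 1 ->
  Rabs ((/ (1 + (s + h) * y)) ^ n - (/ (1 + s * y)) ^ n + h * (INR n * (y * (/ (1 + s * y)) ^ (S n)))) <= K * h ^ 2.
Proof.
  induction n as [|n (K & HK & IH)].
  - exists 0. split; [lra|]. intros. simpl. rewrite Rmult_0_l, Rmult_0_r, Rminus_diag, Rplus_0_l, Rabs_R0. lra.
  - exists (2 * K + 2 * INR (S n)). split; [generalize (pos_INR (S n)); lra|].
    intros s h y Hs Hh Hy. specialize (IH s h y Hs Hh Hy).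
    assert (Hh' := proj1 (Rabs_le_between _ _) Hh).
    assert (Bu := inv_bound (s + h) y ltac:(lra) Hy).
    assert (N0 : 1 + s * y <> 0) by nra. assert (N1 : 1 + (s + h) * y <> 0) by nra.
    assert (Bv : 0 < / (1 + s * y) <= 1).
    { split; [apply Rinv_0_lt_compat; nra|]. rewrite <- Rinv_1 at 2. apply Rinv_le_contravar; nra. }
    assert (Euv : / (1 + (s + h) * y) - / (1 + s * y) = - (h * y) * (/ (1 + (s + h) * y) * / (1 + s * y))) by (field; auto).
    set (u := / (1 + (s + h) * y)) in *. set (v := / (1 + s * y)) in *.
    (* The induction hypothesis enters multiplied by u <= 2; the identity u - v = - h y u v makes
       the third summand vanish and the second quadratic in h. *)
    replace (u ^ S n - v ^ S n + h * (INR (S n) * (y * v ^ S (S n))))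
      with (u * (u ^ n - v ^ n + h * (INR n * (y * v ^ S n))) + - (INR (S n) * h * (y * v ^ S n)) * (u - v)
            + v ^ n * ((u - v) + h * y * (u * v))
            + 0).
    2: { rewrite S_INR. clear. simpl. ring. }
    rewrite Euv. replace (- (h * y) * (u * v) + h * y * (u * v)) with 0 by ring.
    rewrite Rmult_0_r, !Rplus_0_r.
    eapply Rle_trans; [apply Rabs_triang|]. rewrite Rabs_mult, (Rabs_pos_eq u) by lra.
    assert (A1 : u * Rabs (u ^ n - v ^ n + h * (INR n * (y * v ^ S n))) <= 2 * (K * h ^ 2)).
    { apply Rmult_le_compat; [lra|apply Rabs_pos|lra|exact IH]. }
    assert (A2 : Rabs (- (INR (S n) * h * (y * v ^ S n)) * (- (h * y) * (u * v))) <= 2 * INR (S n) * h ^ 2).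
    { replace (- (INR (S n) * h * (y * v ^ S n)) * (- (h * y) * (u * v)))
        with (INR (S n) * h ^ 2 * (y ^ 2 * v ^ S n * v * u)) by ring.
      assert (V : 0 <= v ^ S n <= 1) by (split; [apply pow_le; lra|rewrite <- (pow1 (S n)); apply pow_incr; lra]).
      assert (Y : 0 <= y ^ 2 <= 1) by nra.
      assert (W1 : 0 <= y ^ 2 * v ^ S n <= 1) by nra.
      assert (W2 : 0 <= y ^ 2 * v ^ S n * v <= 1) by nra.
      assert (W : 0 <= y ^ 2 * v ^ S n * v * u <= 2) by nra.
      assert (H2 : 0 <= INR (S n) * h ^ 2) by (apply Rmult_le_pos; [apply pos_INR|nra]).
      rewrite Rabs_pos_eq by (apply Rmult_le_pos; [exact H2|lra]).
      replace (2 * INR (S n) * h ^ 2) with (INR (S n) * h ^ 2 * 2) by ring.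
      apply Rmult_le_compat_l; lra. }
    lra.
Qed.

Definition ig (s : R) : C := Lam b 1 (RtoC (INR m)) (fun y => RtoC (ipow s y)).
Definition ig1 (s : R) : C := Lam b 1 (RtoC (INR m)) (fun y => RtoC (ipow1 s y)).

Lemma ig_cder (s : R) : 0 <= s -> cder ig s (ig1 s).
Proof.
  intros Hs. apply ctends_cder.
  destruct (pow_taylor m) as (K & HK & HT).
  destruct (Lam_bound b 1 _ Rlt_0_1 Hb Hm') as (M0 & HM0 & HM).
  destruct (ipow1_bcont s ltac:(lra)) as (B1 & Q1).
  intros eps He. pose (dl := Rmin (1/2) (eps / (M0 * K + 1))).
  assert (HMK : 0 <= M0 * K) by nra.
  assert (Hdl : 0 < dl) by (apply Rmin_pos; [lra|apply Rdiv_lt_0_compat; lra]).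
  exists (mkposreal dl Hdl). intros h Hh Hh0. change (Rabs (h - 0) < dl) in Hh. rewrite Rminus_0_r in Hh.
  assert (Hh1 : Rabs h < 1/2) by (eapply Rlt_le_trans; [exact Hh|apply Rmin_l]).
  assert (Hh2 : Rabs h < eps / (M0 * K + 1)) by (eapply Rlt_le_trans; [exact Hh|apply Rmin_r]).
  apply Rlt_div_r in Hh2; [|lra].
  assert (Hsh : - (1/2) <= s + h) by (apply Rabs_def2 in Hh1; lra).
  assert (Qa := ipow_bcont m (s + h) Hsh). assert (Qb := ipow_bcont m s ltac:(lra)).
  assert (Qc := bcont_plus _ _ _ _ (bcont_plus _ _ _ _ Qa (bcont_scal (RtoC (-1)) _ _ Qb)) (bcont_scal (RtoC (- h)) _ _ Q1)).
  assert (E : (ig (s + h) + RtoC (-1) * ig s + RtoC (- h) * ig1 s)%C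
    = Lam b 1 (RtoC (INR m)) (fun y => RtoC ((/ (1 + (s + h) * y)) ^ m) + RtoC (-1) * RtoC ((/ (1 + s * y)) ^ m)
          + RtoC (- h) * RtoC (ipow1 s y))%C).
  { rewrite (Lam_plus b 1 _ Rlt_0_1 Hb Hm' _ _ _ _ (bcont_plus _ _ _ _ Qa (bcont_scal (RtoC (-1)) _ _ Qb)) (bcont_scal (RtoC (- h)) _ _ Q1)).
    rewrite (Lam_plus b 1 _ Rlt_0_1 Hb Hm' _ _ _ _ Qa (bcont_scal (RtoC (-1)) _ _ Qb)).
    rewrite (Lam_scal b 1 _ Rlt_0_1 Hb Hm' _ _ _ Qb), (Lam_scal b 1 _ Rlt_0_1 Hb Hm' _ _ _ Q1). reflexivity. }
  assert (Bd : Cmod (ig (s + h) + RtoC (-1) * ig s + RtoC (- h) * ig1 s)%C <= M0 * (K * h ^ 2)).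
  { rewrite E. apply HM. split; [apply Qc|]. intros y Hy.
    rewrite <- !RtoC_mult, <- !RtoC_plus, Cmod_R. eapply Rle_trans; [|apply (HT s h y Hs ltac:(lra) ltac:(lra))].
    right. f_equal. unfold ipow1. ring. }
  assert (hC : RtoC h <> 0%C) by (apply RtoC_neq_0, Hh0).
  replace ((ig (s + h)%R - ig s) / h - ig1 s)%C
    with ((ig (s + h)%R + RtoC (-1) * ig s + RtoC (- h) * ig1 s) / h)%C.
  2: { rewrite RtoC_opp. field. exact hC. }
  rewrite Cmod_div, Cmod_R by exact hC.
  assert (Hp : 0 < Rabs h) by (apply Rabs_pos_lt, Hh0).
  apply Rlt_div_l; [exact Hp|]. eapply Rle_lt_trans; [exact Bd|].
  rewrite <- (pow2_abs h). nra.
Qed.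

(** Integration by parts with G = (1 + s y)^(-m). Here c equals the exponent m, so the y^2 terms of
    (b - m y)(1 + s y) - m s y (1 - y) cancel and b (1 + s y) - m y (1 + s) remains. *)
Lemma ig_ode (s : R) : 0 <= s -> (b * ig s + RtoC (1 + s) * ig1 s = 0)%C.
Proof.
  intros Hs. destruct (ipow1_bcont s ltac:(lra)) as (B1 & Q1).
  assert (Qb := ipow_bcont m s ltac:(lra)).
  unfold ig, ig1.
  assert (QG : bcont (fun y => RtoC (- INR m * (s * (/ (1 + s * y)) ^ (S m)))) (Cmod (RtoC (- INR m * s)) * 2 ^ (S m))).
  { replace (fun y => RtoC (- INR m * (s * (/ (1 + s * y)) ^ (S m))))
      with (fun y => (RtoC (- INR m * s) * RtoC ((/ (1 + s * y)) ^ (S m)))%C).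
    - apply bcont_scal, ipow_bcont. lra.
    - apply functional_extensionality. intros y. rewrite <- RtoC_mult. f_equal. ring. }
  rewrite <- (Lam_scal b 1 _ Rlt_0_1 Hb Hm' _ _ _ Qb), <- (Lam_scal b 1 _ Rlt_0_1 Hb Hm' _ _ _ Q1).
  rewrite <- (Lam_plus b 1 _ Rlt_0_1 Hb Hm' _ _ _ _ (bcont_scal _ _ _ Qb) (bcont_scal _ _ _ Q1)).
  rewrite <- (Lam_parts b 1 _ Rlt_0_1 Hb Hm' _ _ _ _ Qb QG).
  - apply (Lam_ext b 1 _ Rlt_0_1 Hb Hm' _ _ _ (bcont_plus _ _ _ _ (bcont_scal _ _ _ Qb) (bcont_scal _ _ _ Q1))).
    intros y Hy. unfold ipow, ipow1.
    assert (N : 1 + s * y <> 0) by nra.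
    replace ((/ (1 + s * y)) ^ S m) with (/ (1 + s * y) * (/ (1 + s * y)) ^ m) by reflexivity.
    rewrite !RtoC_mult, !RtoC_opp, !RtoC_inv, !RtoC_minus, !RtoC_plus, !RtoC_mult by exact N.
    assert (NC : (1 + s * y <> 0)%C) by (rewrite <- RtoC_mult, <- RtoC_plus; apply RtoC_neq_0, N).
    field. exact NC.
  - intros y Hy. apply cder_RtoC. apply pow_frac_derive. nra.
Qed.

(** By the differential equation ig(s) (1 + s)^b is constant; at s = 0 it is the total mass of the
    density. A positive base 1 + s is what lets a complex power appear after integer ones. *)
Lemma ig_value (s : R) : 0 <= s -> ig s = (beta b 1 (RtoC (INR m)) * Rcpow (1 + s) (- b))%C.
Proof.
  intros Hs.
  assert (E : (ig s * Rcpow (1 + s) b = ig 0 * Rcpow (1 + 0) b)%C).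
  { apply (cder_0_const (fun s => (ig s * Rcpow (1 + s) b)%C) 0 s Hs). intros t Ht.
    assert (D2 := cder_comp (fun x => Rcpow x b) (fun s => 1 + s) t _ 1 (cder_Rcpow b (1 + t) ltac:(lra))
              ltac:(auto_derive; [trivial|ring])).
    eapply cder_eq; [|exact (cder_mult _ _ _ _ _ (ig_cder t Ht) D2)].
    assert (N : RtoC (1 + t) <> 0%C) by (apply RtoC_neq_0; lra).
    transitivity (Rcpow (1 + t) b / RtoC (1 + t) * (b * ig t + RtoC (1 + t) * ig1 t))%C; [field; exact N|].
    rewrite ig_ode by exact Ht. ring. }
  rewrite Rplus_0_r, Rcpow_base_1 in E.
  assert (E0 : ig 0 = beta b 1 (RtoC (INR m))).
  { apply (Lam_ext b 1 _ Rlt_0_1 Hb Hm' _ _ _ (ipow_bcont m 0 ltac:(lra))).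
    intros y _. rewrite Rmult_0_l, Rplus_0_r, Rinv_1, pow1. reflexivity. }
  rewrite Rcpow_opp, <- E0. assert (N := Rcpow_neq_0 (1 + s) b).
  transitivity (ig s * Rcpow (1 + s) b / Rcpow (1 + s) b)%C; [field; exact N|]. rewrite E. field. exact N.
Qed.
End InnerPower.

Lemma Rcpow_bcont (q : C) (s : R) : 0 <= s ->
  bcont (fun y => Rcpow (1 + s * y) (- q)) (exp (Rabs (Re q) * ln (1 + s))).
Proof.
  intros Hs. split.
  - intros y Hy. apply (ctends_Rcpow (fun y => 1 + s * y)); [nra|].
    apply (ex_derive_continuous (fun y => 1 + s * y)). auto_derive. trivial.
  - intros y Hy. rewrite Cmod_Rcpow, re_opp. apply exp_le_compat.
    assert (0 <= ln (1 + s * y)) by (apply ln_nonneg; nra).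
    assert (ln (1 + s * y) <= ln (1 + s)) by (apply ln_le; nra).
    assert (- Re q <= Rabs (Re q)) by (rewrite <- Rabs_Ropp; apply Rle_abs).
    assert (Z := Rabs_pos (Re q)). nra.
Qed.

(** * Euler's integral *)

(** [F] is existential so that the contiguous relation can build it for general b. At w = - s the
    base 1 + s y is positive and its complex power unambiguous. *)
Definition euler_rep (a b : C) (c : R) : Prop :=
  exists F, is_hyp2F1 a b (RtoC c) F /\ forall s, 0 <= s ->
    (F (RtoC (- s)) * beta a 1 (RtoC c) = Lam a 1 (RtoC c) (fun y => Rcpow (1 + s * y) (- b)))%C.

Lemma euler_rep_base (a b : C) (c : R) : 1 < Re a -> 1 < Re b -> Re a < c -> euler_rep a b c.
Proof.
  intros Ha Hb Hc.
  destruct (nfloor_ex (Re b)) as (N & _ & HN); [lra|].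
  pose (m := S N). assert (Hm : Re b < INR m) by (unfold m; rewrite S_INR; exact HN).
  assert (B1 : beta a 1 (RtoC c) <> 0%C).
  { replace (RtoC c) with ((RtoC c - a) + a)%C by ring. apply beta_neq_0; [exact Ha|]. rewrite Re_minus, re_RtoC. lra. }
  assert (B2 : beta b 1 (RtoC (INR m)) <> 0%C).
  { replace (RtoC (INR m)) with ((RtoC (INR m) - b) + b)%C by ring. apply beta_neq_0; [exact Hb|]. rewrite Re_minus, re_RtoC. lra. }
  assert (Hc' : 1 * Re a < Re (RtoC c)) by (rewrite re_RtoC; lra).
  assert (Hm' : 1 * Re b < Re (RtoC (INR m))) by (rewrite re_RtoC; lra).
  eexists. split; [exact (hypI_is_hyp2F1 a b c (INR m) Ha Hb Hc Hm m eq_refl B1 B2)|].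
  intros s Hs. unfold hypI, LL.
  destruct (slit_lower_bound (RtoC (- s)) (slit_neg s Hs)) as (dl & Hdl & Hdb).
  destruct (lip_hden_pow (RtoC (- s)) m dl Hdl Hdb) as (M & B & HL).
  destruct (LLi_bcont b (INR m) Hb Hm _ _ _ HL) as (B' & Q).
  assert (E : Lam a 1 (RtoC c) (LLi b (INR m) (fun s0 => (/ hden (RtoC (- s)) s0) ^ m)%C)
     = (beta b 1 (RtoC (INR m)) * Lam a 1 (RtoC c) (fun y => Rcpow (1 + s * y) (- b)))%C).
  { rewrite <- (Lam_scal a 1 _ Rlt_0_1 Ha Hc' _ _ (exp (Rabs (Re b) * ln (1 + s)))).
    - apply (Lam_ext a 1 _ Rlt_0_1 Ha Hc' _ _ _ Q). intros x Hx.
      rewrite <- (ig_value b m Hb Hm) by nra. unfold LLi, ig.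
      apply (Lam_ext b 1 _ Rlt_0_1 Hb Hm' _ _ _ (lip_inner_bcont _ _ _ x HL)). intros y Hy.
      unfold ipow, hden. rewrite clamp_id by (split; nra).
      rewrite RtoC_pow, RtoC_inv by (assert (0 <= x * y) by nra; nra).
      do 2 f_equal. rewrite RtoC_plus, !RtoC_mult, RtoC_opp. ring.
    - apply Rcpow_bcont, Hs. }
  rewrite E. field. split; assumption.
Qed.

(** * Contiguous relations for the series and for Euler's integral *)

Lemma is_hyp2F1_swap (a b c : C) (F : C -> C) : is_hyp2F1 a b c F -> is_hyp2F1 b a c F.
Proof.
  intros [H1 H2]. split; [exact H1|]. intros w Hw. eapply is_pseries_ext; [|apply H2, Hw].
  intros n. unfold gauss_coef. rewrite (Cmult_comm (poch a n)). reflexivity.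
Qed.

Lemma is_pseries_plus_C (f g : nat -> C) (w l l' : C) :
  @is_pseries C_AbsRing C_NormedModule f w l -> @is_pseries C_AbsRing C_NormedModule g w l' ->
  @is_pseries C_AbsRing C_NormedModule (fun n => (f n + g n)%C) w (l + l')%C.
Proof. intros H1 H2. exact (is_pseries_plus f g w l l' H1 H2). Qed.

Definition shiftC (f : nat -> C) (n : nat) : C := match n with O => RtoC 0 | S k => f k end.

Lemma is_pseries_shift_C (f : nat -> C) (w l : C) :
  @is_pseries C_AbsRing C_NormedModule f w l ->
  @is_pseries C_AbsRing C_NormedModule (shiftC f) w (w * l)%C.
Proof.
  intros H. eapply is_pseries_ext; [|exact (is_pseries_incr_1 f w l H)].
  intros [|n]; reflexivity.
Qed.

Lemma analytic_lin_comb (F G : C -> C) (p q r s w0 : C) : analytic_at F w0 -> analytic_at G w0 ->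
  analytic_at (fun w => (p + q * w) * F w + (r + s * w) * G w)%C w0.
Proof.
  intros (f & r1 & Hr1 & HF) (g & r2 & Hr2 & HG).
  exists (fun n => (p + q * w0) * f n + q * shiftC f n + ((r + s * w0) * g n + s * shiftC g n))%C, (Rmin r1 r2).
  split; [apply Rmin_pos; assumption|]. intros w Hw.
  assert (A := HF w (Rlt_le_trans _ _ _ Hw (Rmin_l _ _))). assert (B := HG w (Rlt_le_trans _ _ _ Hw (Rmin_r _ _))).
  replace ((p + q * w) * F w + (r + s * w) * G w)%C
    with ((p + q * w0) * F w + q * ((w - w0) * F w) + ((r + s * w0) * G w + s * ((w - w0) * G w)))%C by ring.
  exact (is_pseries_plus_C _ _ _ _ _
    (is_pseries_plus_C _ _ _ _ _ (is_pseries_scal_C _ _ _ _ A) (is_pseries_scal_C _ _ _ _ (is_pseries_shift_C _ _ _ A)))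
    (is_pseries_plus_C _ _ _ _ _ (is_pseries_scal_C _ _ _ _ B) (is_pseries_scal_C _ _ _ _ (is_pseries_shift_C _ _ _ B)))).
Qed.

(** Gauss' contiguous relation between [F(a - 1)], [F(a)] and [F(a + 1)]. *)
Lemma is_hyp2F1_lower (a b : C) (c : R) (F G : C -> C) : 0 < c -> (RtoC c - a <> 0)%C ->
  is_hyp2F1 a b (RtoC c) F -> is_hyp2F1 (a + 1) b (RtoC c) G ->
  is_hyp2F1 (a - 1) b (RtoC c)
    (fun w => ((RtoC c - 2 * a - (b - a) * w) * F w - a * (w - 1) * G w) / (RtoC c - a))%C.
Proof.
  intros Hc Hca [F1 F2] [G1 G2].
  assert (E : forall w, (((RtoC c - 2 * a) / (RtoC c - a) + (- (b - a) / (RtoC c - a)) * w) * F w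
              + (a / (RtoC c - a) + (- a / (RtoC c - a)) * w) * G w
            = ((RtoC c - 2 * a - (b - a) * w) * F w - a * (w - 1) * G w) / (RtoC c - a))%C).
  { intros w. field. exact Hca. }
  split.
  - intros w0 Hw0.
    destruct (analytic_lin_comb F G ((RtoC c - 2 * a) / (RtoC c - a)) (- (b - a) / (RtoC c - a))
      (a / (RtoC c - a)) (- a / (RtoC c - a)) w0 (F1 w0 Hw0) (G1 w0 Hw0)) as (f & r & Hr & Hf).
    exists f, r. split; [exact Hr|]. intros w Hw. rewrite <- E. apply Hf, Hw.
  - intros w Hw. rewrite <- E.
    assert (A := F2 w Hw). assert (B := G2 w Hw).
    rewrite Cmult_plus_distr_r, <- (Cmult_assoc _ w (F w)).
    rewrite (Cmult_plus_distr_r (a / (RtoC c - a))), <- (Cmult_assoc _ w (G w)).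
    eapply is_pseries_ext; [|exact (is_pseries_plus_C _ _ _ _ _
    (is_pseries_plus_C _ _ _ _ _ (is_pseries_scal_C _ _ _ _ A) (is_pseries_scal_C _ _ _ _ (is_pseries_shift_C _ _ _ A)))
    (is_pseries_plus_C _ _ _ _ _ (is_pseries_scal_C _ _ _ _ B) (is_pseries_scal_C _ _ _ _ (is_pseries_shift_C _ _ _ B))))].
    intros n. match goal with |- ?x = ?y => change (@eq C x y) end. cbv beta. unfold gauss_coef.
    destruct n as [|n].
    + simpl. field. exact Hca.
    + unfold shiftC.
      assert (P0 : poch (RtoC c) n <> 0%C) by (apply poch_neq_0, regular_RtoC; lra).
      assert (Pn : (RtoC c + RtoC (INR n) <> 0)%C) by (apply regular_RtoC; lra).
      assert (Fn := INR_factC n).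
      assert (Sn : (RtoC (INR n) + 1 <> 0)%C) by (rewrite <- RtoC_plus; apply RtoC_neq_0; generalize (pos_INR n); lra).
      replace (poch (a - 1)%C (S n)) with ((a - 1) * poch a n)%C.
      2: { rewrite poch_shift. do 2 f_equal. ring. }
      assert (Ea : (a * poch (a + 1) n = poch a n * (a + RtoC (INR n)))%C) by (rewrite <- poch_shift; reflexivity).
      assert (Ea2 : (a * poch (a + 1) (S n) = poch a n * (a + RtoC (INR n)) * (a + 1 + RtoC (INR n)))%C).
      { simpl poch. rewrite Cmult_assoc, Ea. reflexivity. }
      rewrite fact_simpl, mult_INR, RtoC_mult, S_INR, RtoC_plus.
      change (poch a (S n)) with (poch a n * (a + RtoC (INR n)))%C.
      change (poch b (S n)) with (poch b n * (b + RtoC (INR n)))%C.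
      change (poch (RtoC c) (S n)) with (poch (RtoC c) n * (RtoC c + RtoC (INR n)))%C.
      set (pa := poch a n) in *. set (pb := poch b n) in *. set (pc := poch (RtoC c) n) in *.
      set (f := RtoC (INR (fact n))) in *. set (k := RtoC (INR n)) in *.
      transitivity ((RtoC c - 2 * a) / (RtoC c - a) * (pa * (a + k) * (pb * (b + k)) / (pc * (RtoC c + k) * ((k + 1) * f)))
        + - (b - a) / (RtoC c - a) * (pa * pb / (pc * f))
        + ((a * poch (a + 1) (S n)) / (RtoC c - a) * ((pb * (b + k)) / (pc * (RtoC c + k) * ((k + 1) * f)))
           - (a * poch (a + 1) n) / (RtoC c - a) * (pb / (pc * f))))%C.
      { field. repeat split; assumption. }
      rewrite Ea, Ea2. field. repeat split; assumption.
Qed.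

(** Integration by parts with G = (1 + s y)^(-b), multiplied by - s. It is the recursion in b that
    Gauss' relation gives at w = - s, so both sides of Euler's formula descend together. *)
Lemma Lam_contiguous (a b : C) (c s : R) : 1 < Re a -> Re a < c -> 0 <= s ->
  let J q := Lam a 1 (RtoC c) (fun y => Rcpow (1 + s * y) (- q)) in
  ((RtoC c - b) * J (b - 1) + (2 * b - RtoC c - (a - b) * RtoC s) * J b - b * (RtoC s + 1) * J (b + 1) = 0)%C.
Proof.
  intros Ha Hc Hs J.
  assert (Hc' : 1 * Re a < Re (RtoC c)) by (rewrite re_RtoC; lra).
  assert (Q := fun q => Rcpow_bcont q s Hs).
  assert (D : forall y, 0 <= y < 1 -> cder (fun y => Rcpow (1 + s * y) (- b)) y (- b * RtoC s * Rcpow (1 + s * y) (- (b + 1)))%C).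
  { intros y Hy.
    assert (D2 := cder_comp (fun x => Rcpow x (- b)) (fun y => 1 + s * y) y _ s (cder_Rcpow (- b) (1 + s * y) ltac:(nra))
              ltac:(auto_derive; [trivial|ring])).
    eapply cder_eq; [|exact D2].
    assert (N : RtoC (1 + s * y) <> 0%C) by (apply RtoC_neq_0; nra).
    replace (- (b + 1))%C with (- b + - (1))%C by ring.
    rewrite Rcpow_plus, (Rcpow_opp _ 1), Rcpow_1 by nra. field. exact N. }
  assert (P := Lam_parts a 1 _ Rlt_0_1 Ha Hc' _ _ _ _ (Q b) (bcont_scal (- b * RtoC s)%C _ _ (Q (b + 1)%C)) D).
  cbv beta in P.
  assert (B1 := bcont_scal (RtoC c - b)%C _ _ (Q (b - 1)%C)).
  assert (B2 := bcont_scal (2 * b - RtoC c - (a - b) * RtoC s)%C _ _ (Q b)).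
  assert (B3 := bcont_scal (- (b * (RtoC s + 1)))%C _ _ (Q (b + 1)%C)).
  assert (B12 := bcont_plus _ _ _ _ B1 B2). assert (B123 := bcont_plus _ _ _ _ B12 B3).
  transitivity (Lam a 1 (RtoC c) (fun y => (RtoC c - b) * Rcpow (1 + s * y) (- (b - 1))
     + (2 * b - RtoC c - (a - b) * RtoC s) * Rcpow (1 + s * y) (- b)
     + - (b * (RtoC s + 1)) * Rcpow (1 + s * y) (- (b + 1)))%C).
  { rewrite (Lam_plus a 1 _ Rlt_0_1 Ha Hc' _ _ _ _ B12 B3), (Lam_plus a 1 _ Rlt_0_1 Ha Hc' _ _ _ _ B1 B2).
    rewrite (Lam_scal a 1 _ Rlt_0_1 Ha Hc' _ _ _ (Q (b - 1)%C)), (Lam_scal a 1 _ Rlt_0_1 Ha Hc' _ _ _ (Q b)),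
      (Lam_scal a 1 _ Rlt_0_1 Ha Hc' _ _ _ (Q (b + 1)%C)). unfold J. ring. }
  assert (E : forall y, 0 <= y < 1 -> ((RtoC c - b) * Rcpow (1 + s * y) (- (b - 1))
     + (2 * b - RtoC c - (a - b) * RtoC s) * Rcpow (1 + s * y) (- b)
     + - (b * (RtoC s + 1)) * Rcpow (1 + s * y) (- (b + 1))
     = RtoC (- s) * ((a - RtoC c / 1 * RtoC y) * Rcpow (1 + s * y) (- b) + RtoC (y * (1 - y)) * (- b * RtoC s * Rcpow (1 + s * y) (- (b + 1)))))%C).
  { intros y Hy. assert (Np : 0 < 1 + s * y) by nra.
    replace (- (b - 1))%C with (- (b + 1) + (1 + 1))%C by ring. replace (- b)%C with (- (b + 1) + 1)%C at 1 2 by ring.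
    rewrite !Rcpow_plus, !(Rcpow_1 _ Np).
    rewrite RtoC_plus, !RtoC_mult, RtoC_minus, RtoC_opp. field. }
  rewrite (Lam_ext a 1 _ Rlt_0_1 Ha Hc' _ _ _ B123 E).
  assert (Bp := parts_bcont a (RtoC c / 1) _ _ _ _ (Q b) (bcont_scal (- b * RtoC s)%C _ _ (Q (b + 1)%C))).
  rewrite (Lam_scal a 1 _ Rlt_0_1 Ha Hc' _ _ _ Bp), P. ring.
Qed.

Lemma euler_rep_lower (a b : C) (c : R) : 1 < Re a -> Re a < c -> (RtoC c - b <> 0)%C ->
  euler_rep a b c -> euler_rep a (b + 1) c -> euler_rep a (b - 1) c.
Proof.
  intros Ha Hc Hcb (F & HF & EF) (G & HG & EG).
  eexists. split.
  - apply is_hyp2F1_swap. apply (is_hyp2F1_lower b a c F G); [lra|exact Hcb| |]; apply is_hyp2F1_swap; assumption.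
  - intros s Hs. cbv beta.
    assert (J := Lam_contiguous a b c s Ha Hc Hs). cbv zeta in J.
    cbv beta in J. rewrite <- (EF s Hs), <- (EG s Hs) in J.
    set (J1 := Lam a 1 (RtoC c) (fun y => Rcpow (1 + s * y) (- (b - 1)))) in *.
    apply Ceq_minus.
    transitivity (- (((RtoC c - b) * J1
       + (2 * b - RtoC c - (a - b) * RtoC s) * (F (RtoC (- s)) * beta a 1 (RtoC c))
       - b * (RtoC s + 1) * (G (RtoC (- s)) * beta a 1 (RtoC c)))) / (RtoC c - b))%C.
    + rewrite RtoC_opp. field. exact Hcb.
    + rewrite J. field. exact Hcb.
Qed.

(** Induction on the number of unit steps from b to Re b > 1, keeping two consecutive values as the
    three-term relation requires. Each step divides by c - (b + 1), so the threshold on c may grow;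
    c = x / e will exceed it for small e. *)
Lemma euler_rep_all (a b : C) : 1 < Re a -> exists C0, forall c, C0 < c -> euler_rep a b c.
Proof.
  intros Ha.
  assert (G : forall (N : nat) (b : C), 1 < Re b + INR N -> exists C0, Re a <= C0 /\ forall c, C0 < c -> euler_rep a b c /\ euler_rep a (b + 1) c).
  { clear b. induction N as [|N IH]; intros b HN.
    - rewrite Rplus_0_r in HN. exists (Re a). split; [lra|]. intros c Hc.
      split; apply euler_rep_base; rewrite ?re_plus, ?re_RtoC; lra.
    - destruct (IH (b + 1)%C) as (C0 & H0 & H).
      { rewrite re_plus, re_RtoC. rewrite S_INR in HN. lra. }
      exists (Rmax C0 (Re b + 1)). split; [eapply Rle_trans; [exact H0|apply Rmax_l]|].
      intros c Hc.
      assert (c1 : C0 < c) by (eapply Rle_lt_trans; [apply Rmax_l|exact Hc]).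
      assert (c2 : Re b + 1 < c) by (eapply Rle_lt_trans; [apply Rmax_r|exact Hc]).
      destruct (H c c1) as [H1 H2]. split; [|exact H1].
      replace b with (b + 1 - 1)%C by ring. apply euler_rep_lower; try assumption; [lra|].
      intros E. apply (f_equal Re) in E. rewrite Re_minus, re_plus, !re_RtoC in E. lra. }
  destruct (nfloor_ex (Rabs (Re b) + 2)) as (N & _ & HN); [generalize (Rabs_pos (Re b)); lra|].
  destruct (G (S N) b) as (C0 & _ & H).
  { rewrite S_INR. generalize (Rle_abs (- Re b)). rewrite Rabs_Ropp. lra. }
  exists C0. intros c Hc. apply H, Hc.
Qed.

(** Passes from the unscaled integral at c = x / e to the scaled one, whose integrand has a limit as
    e tends to 0; the factor e^a cancels in quotients. *)
Lemma Lam_scale (a : C) (e x : R) (G : R -> C) B : 0 < e -> 1 < Re a -> e * Re a < x -> bcont G B ->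
  Lam a 1 (RtoC (x / e)) G = (Rcpow e a * Lam a e (RtoC x) G)%C.
Proof.
  intros He Ha Hx HG.
  assert (Hx1 : e * Re a < Re (RtoC x)) by (rewrite re_RtoC; exact Hx).
  assert (Hx2 : 1 * Re a < Re (RtoC (x / e))).
  { rewrite re_RtoC, Rmult_1_l. apply Rlt_div_r; lra. }
  assert (T := dens_G_tame a e _ G B He Ha Hx1 HG).
  unfold Lam. rewrite <- L_scal by exact T.
  rewrite <- (L_scale _ e He (dens_G_tame a 1 _ G B Rlt_0_1 Ha Hx2 HG)).
  symmetry. apply L_ext; [|apply istame_scal, T].
  intros t Ht. assert (EX : X 1 (e * t) = e * X e t).
  { rewrite eX, X_e by lra. rewrite Rmult_1_l. field. }
  rewrite EX, Rmult_1_l. unfold dens. rewrite EX, pw_mult by (try exact He; apply X_nonneg; lra).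
  replace (Rcpow e a) with (RtoC e * Rcpow e (a - 1))%C.
  2: { rewrite <- (Rcpow_1 e He) at 1. rewrite <- Rcpow_plus. f_equal. ring. }
  replace ((a * 1 - RtoC (x / e)) * RtoC (e * t))%C with ((a * RtoC e - RtoC x) * RtoC t)%C; [ring|].
  rewrite RtoC_mult, RtoC_div by lra. field. apply RtoC_neq_0. lra.
Qed.

(** Each derivative in x brings down a factor - t; this is the purpose of the index j in [kern]. *)
Lemma L_kern_cder (p b q : C) (e x : R) : istame (kern p b q 0 e x) ->
  cder (fun x => L (kern p b q 0 e x)) x (- L (kern p b q 1 e x))%C.
Proof.
  intros T. assert (D := L_der _ T).
  assert (D' : is_derive (fun y => y - x) x 1) by (auto_derive; [trivial|ring]).
  replace 0 with ((fun y => y - x) x) in D by (simpl; ring).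
  eapply cder_eq; [|eapply cder_ext; [|exact (cder_comp _ (fun y => y - x) _ _ _ D D')]].
  - rewrite Cmult_1_l. do 2 f_equal. apply functional_extensionality. intros t. unfold kern. simpl pow.
    rewrite !RtoC_mult. ring.
  - intros y. cbv beta. f_equal. apply functional_extensionality. intros t. unfold kern.
    rewrite <- Cexp_RtoC.
    replace ((q * RtoC e - RtoC y) * t)%C with ((q * RtoC e - RtoC x) * t + RtoC (- ((y - x) * t)))%C
      by (rewrite RtoC_opp, RtoC_mult, RtoC_minus; ring).
    rewrite Cexp_plus. ring.
Qed.

(** * The confluent limit *)

(** For j = 0 this is Gamma(a) U(a, a + 1 - b, x), with U Tricomi's function; at b = 0 it is
    Gamma(a) x^(-a), the normaliser used below. *)
Definition M (a b : C) (j : nat) (x : R) : C := L (kern (a - 1) b a j 0 x).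

Lemma kern_0_tame (a b : C) (j : nat) (x : R) : 1 < Re a -> 0 < x -> istame (kern (a - 1) b a j 0 x).
Proof. intros. apply kern_istame; [rewrite Re_minus, re_RtoC; lra|lra|rewrite Rmult_0_r; lra]. Qed.

Lemma M_scaled (a b : C) (x : R) : 1 < Re a -> 0 < x ->
  (Rcpow x a * M a b 0 x)%C
  = L (fun s => (pw s (a - 1) * Rcpow (1 + s / x) (- b) * Cexp (RtoC (- s)))%C).
Proof.
  intros Ha Hx.
  assert (T := kern_0_tame a b 0 x Ha Hx).
  unfold M. rewrite <- L_scal by exact T.
  assert (T2 := istame_scal (Rcpow x a) _ T).
  rewrite <- (L_scale _ (/ x) (Rinv_0_lt_compat _ Hx) T2).
  assert (T3 : istame (fun t => (RtoC (/ x) * (Rcpow x a * kern (a - 1) b a 0 0 x (/ x * t)))%C)).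
  { destruct T2 as (K & lam & h1 & h2 & h3).
    assert (Hi := Rinv_0_lt_compat _ Hx).
    exists (/ x * K), (lam * / x). split; [nra|]. split.
    - intros t Ht. apply ccont_mult; [apply ccont_const|].
      apply (ctends_comp (F := locally t) (G := locally (/ x * t)) (fun u => (Rcpow x a * kern (a - 1) b a 0 0 x u)%C) (fun t => / x * t)).
      + apply (ex_derive_continuous (fun t => / x * t)). auto_derive. trivial.
      + apply h2. nra.
    - intros t Ht. rewrite Cmod_mult, Cmod_R, (Rabs_pos_eq (/ x)) by lra. rewrite Rmult_assoc.
      apply Rmult_le_compat_l; [lra|]. eapply Rle_trans; [apply h3; nra|]. right. f_equal. f_equal. ring. }
  apply L_ext; [|exact T3].
  intros s Hs. unfold kern. rewrite X_0. simpl pow.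
  rewrite pw_mult by (try apply Rinv_0_lt_compat; lra).
  replace (1 + (1 - 0) * (/ x * s)) with (1 + s / x) by (field; lra).
  replace ((a * 0 - RtoC x) * RtoC (/ x * s))%C with (RtoC (- s)).
  2: { rewrite RtoC_opp, RtoC_mult, RtoC_inv by lra. field. apply RtoC_neq_0. lra. }
  replace (Rcpow x a) with (RtoC x * Rcpow x (a - 1))%C.
  2: { rewrite <- (Rcpow_1 x Hx) at 1. rewrite <- Rcpow_plus. f_equal. ring. }
  assert (E : (Rcpow x (a - 1) * Rcpow (/ x) (a - 1) = 1)%C).
  { rewrite <- Rcpow_mult, Rinv_r by (try apply Rinv_0_lt_compat; lra). apply Rcpow_base_1. }
  transitivity ((RtoC (/ x) * RtoC x) * (Rcpow x (a - 1) * Rcpow (/ x) (a - 1))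
                * (pw s (a - 1) * Rcpow (1 + s / x) (- b) * Cexp (RtoC (- s))))%C; [ring|].
  rewrite E, <- RtoC_mult, Rinv_l by lra. ring.
Qed.

Lemma GI_alt (a : C) : 1 < Re a ->
  GI a = L (fun s => (pw s (a - 1) * Cexp (RtoC (- s)))%C).
Proof.
  intros Ha. unfold GI. apply L_ext.
  - intros t Ht. unfold kern. rewrite X_0, Copp_0, Rcpow_0. simpl pow.
    replace ((0 * 0 - 1) * t)%C with (RtoC (- t)) by (rewrite RtoC_opp; ring). ring.
  - apply kern_istame; [rewrite Re_minus, re_RtoC; lra|lra|rewrite Rmult_0_r; lra].
Qed.

Lemma M_0_value (a : C) (x : R) : 1 < Re a -> 0 < x -> (Rcpow x a * M a 0 0 x)%C = GI a.
Proof.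
  intros Ha Hx. rewrite M_scaled, GI_alt by assumption. f_equal. apply functional_extensionality.
  intros s. rewrite Copp_0, Rcpow_0. ring.
Qed.

Lemma M_0_neq_0 (a : C) (x : R) : 1 < Re a -> 0 < x -> M a 0 0 x <> 0%C.
Proof.
  intros Ha Hx E. apply (GI_neq_0 a Ha). rewrite <- (M_0_value a x Ha Hx), E. ring.
Qed.

(** After s = x t the integrand is s^(a - 1) (1 + s / x)^(-b) exp (- s); for x > 1 it is dominated
    by a power of 1 + s times exp (- s), and it converges to the integrand of Gamma(a). *)
Lemma M_at_infinity (a b : C) : 1 < Re a ->
  ctends (Rbar_locally p_infty) (fun x => (Rcpow x a * M a b 0 x)%C) (GI a).
Proof.
  intros Ha.
  apply ctends_ext_loc with (fun x => L (fun s => (pw s (a - 1) * Rcpow (1 + s / x) (- b) * Cexp (RtoC (- s)))%C)).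
  { exists 0. intros x Hx. symmetry. apply M_scaled; assumption. }
  rewrite GI_alt by exact Ha.
  assert (Hpp : 0 <= Re a - 1 + Rabs (Re b)) by (generalize (Rabs_pos (Re b)); lra).
  destruct (power_le_exp _ (1/2) Hpp ltac:(lra)) as (K & HK & HG).
  assert (Bd : forall p t, 0 <= t -> 0 <= p <= Re a - 1 + Rabs (Re b) ->
             exp (p * ln (1 + t)) * exp (- t) <= K * exp (- (1/2) * t)).
  { intros p t Ht Hp. apply Rle_trans with (K * exp (1/2 * t) * exp (- t)).
    - apply Rmult_le_compat_r; [left; apply exp_pos|]. eapply Rle_trans; [|apply HG, Ht].
      apply exp_le_compat. apply Rmult_le_compat_r; [apply ln_nonneg|]; lra.
    - right. rewrite Rmult_assoc, <- exp_plus. f_equal. f_equal. lra. }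
  assert (Pw : forall t, 0 <= t -> Cmod (pw t (a - 1)) <= exp ((Re a - 1) * ln (1 + t))).
  { intros t Ht. assert (Q := Cmod_pw_le t (1 + t) (a - 1)). rewrite Re_minus, re_RtoC in Q. apply Q; lra. }
  assert (C1 : forall t, ccont (fun s => pw s (a - 1)) t).
  { intros t. apply (pw_tends (fun s => s)); [rewrite Re_minus, re_RtoC; lra|apply continuous_id]. }
  assert (C2 : forall t, ccont (fun s => Cexp (RtoC (- s))) t).
  { intros t. apply ctends_Cexp, ctends_RtoC. apply (ex_derive_continuous (fun s => - s)). auto_derive. trivial. }
  apply L_dominated with K (1/2).
  - exists 1. intros x Hx. split; [lra|]. split.
    + intros t Ht. apply ccont_mult; [apply ccont_mult; [apply C1|]|apply C2].
      apply (ctends_Rcpow (fun s => 1 + s / x)).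
      * assert (0 <= t / x) by (apply Rdiv_le_0_compat; lra). lra.
      * apply (ex_derive_continuous (fun s => 1 + s / x)). auto_derive. lra.
    + intros t Ht. rewrite !Cmod_mult, Cmod_Rcpow, Cmod_Cexp, re_RtoC.
      eapply Rle_trans; [|apply (Bd (Re a - 1 + Rabs (Re b)) t Ht); lra].
      rewrite Rmult_plus_distr_r, exp_plus. apply Rmult_le_compat_r; [left; apply exp_pos|].
      apply Rmult_le_compat; [apply Cmod_ge_0|left; apply exp_pos|apply Pw, Ht|].
      apply exp_le_compat. rewrite re_opp.
      assert (H0 : 0 <= t / x <= t).
      { split; [apply Rdiv_le_0_compat; lra|]. apply Rle_div_l; nra. }
      assert (0 <= ln (1 + t / x)) by (apply ln_nonneg; lra).
      assert (ln (1 + t / x) <= ln (1 + t)) by (apply ln_le; lra).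
      assert (- Re b <= Rabs (Re b)) by (rewrite <- Rabs_Ropp; apply Rle_abs).
      generalize (Rabs_pos (Re b)). nra.
  - split; [lra|]. split.
    + intros t Ht. apply ccont_mult; [apply C1|apply C2].
    + intros t Ht. rewrite Cmod_mult, Cmod_Cexp, re_RtoC.
      eapply Rle_trans; [|apply (Bd (Re a - 1) t Ht); generalize (Rabs_pos (Re b)); lra].
      apply Rmult_le_compat_r; [left; apply exp_pos|apply Pw, Ht].
  - intros t0 Ht0.
    assert (Hs : filterlim (fun p : R * R => snd p) (filter_prod (Rbar_locally p_infty) (locally t0)) (locally t0))
      by apply filterlim_snd.
    replace (pw t0 (a - 1) * Cexp (RtoC (- t0)))%C with (pw t0 (a - 1) * Rcpow 1 (- b) * Cexp (RtoC (- t0)))%C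
      by (rewrite Rcpow_base_1; ring).
    apply ctends_mult; [apply ctends_mult|].
    + apply (pw_tends (F := filter_prod (Rbar_locally p_infty) (locally t0)) (fun p => snd p));
        [rewrite Re_minus, re_RtoC; lra|exact Hs].
    + apply (ctends_Rcpow (F := filter_prod (Rbar_locally p_infty) (locally t0)) (fun p => 1 + snd p / fst p)); [lra|].
      assert (Hi : ctends (filter_prod (Rbar_locally p_infty) (locally t0)) (fun p => RtoC (/ fst p)) (RtoC 0)).
      { apply ctends_RtoC. apply (filterlim_comp _ _ _ (fun p : R * R => fst p) (fun x => / x) _ (Rbar_locally p_infty) _ (filterlim_fst)).
        apply (filterlim_Rbar_inv p_infty). discriminate. }
      assert (Q := ctends_re _ _ (ctends_plus _ _ _ _ (ctends_const (RtoC 1)) (ctends_mult _ _ _ _ (ctends_RtoC _ _ Hs) Hi))).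
      replace (Re (1 + RtoC t0 * 0)%C) with 1 in Q by (rewrite Cmult_0_r, Cplus_0_r; reflexivity).
      eapply filterlim_ext; [|exact Q]. intros p. cbv beta.
      rewrite <- RtoC_mult, <- RtoC_plus, re_RtoC. reflexivity.
    + apply ctends_Cexp, ctends_RtoC. apply (filterlim_comp _ _ _ _ Ropp _ _ _ Hs).
      apply (ex_derive_continuous Ropp). auto_derive. trivial.
Qed.

Lemma M_cder (a b : C) (x : R) : 1 < Re a -> 0 < x -> cder (M a b 0) x (- M (a + 1) b 0 x)%C.
Proof.
  intros Ha Hx. eapply cder_eq; [|exact (L_kern_cder _ _ _ _ _ (kern_0_tame a b 0 x Ha Hx))].
  f_equal. unfold M. apply L_ext; [|apply kern_0_tame; assumption].
  intros t Ht. unfold kern. rewrite X_0. simpl pow.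
  replace (a + 1 - 1)%C with (a - 1 + 1)%C by ring. rewrite pw_plus_1 by lra.
  rewrite !RtoC_mult. replace (((a + 1) * 0 - x) * t)%C with ((a * 0 - x) * t)%C by ring. ring.
Qed.

(** The left side is the integral of the derivative of t^a (1 + t)^(1 - b) exp (- x t), a function
    that vanishes at 0 and at infinity. *)
Lemma M_recur (a b : C) (x : R) : 1 < Re a -> 0 < x ->
  (a * M a b 0 x + (a + 1 - b - RtoC x) * M (a + 1) b 0 x - RtoC x * M (a + 2) b 0 x = 0)%C.
Proof.
  intros Ha Hx.
  pose (f := fun t => (pw t a * Rcpow (1 + t) (1 - b) * Cexp (- RtoC x * RtoC t))%C).
  pose (G := fun t => (a * kern (a - 1) b a 0 0 x t + (a + 1 - b - RtoC x) * kern (a + 1 - 1) b (a + 1) 0 0 x t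
                       + - RtoC x * kern (a + 2 - 1) b (a + 2) 0 0 x t)%C).
  assert (T1 := kern_0_tame a b 0 x Ha Hx).
  assert (T2 : istame (kern (a + 1 - 1) b (a + 1) 0 0 x)) by (apply kern_0_tame; [rewrite re_plus, re_RtoC; lra|exact Hx]).
  assert (T3 : istame (kern (a + 2 - 1) b (a + 2) 0 0 x)) by (apply kern_0_tame; [rewrite re_plus, re_RtoC; lra|exact Hx]).
  assert (TG : istame G) by (apply istame_plus; [apply istame_plus|]; apply istame_scal; assumption).
  transitivity (L G).
  { unfold G. rewrite (L_plus (fun t => (a * kern (a - 1) b a 0 0 x t + (a + 1 - b - RtoC x) * kern (a + 1 - 1) b (a + 1) 0 0 x t)%C)).
    - rewrite L_plus, !L_scal by (try apply istame_scal; assumption). unfold M. ring.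
    - apply istame_plus; apply istame_scal; assumption.
    - apply istame_scal; assumption. }
  assert (E : forall t, 0 <= t -> G t = (a * pw t (a - 1) * Rcpow (1 + t) (1 - b) * Cexp (- RtoC x * RtoC t)
      + pw t a * ((1 - b) / RtoC (1 + t) * Rcpow (1 + t) (1 - b)) * Cexp (- RtoC x * RtoC t)
      + pw t a * Rcpow (1 + t) (1 - b) * (- RtoC x * Cexp (- RtoC x * RtoC t)))%C).
  { intros t Ht. unfold G, kern. rewrite X_0. simpl pow.
    assert (N : RtoC (1 + t) <> 0%C) by (apply RtoC_neq_0; lra).
    replace (1 + (1 - 0) * t) with (1 + t) by ring.
    replace (a + 2 - 1)%C with (a - 1 + 1 + 1)%C by ring. replace (a + 1 - 1)%C with (a - 1 + 1)%C by ring.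
    replace (pw t a) with (RtoC t * pw t (a - 1))%C by (rewrite <- pw_plus_1 by exact Ht; f_equal; ring).
    rewrite !pw_plus_1 by exact Ht.
    replace (1 - b)%C with (- b + 1)%C by ring. rewrite Rcpow_plus, Rcpow_1 by lra.
    replace ((a * 0 - x) * t)%C with (- RtoC x * RtoC t)%C by ring.
    replace (((a + 1) * 0 - x) * t)%C with (- RtoC x * RtoC t)%C by ring.
    replace (((a + 2) * 0 - x) * t)%C with (- RtoC x * RtoC t)%C by ring.
    rewrite RtoC_plus in *. field. exact N. }
  rewrite (L_ftc f G 0%C).
  - unfold f. rewrite (pw_nonpos 0) by lra. ring.
  - intros t Ht. rewrite E by exact Ht. unfold f.
    assert (D1 := cder_pw a t Ha).
    assert (D2 := cder_comp (fun u => Rcpow u (1 - b)) (fun s => 1 + s) t _ 1 (cder_Rcpow (1 - b) (1 + t) ltac:(lra))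
              ltac:(auto_derive; [trivial|ring])).
    assert (D3 : cder (fun s => Cexp (- RtoC x * RtoC s)%C) t (- RtoC x * Cexp (- RtoC x * RtoC t))%C).
    { apply cder_Cexp. eapply cder_eq; [|apply cder_mult; [apply cder_const|apply cder_RtoC, (is_derive_id (K := R_AbsRing))]].
      cbv beta. unfold one; simpl. ring. }
    eapply cder_eq; [|exact (cder_mult _ _ _ _ _ (cder_mult _ _ _ _ _ D1 D2) D3)].
    cbv beta. ring.
  - exact TG.
  - destruct (power_le_exp (Re a + Rabs (1 - Re b)) (x / 2)) as (K & HK & HG); [generalize (Rabs_pos (1 - Re b)); lra|lra|].
    intros eps He. destruct (exp_decay_small K (x / 2) eps ltac:(lra) He) as (A0 & HA0 & HA).
    exists A0. intros t Ht. specialize (HA t ltac:(lra)). eapply Rle_lt_trans; [|exact HA].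
    replace (f t - 0)%C with (f t) by ring. unfold f.
    rewrite !Cmod_mult, Cmod_Rcpow, Cmod_Cexp, re_scal_r, re_opp, re_RtoC, Re_minus, re_RtoC.
    apply Rle_trans with (exp ((Re a + Rabs (1 - Re b)) * ln (1 + t)) * exp (- x * t)).
    + apply Rmult_le_compat_r; [left; apply exp_pos|]. rewrite Rmult_plus_distr_r, exp_plus.
      apply Rmult_le_compat; [apply Cmod_ge_0|left; apply exp_pos|apply Cmod_pw_le; lra|].
      apply exp_le_compat, Rmult_le_compat_r; [apply ln_nonneg; lra|apply Rle_abs].
    + apply Rle_trans with (K * exp (x / 2 * t) * exp (- x * t)).
      * apply Rmult_le_compat_r; [left; apply exp_pos|apply HG; lra].
      * right. rewrite Rmult_assoc, <- exp_plus. f_equal. f_equal. lra.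
Qed.

(** For [e = 1 - xi], the argument [xi / (xi - 1)] of the kernel is [1 - / e]. *)
Definition Hf (a b : C) (e x : R) : C := hyp2F1 a b (RtoC (x / e)) (RtoC (1 - / e)).

Definition near (x0 : R) : (R * R -> Prop) -> Prop := filter_prod (at_right 0) (locally x0).

(** Convergence as [(e, x)] tends to [(0+, x0)] jointly, so that it can be evaluated along
    [x = e (k + const)], together with the [x]-derivatives. *)
Definition Hf_converges (a b : C) (Phi Phi1 : R -> C) : Prop :=
  forall x0, 0 < x0 -> exists D : R * R -> C,
    near x0 (fun p => (exists F, is_hyp2F1 a b (RtoC (snd p / fst p)) F)
                      /\ cder (Hf a b (fst p)) (snd p) (D p)) /\
    ctends (near x0) (fun p => Hf a b (fst p) (snd p)) (Phi x0) /\
    ctends (near x0) D (Phi1 x0).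

(** The first-order system satisfied by the limits [f] at [a] and [g] at [a + 1]. *)
Definition confluent_system (a b : C) (f g f1 g1 : R -> C) : Prop :=
  (forall x, 0 < x -> cder f x (f1 x) /\ cder g x (g1 x)
     /\ (RtoC x * f1 x = a * (f x - g x))%C /\ (RtoC x * g1 x = (RtoC x + b) * g x - RtoC x * f x)%C)
  /\ ctends (Rbar_locally p_infty) f 1%C /\ ctends (Rbar_locally p_infty) g 1%C.

(** An identity between functions of (e, x) can be differentiated in x only if, at fixed e, it holds
    in a whole neighbourhood of x. *)
Lemma near_open (x0 : R) (P : R * R -> Prop) : near x0 P ->
  near x0 (fun p => P p /\ locally (snd p) (fun y => P (fst p, y))).
Proof.
  intros [Q S HQ HS H]. apply locally_locally in HS.
  apply Filter_prod with Q (fun y => locally y S); [exact HQ|exact HS|].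
  intros e y He Hy. split.
  - apply H; [exact He|]. exact (locally_singleton _ _ Hy).
  - revert Hy. apply filter_imp. intros y' Hy'. apply H; assumption.
Qed.

Lemma near_fst (x0 : R) : filterlim (fun p : R * R => fst p) (near x0) (locally 0).
Proof.
  intros P HP. apply (filterlim_fst (F := at_right 0) (G := locally x0)). apply filter_le_within, HP.
Qed.

Lemma near_snd (x0 : R) : filterlim (fun p : R * R => snd p) (near x0) (locally x0).
Proof. apply filterlim_snd. Qed.

Lemma near_small (x0 d : R) : 0 < x0 -> 0 < d -> near x0 (fun p => 0 < fst p < d /\ x0 * 3 / 4 < snd p).
Proof.
  intros Hx Hd. apply Filter_prod with (fun e => 0 < e < d) (fun x => x0 * 3 / 4 < x).
  - exists (mkposreal d Hd). intros e He He0. change (Rabs (e - 0) < d) in He. rewrite Rminus_0_r in He.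
    apply Rabs_def2 in He. lra.
  - exists (mkposreal (x0 / 4) ltac:(lra)). intros x Hxx. change (Rabs (x - x0) < x0 / 4) in Hxx.
    apply Rabs_def2 in Hxx. lra.
  - intros; simpl; split; assumption.
Qed.

#[global] Instance near_filter (x0 : R) : ProperFilter (near x0).
Proof. unfold near. apply filter_prod_proper; typeclasses eauto. Qed.

(** With s = 1 / e - 1 and y = e X, the base 1 + s y becomes 1 + (1 - e) X. Euler's integral is then
    e^a times an integral of [kern], the beta normaliser is the same with b = 0, and F is the
    quotient of two integrals with known limits. *)
Lemma Hf_converges_base (a b : C) : 1 < Re a ->
  Hf_converges a b (fun x => (M a b 0 x / M a 0 0 x)%C)
   (fun x => ((- M (a + 1) b 0 x * M a 0 0 x - M a b 0 x * - M (a + 1) 0 0 x) / (M a 0 0 x * M a 0 0 x))%C).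
Proof.
  intros Ha x0 Hx0.
  destruct (euler_rep_all a b Ha) as (C0 & HC0).
  pose (N := fun b j (p : R * R) => L (kern (a - 1) b a j (fst p) (snd p))).
  exists (fun p => ((- N b 1%nat p * N 0%C 0%nat p - N b 0%nat p * - N 0%C 1%nat p) / (N 0%C 0%nat p * N 0%C 0%nat p))%C).
  assert (Hp1 : 0 < Re (a - 1)%C) by (rewrite Re_minus, re_RtoC; lra).
  assert (NT : forall b j, ctends (near x0) (N b j) (L (kern (a - 1) b a j 0 x0))).
  { intros b' j. apply (L_kern_tends (fun p : R * R => fst p) (fun p => snd p)); [exact Hp1|exact Hx0| |apply near_fst|apply near_snd].
    generalize (near_small x0 1 Hx0 Rlt_0_1). apply filter_imp. intros p Hp. lra. }
  assert (M1 : forall b x, 0 < x -> L (kern (a - 1) b a 1 0 x) = M (a + 1) b 0 x).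
  { intros b' x Hx.
    assert (E := cder_unique _ _ _ _ (L_kern_cder _ _ _ _ _ (kern_0_tame a b' 0 x Ha Hx)) (M_cder a b' x Ha Hx)).
    transitivity (- (- L (kern (a - 1) b' a 1 0 x)))%C; [ring|]. rewrite E. ring. }
  assert (NT0 : forall b, ctends (near x0) (N b 0%nat) (M a b 0 x0)) by (intros b'; exact (NT b' 0%nat)).
  assert (NT1 : forall b, ctends (near x0) (N b 1%nat) (M (a + 1) b 0 x0)).
  { intros b'. rewrite <- M1 by exact Hx0. exact (NT b' 1%nat). }
  destruct (kern_tame (a - 1) b a 0 x0 Hp1 Hx0) as (K1 & e1 & He1 & HT1).
  destruct (kern_tame (a - 1) 0%C a 0 x0 Hp1 Hx0) as (K2 & e2 & He2 & HT2).
  (* C1 exceeds both the threshold of Euler's representation and Re a; the bound d on e forces c = x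
     / e > C1. *)
  pose (C1 := Rabs C0 + Rabs (Re a) + 1).
  assert (HC1 : 0 < C1) by (unfold C1; generalize (Rabs_pos C0) (Rabs_pos (Re a)); lra).
  pose (d := Rmin (Rmin e1 e2) (x0 * 3 / 4 / C1)).
  assert (Hd : 0 < d) by (repeat apply Rmin_pos; try lra; apply Rdiv_lt_0_compat; lra).
  assert (Good : forall e x, 0 < e < d -> x0 * 3 / 4 < x ->
     (exists F, is_hyp2F1 a b (RtoC (x / e)) F) /\ istame (kern (a - 1) b a 0 e x)
     /\ istame (kern (a - 1) 0%C a 0 e x) /\ N 0%C 0%nat (e, x) <> 0%C
     /\ Hf a b e x = (N b 0%nat (e, x) / N 0%C 0%nat (e, x))%C).
  { intros e x He Hx.
    assert (d1 : e < e1) by (eapply Rlt_le_trans; [apply He|]; eapply Rle_trans; [apply Rmin_l|apply Rmin_l]).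
    assert (d2 : e < e2) by (eapply Rlt_le_trans; [apply He|]; eapply Rle_trans; [apply Rmin_l|apply Rmin_r]).
    assert (d3 : e < x0 * 3 / 4 / C1) by (eapply Rlt_le_trans; [apply He|apply Rmin_r]).
    apply Rlt_div_r in d3; [|exact HC1].
    assert (c1 : C1 < x / e) by (apply Rlt_div_r; lra).
    assert (a1 := Rle_abs C0). assert (a2 := Rle_abs (Re a)). assert (a3 := Rabs_pos C0). assert (a4 := Rabs_pos (Re a)).
    assert (c2 : Re a < x / e) by (unfold C1 in c1; lra).
    destruct (HC0 (x / e)) as (F & HF & EF); [unfold C1 in c1; lra|].
    assert (T1 : istame (kern (a - 1) b a 0 e x)) by (eexists; eexists; apply HT1; lra).
    assert (T2 : istame (kern (a - 1) 0%C a 0 e x)) by (eexists; eexists; apply HT2; lra).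
    assert (c3 : e * Re a < x) by (apply Rlt_div_r in c2; lra).
    assert (NB : forall q, istame (kern (a - 1) q a 0 e x) ->
       (Rcpow e a * N q 0%nat (e, x))%C = Lam a 1 (RtoC (x / e)) (fun y => Rcpow (1 + (/ e - 1) * y) (- q))).
    { intros q Tq.
      assert (Ie : 1 <= / e) by (rewrite <- Rinv_1; apply Rinv_le_contravar; lra).
      rewrite (Lam_scale a e x _ (exp (Rabs (Re q) * ln (1 + (/ e - 1)))) ltac:(lra) Ha c3 (Rcpow_bcont q (/ e - 1) ltac:(lra))).
      f_equal. unfold N, Lam. simpl fst; simpl snd. apply L_ext; [|exact Tq].
      intros t Ht. unfold kern, dens. simpl pow.
      replace (1 + (/ e - 1) * (e * X e t)) with (1 + (1 - e) * X e t) by (field; lra). ring. }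
    assert (B0 : (Rcpow e a * N 0%C 0%nat (e, x))%C = beta a 1 (RtoC (x / e))).
    { rewrite (NB _ T2). unfold beta. f_equal. apply functional_extensionality. intros y. rewrite Copp_0. apply Rcpow_0. }
    assert (Bn : beta a 1 (RtoC (x / e)) <> 0%C).
    { replace (RtoC (x / e)) with ((RtoC (x / e) - a) + a)%C by ring. apply beta_neq_0; [exact Ha|].
      rewrite Re_minus, re_RtoC. lra. }
    assert (Nn : N 0%C 0%nat (e, x) <> 0%C).
    { intros E. apply Bn. rewrite <- B0, E. ring. }
    repeat split; try assumption; [exists F; exact HF|].
    unfold Hf. assert (Ie : 1 <= / e) by (rewrite <- Rinv_1; apply Rinv_le_contravar; lra).
    replace (1 - / e) with (- (/ e - 1)) by ring.
    rewrite (hyp2F1_value _ _ _ F _ HF) by lra.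
    specialize (EF (/ e - 1) ltac:(lra)). rewrite <- (NB _ T1), <- B0 in EF.
    assert (Rn := Rcpow_neq_0 e a).
    transitivity (F (RtoC (- (/ e - 1))) * (Rcpow e a * N 0%C 0%nat (e, x)) / (Rcpow e a * N 0%C 0%nat (e, x)))%C.
    - field. split; assumption.
    - rewrite EF. field. split; assumption. }
  assert (Near := near_small x0 d Hx0 Hd).
  split; [|split].
  - generalize (near_open _ _ Near). apply filter_imp. intros [e x] [[He Hx] Hloc]. simpl fst in *; simpl snd in *.
    destruct (Good e x He Hx) as (G1 & T1 & T2 & Nn & EH). split; [exact G1|].
    apply cder_ext_loc with (fun y => (N b 0%nat (e, y) / N 0%C 0%nat (e, y))%C).
    + revert Hloc. apply filter_imp. intros y [_ Hy]. symmetry. apply Good; assumption.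
    + exact (cder_div (fun y => N b 0%nat (e, y)) (fun y => N 0%C 0%nat (e, y)) x _ _ Nn
        (L_kern_cder _ _ _ _ _ T1) (L_kern_cder _ _ _ _ _ T2)).
  - apply ctends_ext_loc with (fun p => (N b 0%nat p / N 0%C 0%nat p)%C).
    + revert Near. apply filter_imp. intros [e x] [He Hx]. symmetry. apply Good; assumption.
    + exact (ctends_div _ _ _ _ (M_0_neq_0 a x0 Ha Hx0) (NT0 b) (NT0 0%C)).
  - assert (Mn := M_0_neq_0 a x0 Ha Hx0).
    exact (ctends_div _ _ _ _ (Cmult_neq_0 _ _ Mn Mn)
      (ctends_minus _ _ _ _ (ctends_mult _ _ _ _ (ctends_opp _ _ (NT1 b)) (NT0 0%C))
         (ctends_mult _ _ _ _ (NT0 b) (ctends_opp _ _ (NT1 0%C))))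
      (ctends_mult _ _ _ _ (NT0 0%C) (NT0 0%C))).
Qed.

Lemma Hf_converges_lower (a b : C) (f g f1 g1 : R -> C) : Hf_converges a b f f1 -> Hf_converges (a + 1) b g g1 ->
  Hf_converges (a - 1) b (fun x => (((RtoC x + b - a) * f x + a * g x) / RtoC x)%C)
   (fun x => (((f x + (RtoC x + b - a) * f1 x + a * g1 x) * RtoC x - ((RtoC x + b - a) * f x + a * g x)) / (RtoC x * RtoC x))%C).
Proof.
  intros HF HG x0 Hx0.
  destruct (HF x0 Hx0) as (D & HF1 & HF2 & HF3). destruct (HG x0 Hx0) as (E & HG1 & HG2 & HG3).
  (* u and v are coefficients of the contiguous relation multiplied by e, with c = x / e and w = 1 -
     1 / e. So rescaled they converge, to x + b - a and to x, and the coefficient - a (w - 1)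
     becomes the constant a. *)
  pose (u := fun p : R * R => (RtoC (snd p) - 2 * a * RtoC (fst p) - (b - a) * (RtoC (fst p) - 1))%C).
  pose (v := fun p : R * R => (RtoC (snd p) - a * RtoC (fst p))%C).
  assert (Ce : ctends (near x0) (fun p => RtoC (fst p)) (RtoC 0)) by (apply ctends_RtoC, near_fst).
  assert (Cx : ctends (near x0) (fun p => RtoC (snd p)) (RtoC x0)) by (apply ctends_RtoC, near_snd).
  assert (Cu : ctends (near x0) u (RtoC x0 + b - a)%C).
  { replace (RtoC x0 + b - a)%C with (RtoC x0 - 2 * a * 0 - (b - a) * (0 - 1))%C by ring.
    apply ctends_minus; [apply ctends_minus; [exact Cx|]|].
    - apply ctends_mult; [apply ctends_const|exact Ce].
    - apply ctends_mult; [apply ctends_const|]. apply ctends_minus; [exact Ce|apply ctends_const]. }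
  assert (Cv : ctends (near x0) v (RtoC x0)).
  { replace (RtoC x0) with (RtoC x0 - a * 0)%C by ring. apply ctends_minus; [exact Cx|].
    apply ctends_mult; [apply ctends_const|exact Ce]. }
  assert (Nx : RtoC x0 <> 0%C) by (apply RtoC_neq_0; lra).
  assert (Vn := ctends_ne0 _ _ Nx Cv).
  pose (Ff := fun p : R * R => Hf a b (fst p) (snd p)). pose (Fg := fun p : R * R => Hf (a + 1) b (fst p) (snd p)).
  exists (fun p => (((Ff p + u p * D p + a * E p) * v p - (u p * Ff p + a * Fg p)) / (v p * v p))%C).
  assert (All : near x0 (fun p => (exists F, is_hyp2F1 (a - 1) b (RtoC (snd p / fst p)) F) /\ v p <> 0%C
      /\ Hf (a - 1) b (fst p) (snd p) = ((u p * Ff p + a * Fg p) / v p)%C)).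
  { generalize (filter_and _ _ (near_small x0 1 Hx0 Rlt_0_1) (filter_and _ _ HF1 (filter_and _ _ HG1 Vn))).
    apply filter_imp. intros [e x]. unfold v, u, Ff, Fg. simpl fst; simpl snd.
    intros ((He & Hx) & ((F & IF) & _) & ((G & IG) & _) & Nv).
    assert (Hxe : 0 < x / e) by (apply Rdiv_lt_0_compat; lra).
    assert (NeC : RtoC e <> 0%C) by (apply RtoC_neq_0; lra).
    assert (Nca : (RtoC (x / e) - a <> 0)%C).
    { intros Z. apply Nv. rewrite RtoC_div in Z by lra.
      replace (RtoC x - a * RtoC e)%C with ((RtoC x / RtoC e - a) * RtoC e)%C by (field; exact NeC). rewrite Z. ring. }
    assert (IL := is_hyp2F1_lower a b (x / e) F G Hxe Nca IF IG).
    split; [eexists; exact IL|]. split; [exact Nv|].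
    unfold Hf. assert (Ie : 1 <= / e) by (rewrite <- Rinv_1; apply Rinv_le_contravar; lra).
    replace (1 - / e) with (- (/ e - 1)) by ring.
    rewrite (hyp2F1_value _ _ _ _ _ IL), (hyp2F1_value _ _ _ _ _ IF), (hyp2F1_value _ _ _ _ _ IG) by lra.
    rewrite RtoC_div in * by lra. rewrite RtoC_opp, RtoC_minus, RtoC_inv by lra.
    field. repeat split; assumption. }
  split; [|split].
  - generalize (filter_and _ _ (near_open _ _ All) (filter_and _ _ HF1 HG1)). apply filter_imp.
    intros [e x]. simpl fst; simpl snd. intros (((IL & Nv & _) & Hloc) & (_ & D1) & (_ & D2)).
    split; [exact IL|].
    apply cder_ext_loc with (fun y => ((u (e, y) * Hf a b e y + a * Hf (a + 1) b e y) / v (e, y))%C).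
    + revert Hloc. apply filter_imp. intros y (_ & _ & Hy). symmetry. exact Hy.
    + assert (Did : cder (fun y => RtoC y) x 1%C) by (apply cder_RtoC, (is_derive_id (K := R_AbsRing))).
      assert (Du : cder (fun y => u (e, y)) x 1%C).
      { unfold u; simpl fst; simpl snd. eapply cder_eq; [|apply cder_minus; [apply cder_minus; [exact Did|apply cder_const]|apply cder_const]]. ring. }
      assert (Dv : cder (fun y => v (e, y)) x 1%C).
      { unfold v; simpl fst; simpl snd. eapply cder_eq; [|apply cder_minus; [exact Did|apply cder_const]]. ring. }
      eapply cder_eq; [|exact (cder_div _ _ _ _ _ Nv (cder_plus _ _ _ _ _ (cder_mult _ _ _ _ _ Du D1)
        (cder_mult _ _ _ _ _ (cder_const a x) D2)) Dv)].
      cbv beta. unfold Ff, Fg. simpl fst; simpl snd. field. exact Nv.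
  - apply ctends_ext_loc with (fun p => ((u p * Ff p + a * Fg p) / v p)%C).
    + revert All. apply filter_imp. intros p (_ & _ & Hp). symmetry. exact Hp.
    + apply ctends_div; [exact Nx| |exact Cv].
      apply ctends_plus; apply ctends_mult; try assumption. apply ctends_const.
  - apply ctends_div; [apply Cmult_neq_0; exact Nx| |apply ctends_mult; exact Cv].
    apply ctends_minus.
    + apply ctends_mult; [|exact Cv]. apply ctends_plus; [apply ctends_plus|].
      * exact HF2.
      * apply ctends_mult; assumption.
      * apply ctends_mult; [apply ctends_const|assumption].
    + apply ctends_plus; apply ctends_mult; try assumption. apply ctends_const.
Qed.

(** The pair moves down one place: the old f serves as the new g. The new f is the limit form of the
    contiguous relation, and the system itself verifies its equations. *)
Lemma confluent_system_lower (a b : C) (f g f1 g1 : R -> C) : confluent_system a b f g f1 g1 ->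
  confluent_system (a - 1) b (fun x => (((RtoC x + b - a) * f x + a * g x) / RtoC x)%C) f
   (fun x => (((f x + (RtoC x + b - a) * f1 x + a * g1 x) * RtoC x - ((RtoC x + b - a) * f x + a * g x)) / (RtoC x * RtoC x))%C) f1.
Proof.
  intros (H & Lf & Lg). split; [|split; [|exact Lf]].
  - intros x Hx. destruct (H x Hx) as (Df & Dg & E1 & E2).
    assert (Nx : RtoC x <> 0%C) by (apply RtoC_neq_0; lra).
    assert (Did : cder (fun y => RtoC y) x 1%C) by (apply cder_RtoC, (is_derive_id (K := R_AbsRing))).
    assert (F1 : f1 x = (a * (f x - g x) / RtoC x)%C) by (rewrite <- E1; field; exact Nx).
    assert (G1 : g1 x = (((RtoC x + b) * g x - RtoC x * f x) / RtoC x)%C) by (rewrite <- E2; field; exact Nx).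
    split; [|split; [exact Df|split]].
    + eapply cder_eq; [|apply cder_div; [exact Nx|apply cder_plus; [apply cder_mult; [|exact Df]|apply cder_mult; [apply cder_const|exact Dg]]|exact Did]].
      2: { apply cder_minus; [apply cder_plus; [exact Did|apply cder_const]|apply cder_const]. }
      cbv beta. field. exact Nx.
    + rewrite F1, G1. field. exact Nx.
    + rewrite F1. field. exact Nx.
  - assert (Li : ctends (Rbar_locally p_infty) (fun x => RtoC (/ x)) (RtoC 0)).
    { apply ctends_RtoC. apply (filterlim_Rbar_inv p_infty). discriminate. }
    apply ctends_ext_loc with (fun x => ((1 + (b - a) * RtoC (/ x)) * f x + a * g x * RtoC (/ x))%C).
    { exists 0. intros x Hx. rewrite RtoC_inv by lra. field. apply RtoC_neq_0. lra. }
    enough (Q : ctends (Rbar_locally p_infty) (fun x => ((1 + (b - a) * RtoC (/ x)) * f x + a * g x * RtoC (/ x))%C)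
              ((1 + (b - a) * 0) * 1 + a * 1 * 0)%C).
    { replace ((1 + (b - a) * 0) * 1 + a * 1 * 0)%C with (RtoC 1) in Q by ring. exact Q. }
    apply ctends_plus; apply ctends_mult; try assumption.
    + apply ctends_plus; [apply ctends_const|]. apply ctends_mult; [apply ctends_const|exact Li].
    + apply ctends_mult; [apply ctends_const|exact Lg].
Qed.

Lemma M_0_step (a : C) (x : R) : 1 < Re a -> 0 < x -> (RtoC x * M (a + 1) 0 0 x = a * M a 0 0 x)%C.
Proof.
  intros Ha Hx.
  assert (Ha1 : 1 < Re (a + 1)%C) by (rewrite re_plus, re_RtoC; lra).
  assert (V1 := M_0_value (a + 1) x Ha1 Hx).
  rewrite <- (Gamma_GI _ Ha1), Gamma_succ, (Gamma_GI _ Ha), <- (M_0_value a x Ha Hx), Rcpow_plus, Rcpow_1 in V1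
    by (try exact Hx; apply Re_pos_regular; lra).
  assert (N := Rcpow_neq_0 x a).
  transitivity (Rcpow x a * RtoC x * M (a + 1) 0 0 x / Rcpow x a)%C; [field; exact N|]. rewrite V1. field. exact N.
Qed.

(** The first equation is the derivative of M normalised by M at b = 0; the second also uses the
    three-term recursion, to eliminate M at a + 2. *)
Lemma confluent_system_base (a b : C) : 1 < Re a ->
  confluent_system a b (fun x => (M a b 0 x / M a 0 0 x)%C) (fun x => (M (a + 1) b 0 x / M (a + 1) 0 0 x)%C)
   (fun x => ((- M (a + 1) b 0 x * M a 0 0 x - M a b 0 x * - M (a + 1) 0 0 x) / (M a 0 0 x * M a 0 0 x))%C)
   (fun x => ((- M (a + 1 + 1) b 0 x * M (a + 1) 0 0 x - M (a + 1) b 0 x * - M (a + 1 + 1) 0 0 x)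
              / (M (a + 1) 0 0 x * M (a + 1) 0 0 x))%C).
Proof.
  intros Ha. assert (Ha1 : 1 < Re (a + 1)%C) by (rewrite re_plus, re_RtoC; lra).
  assert (Lim : forall a, 1 < Re a -> ctends (Rbar_locally p_infty) (fun x => (M a b 0 x / M a 0 0 x)%C) 1%C).
  { clear a Ha Ha1. intros a Ha. assert (N := GI_neq_0 a Ha).
    replace (RtoC 1) with (GI a / GI a)%C by (field; exact N).
    apply ctends_ext_loc with (fun x => ((Rcpow x a * M a b 0 x) / (Rcpow x a * M a 0 0 x))%C).
    - exists 0. intros x Hx. field. split; [apply M_0_neq_0; assumption|apply Rcpow_neq_0].
    - apply ctends_div; [exact N|apply M_at_infinity, Ha|apply M_at_infinity, Ha]. }
  split; [|split; apply Lim; assumption].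
  intros x Hx.
  assert (N0 := M_0_neq_0 a x Ha Hx). assert (N1 := M_0_neq_0 (a + 1) x Ha1 Hx).
  assert (Nx : RtoC x <> 0%C) by (apply RtoC_neq_0; lra).
  assert (Na : a <> 0%C) by (intros E; rewrite E, re_RtoC in Ha; lra).
  assert (S0 := M_0_step a x Ha Hx). assert (S1 := M_0_step (a + 1) x Ha1 Hx).
  assert (R1 := M_recur a b x Ha Hx).
  split; [|split; [|split]].
  - apply cder_div; [exact N0| |]; apply M_cder; assumption.
  - apply cder_div; [exact N1| |]; apply M_cder; assumption.
  - assert (V : M (a + 1) 0 0 x = (a * M a 0 0 x / RtoC x)%C) by (rewrite <- S0; field; exact Nx).
    rewrite V. field. repeat split; assumption.
  - replace (a + 2)%C with (a + 1 + 1)%C in R1 by ring.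
    assert (V : M (a + 1 + 1) 0 0 x = ((a + 1) * M (a + 1) 0 0 x / RtoC x)%C) by (rewrite <- S1; field; exact Nx).
    assert (V0 : M a 0 0 x = (RtoC x * M (a + 1) 0 0 x / a)%C) by (rewrite S0; field; exact Na).
    assert (V2 : M (a + 1 + 1) b 0 x = ((a * M a b 0 x + (a + 1 - b - RtoC x) * M (a + 1) b 0 x) / RtoC x)%C).
    { transitivity ((a * M a b 0 x + (a + 1 - b - RtoC x) * M (a + 1) b 0 x
          - (a * M a b 0 x + (a + 1 - b - RtoC x) * M (a + 1) b 0 x - RtoC x * M (a + 1 + 1) b 0 x)) / RtoC x)%C.
      - field. exact Nx.
      - rewrite R1. field. exact Nx. }
    rewrite V, V2, V0. field. repeat split; assumption.
Qed.

(** The descent in a. Convergence is carried for two consecutive parameters, as the three-term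
    relation requires. *)
Lemma Hf_converges_confluent_system (a b : C) : exists f g f1 g1, Hf_converges a b f f1 /\ Hf_converges (a + 1) b g g1 /\ confluent_system a b f g f1 g1.
Proof.
  assert (G : forall (N : nat) (a : C), 1 < Re a + INR N ->
     exists f g f1 g1, Hf_converges a b f f1 /\ Hf_converges (a + 1) b g g1 /\ confluent_system a b f g f1 g1).
  { clear a. induction N as [|N IH]; intros a HN.
    - rewrite Rplus_0_r in HN. do 4 eexists. split; [|split].
      + apply Hf_converges_base, HN.
      + apply Hf_converges_base. rewrite re_plus, re_RtoC. lra.
      + apply confluent_system_base, HN.
    - destruct (IH (a + 1)%C) as (f & g & f1 & g1 & Cf & Cg & HS).
      { rewrite re_plus, re_RtoC. rewrite S_INR in HN. lra. }
      assert (E : (a + 1 - 1)%C = a) by ring.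
      assert (C1 := Hf_converges_lower _ _ _ _ _ _ Cf Cg). assert (S1 := confluent_system_lower _ _ _ _ _ _ HS). rewrite E in C1, S1.
      do 4 eexists. split; [exact C1|split; [exact Cf|exact S1]]. }
  destruct (nfloor_ex (Rabs (Re a) + 2)) as (N & _ & HN); [generalize (Rabs_pos (Re a)); lra|].
  apply (G (S N)). rewrite S_INR. generalize (Rle_abs (- Re a)). rewrite Rabs_Ropp. lra.
Qed.

(** [f x] is [2F0(a, b;; -1/x)]. *)
Lemma confluent_exists (a b : C) : exists f f1 f2 : R -> C, Hf_converges a b f f1 /\
  ctends (Rbar_locally p_infty) f 1%C /\
  forall x, 0 < x -> cder f x (f1 x) /\ cder f1 x (f2 x) /\
    (RtoC x * RtoC x * f2 x + (1 - a - b - RtoC x) * (RtoC x * f1 x) + a * b * f x = 0)%C.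
Proof.
  destruct (Hf_converges_confluent_system a b) as (f & g & f1 & g1 & Cf & _ & HS & Lf & _).
  (* By the first equation f1 = a (f - g) / x; f2 is its derivative, and eliminating g yields the
     second-order equation. *)
  exists f, f1, (fun x => (a * (f1 x - g1 x) / RtoC x - a * (f x - g x) / (RtoC x * RtoC x))%C).
  split; [exact Cf|]. split; [exact Lf|]. intros x Hx.
  destruct (HS x Hx) as (Df & Dg & E1 & E2).
  assert (Nx : RtoC x <> 0%C) by (apply RtoC_neq_0; lra).
  split; [exact Df|]. split.
  - apply cder_ext_loc with (fun y => (a * (f y - g y) / RtoC y)%C).
    + exists (mkposreal x Hx). intros y Hy. change (Rabs (y - x) < x) in Hy. apply Rabs_def2 in Hy.
      destruct (HS y ltac:(lra)) as (_ & _ & E & _). rewrite <- E. field. apply RtoC_neq_0. lra.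
    + eapply cder_eq; [|apply cder_div; [exact Nx|apply cder_mult; [apply cder_const|apply cder_minus; [exact Df|exact Dg]]|
          apply cder_RtoC, (is_derive_id (K := R_AbsRing))]].
      cbv beta. unfold one; simpl. field. exact Nx.
  - assert (G1 : g1 x = (((RtoC x + b) * g x - RtoC x * f x) / RtoC x)%C) by (rewrite <- E2; field; exact Nx).
    assert (F1 : f1 x = (a * (f x - g x) / RtoC x)%C) by (rewrite <- E1; field; exact Nx).
    rewrite G1, F1. field. exact Nx.
Qed.

(** * The Whittaker function *)

(** [is_whittaker] differentiates into C as a real normed module. The converse reassembles f from
    its real part times 1 and its imaginary part times i. *)
Lemma is_derive_cder (f : R -> C) (x : R) (l : C) :
  @is_derive R_AbsRing C_R_NormedModule f x l <-> cder f x l.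
Proof.
  split.
  - intros H. split.
    + exact (filterdiff_comp' (U := AbsRing_NormedModule R_AbsRing) (V := C_R_NormedModule)
        (W := R_NormedModule) f (fun p => fst p) x _ (fun p => fst p) H
        (filterdiff_linear _ (is_linear_fst (U := R_NormedModule) (V := R_NormedModule)))).
    + exact (filterdiff_comp' (U := AbsRing_NormedModule R_AbsRing) (V := C_R_NormedModule)
        (W := R_NormedModule) f (fun p => snd p) x _ (fun p => snd p) H
        (filterdiff_linear _ (is_linear_snd (U := R_NormedModule) (V := R_NormedModule)))).
  - intros [H1 H2].
    assert (A := is_derive_scal_l (V := C_R_NormedModule) (fun t => Re (f t)) x _ (RtoC 1) H1).
    assert (B := is_derive_scal_l (V := C_R_NormedModule) (fun t => Im (f t)) x _ Ci H2).
    assert (E := is_derive_plus _ _ _ _ _ A B).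
    assert (V : forall c : C, plus (scal (Re c) (RtoC 1 : C_R_NormedModule)) (scal (Im c) (Ci : C_R_NormedModule)) = c).
    { intros c. rewrite !scal_R_Cmult. change ((RtoC (Re c) * 1 + RtoC (Im c) * Ci)%C = c).
      apply Ceq; simpl; unfold Re, Im; ring. }
    rewrite V in E. eapply is_derive_ext; [|exact E]. intros t. apply V.
Qed.

Lemma Re_derive_ge (f : R -> C) (df : R -> C) (X0 m x : R) : X0 <= x ->
  (forall t, X0 <= t -> cder f t (df t)) -> (forall t, X0 <= t -> m <= Re (df t)) ->
  Re (f X0) + m * (x - X0) <= Re (f x).
Proof.
  intros Hx Hd Hm. destruct Hx as [Hx| <-]; [|lra].
  destruct (MVT_gen (fun t => Re (f t)) X0 x (fun t => Re (df t))) as (c & Hc & E).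
  - intros t Ht. rewrite Rmin_left in Ht by lra. apply Hd. lra.
  - intros t Ht. rewrite Rmin_left in Ht by lra. apply continuity_pt_filterlim.
    apply (ex_derive_continuous (fun t => Re (f t))). eexists. apply Hd. lra.
  - rewrite Rmin_left, Rmax_right in Hc by lra. specialize (Hm c ltac:(lra)).
    assert (m * (x - X0) <= Re (df c) * (x - X0)) by (apply Rmult_le_compat_r; lra). lra.
Qed.

(** Gronwall: [(|D|^2 + |D'|^2) exp (K t)] is nondecreasing. *)
Lemma linear_ode_zero (D D1 q : R -> C) (x0 X0 Q : R) : x0 <= X0 ->
  (forall t, x0 <= t <= X0 -> cder D t (D1 t) /\ cder D1 t (q t * D t)%C /\ Cmod (q t) <= Q) ->
  D X0 = 0%C -> D1 X0 = 0%C -> D x0 = 0%C.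
Proof.
  intros Hx H E0 E1. destruct Hx as [Hx| ->]; [|exact E0].
  pose (S := fun t => Re (D t) ^ 2 + Im (D t) ^ 2 + Re (D1 t) ^ 2 + Im (D1 t) ^ 2).
  pose (S' := fun t => 2 * (Re (D t) * Re (D1 t) + Im (D t) * Im (D1 t)
     + Re (D1 t) * Re (q t * D t)%C + Im (D1 t) * Im (q t * D t)%C)).
  (* The derivative of S is at least - 2 (1 + Q) |D| |D1|, hence at least - (1 + Q) S. *)
  pose (K := 1 + Q).
  assert (DS : forall t, x0 <= t <= X0 ->
     is_derive (fun t => S t * exp (K * t)) t (S' t * exp (K * t) + S t * (K * exp (K * t)))).
  { intros t Ht. destruct (H t Ht) as ([A1 A2] & [B1 B2] & _).
    apply (is_derive_mult_R S (fun t => exp (K * t))).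
    - unfold S. eapply is_derive_eq.
      + apply is_derive_Reals. repeat apply derivable_pt_lim_plus; apply is_derive_Reals; apply is_derive_pow; eassumption.
      + unfold S'. simpl INR. simpl pred. ring.
    - auto_derive; [trivial|ring]. }
  assert (Pos : forall t, x0 <= t <= X0 -> 0 <= S' t * exp (K * t) + S t * (K * exp (K * t))).
  { intros t Ht. destruct (H t Ht) as (_ & _ & B).
    assert (P := exp_pos (K * t)).
    enough (0 <= S' t + K * S t) by nra.
    assert (CS : forall u v : C, - (Cmod u * Cmod v) <= Re u * Re v + Im u * Im v).
    { intros u v. assert (A := re_le_Cmod (u * Cconj v)%C). rewrite Cmod_mult, Cmod_conj in A.
      replace (Re (u * Cconj v)%C) with (Re u * Re v + Im u * Im v) in A by (simpl; unfold Re, Im; ring).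
      apply Rabs_le_between in A. lra. }
    assert (A1 := CS (D t) (D1 t)). assert (A2 := CS (D1 t) (q t * D t)%C).
    rewrite Cmod_mult in A2.
    assert (N1 := Cmod2_alt (D t)). assert (N2 := Cmod2_alt (D1 t)).
    assert (ES : S t = Cmod (D t) ^ 2 + Cmod (D1 t) ^ 2) by (unfold S; rewrite N1, N2; ring).
    unfold S', K. rewrite ES.
    set (d := Cmod (D t)) in *. set (d1 := Cmod (D1 t)) in *. set (r := Cmod (q t)) in *.
    assert (0 <= d) by apply Cmod_ge_0. assert (0 <= d1) by apply Cmod_ge_0. assert (0 <= r) by apply Cmod_ge_0.
    assert (d1 * (r * d) <= Q * (d1 * d)) by (replace (d1 * (r * d)) with (r * (d1 * d)) by ring; apply Rmult_le_compat_r; [nra|exact B]).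
    assert (2 * (d1 * d) <= d ^ 2 + d1 ^ 2) by (assert (U := pow2_ge_0 (d - d1)); simpl in U |- *; lra).
    assert (0 <= Q) by lra.
    assert (Q * (2 * (d1 * d)) <= Q * (d ^ 2 + d1 ^ 2)) by (apply Rmult_le_compat_l; assumption).
    lra. }
  destruct (MVT_gen (fun t => S t * exp (K * t)) x0 X0 (fun t => S' t * exp (K * t) + S t * (K * exp (K * t)))) as (c & Hc & E).
  - intros t Ht. rewrite Rmin_left, Rmax_right in Ht by lra. apply DS. lra.
  - intros t Ht. rewrite Rmin_left, Rmax_right in Ht by lra. apply continuity_pt_filterlim.
    apply (ex_derive_continuous (fun t => S t * exp (K * t))). eexists. apply DS. lra.
  - rewrite Rmin_left, Rmax_right in Hc by lra. specialize (Pos c Hc).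
    assert (SX : S X0 = 0) by (unfold S; rewrite E0, E1, re_RtoC, im_RtoC; ring).
    rewrite SX, Rmult_0_l in E.
    assert (P := exp_pos (K * x0)).
    assert (S0 : S x0 <= 0).
    { apply Rmult_le_reg_r with (exp (K * x0)); [exact P|].
      assert (0 <= (S' c * exp (K * c) + S c * (K * exp (K * c))) * (X0 - x0)) by (apply Rmult_le_pos; lra). lra. }
    unfold S in S0. apply Ceq; rewrite ?re_RtoC, ?im_RtoC; nra.
Qed.

(** [y1 / y0] has derivative [Wronskian / y0^2], which blows up at infinity unless the
    Wronskian vanishes. *)
Lemma is_whittaker_unique (kappa mu : C) (y w : R -> C) : Im kappa = 0 ->
  is_whittaker kappa mu y -> is_whittaker kappa mu w -> forall x, 0 < x -> y x = w x.
Proof.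
  intros Hk ((y1 & y2 & Hy) & Ly) ((w1 & w2 & Hw) & Lw).
  apply filterlim_ctends in Ly. apply filterlim_ctends in Lw.
  pose (k := Re kappa). assert (Ek : kappa = RtoC k) by (apply Ceq; [reflexivity|exact Hk]).
  pose (q := fun x => (RtoC (1 / 4) - kappa / RtoC x + (mu * mu - RtoC (1 / 4)) / RtoC (x ^ 2))%C).
  pose (D := fun x => (y x - w x)%C). pose (D1 := fun x => (y1 x - w1 x)%C).
  assert (Eq : forall x, 0 < x -> cder y x (y1 x) /\ cder y1 x (q x * y x)%C /\ cder D x (D1 x) /\ cder D1 x (q x * D x)%C).
  { intros x Hx. destruct (Hy x Hx) as (A1 & A2 & A3). destruct (Hw x Hx) as (B1 & B2 & B3).
    apply is_derive_cder in A1, A2, B1, B2. apply Ceq_minus in A3, B3. fold (q x) in A3, B3.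
    rewrite A3 in A2. rewrite B3 in B2.
    split; [exact A1|]. split; [exact A2|]. split; [exact (cder_minus _ _ _ _ _ A1 B1)|].
    eapply cder_eq; [|exact (cder_minus _ _ _ _ _ A2 B2)]. unfold D. ring. }
  pose (n := fun x => (Rcpow x kappa * RtoC (exp (- x / 2)))%C).
  assert (Nn : forall x, n x <> 0%C).
  { intros x. apply Cmult_neq_0; [apply Rcpow_neq_0|]. apply RtoC_neq_0, Rgt_not_eq, exp_pos. }
  (* Here kappa real matters: the square of the normalising factor is a positive real, so real parts
     can be compared. *)
  assert (n2 : forall x, (n x * n x)%C = RtoC (exp (2 * k * ln x - x))).
  { intros x. unfold n. rewrite Ek, Rcpow_RtoC. rewrite <- !RtoC_mult. f_equal. unfold Rpower.
    rewrite <- !exp_plus. f_equal. field. }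
  assert (LR : ctends (Rbar_locally p_infty) (fun x => (D x / y x)%C) 0%C).
  { assert (Q := ctends_div _ _ _ _ C1_nz (ctends_minus _ _ _ _ Ly Lw) Ly).
    replace ((1 - 1) / 1)%C with (RtoC 0) in Q by field.
    apply ctends_ext_loc with (2 := Q).
    generalize (ctends_ne0 _ _ C1_nz Ly). apply filter_imp. intros x Hx. cbv beta.
    fold (n x) in Hx |- *. assert (N := Nn x). unfold D.
    assert (Ny : y x <> 0%C) by (intros E; apply Hx; rewrite E; field; exact N).
    field. split; assumption. }
  assert (LI : ctends (Rbar_locally p_infty) (fun x => (n x * n x / (y x * y x))%C) 1%C).
  { assert (Q := ctends_inv _ _ (Cmult_neq_0 _ _ C1_nz C1_nz) (ctends_mult _ _ _ _ Ly Ly)).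
    replace (/ (1 * 1))%C with (RtoC 1) in Q by field.
    apply ctends_ext_loc with (2 := Q).
    generalize (ctends_ne0 _ _ C1_nz Ly). apply filter_imp. intros x Hx. cbv beta.
    fold (n x) in Hx |- *. assert (N := Nn x).
    assert (Ny : y x <> 0%C) by (intros E; apply Hx; rewrite E; field; exact N).
    field. split; assumption. }
  (* Eventually n^2 <= 1. Together with n^2 / y^2 close to 1 this gives Re (1 / y^2) >= 1/2. *)
  assert (LE : exists X1, 0 < X1 /\ forall x, X1 <= x -> 2 * k * ln x - x <= 0).
  { destruct (power_le_exp (2 * Rabs k) (1/2)) as (K & HK & HG); [generalize (Rabs_pos k); lra|lra|].
    destruct (exp_decay_small K (1/2) 1 ltac:(lra) Rlt_0_1) as (A0 & HA0 & HA).
    exists (Rmax 1 A0). split; [eapply Rlt_le_trans; [apply Rlt_0_1|apply Rmax_l]|].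
    intros x Hx. assert (x1 : 1 <= x) by (eapply Rle_trans; [apply Rmax_l|exact Hx]).
    assert (x2 : A0 <= x) by (eapply Rle_trans; [apply Rmax_r|exact Hx]).
    specialize (HA x x2). specialize (HG x ltac:(lra)).
    assert (L0 := ln_nonneg x x1). assert (L1 : ln x <= ln (1 + x)) by (apply ln_le; lra).
    assert (k * ln x <= Rabs k * ln (1 + x)).
    { apply Rle_trans with (Rabs k * ln x); [apply Rmult_le_compat_r; [exact L0|apply Rle_abs]|].
      apply Rmult_le_compat_l; [apply Rabs_pos|exact L1]. }
    assert (U : exp (2 * Rabs k * ln (1 + x) - x) <= exp 0).
    { rewrite exp_0. unfold Rminus. rewrite exp_plus.
      apply Rle_trans with (K * exp (1 / 2 * x) * exp (- x)).
      - apply Rmult_le_compat_r; [left; apply exp_pos|exact HG].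
      - rewrite Rmult_assoc, <- exp_plus. replace (1 / 2 * x + - x) with (- (1 / 2) * x) by lra. lra. }
    destruct (Rle_lt_dec (2 * Rabs k * ln (1 + x) - x) 0) as [V|V]; [lra|].
    apply exp_increasing in V. lra. }
  destruct LE as (X1 & HX1 & LE).
  destruct (LI (1/2) ltac:(lra)) as (X2 & HX2).
  destruct (ctends_ne0 _ _ C1_nz Ly) as (X3 & HX3).
  pose (X0 := Rmax X1 (Rmax (X2 + 1) (X3 + 1))).
  assert (b1 : X1 <= X0) by apply Rmax_l.
  assert (b2 : X2 + 1 <= X0) by (eapply Rle_trans; [apply Rmax_l|apply Rmax_r]).
  assert (b3 : X3 + 1 <= X0) by (eapply Rle_trans; [apply Rmax_r|apply Rmax_r]).
  assert (Ny : forall x, X0 <= x -> y x <> 0%C).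
  { intros x Hx E. apply (HX3 x ltac:(lra)). rewrite E. fold (n x). assert (N := Nn x). field. exact N. }
  pose (W := (D1 X0 * y X0 - D X0 * y1 X0)%C).
  assert (HW : forall x, X0 <= x -> (D1 x * y x - D x * y1 x)%C = W).
  { intros x Hx. apply (cder_0_const (fun x => (D1 x * y x - D x * y1 x)%C) X0 x Hx).
    intros t Ht. destruct (Eq t ltac:(lra)) as (A & B & A' & B').
    eapply cder_eq; [|exact (cder_minus _ _ _ _ _ (cder_mult _ _ _ _ _ B' A) (cder_mult _ _ _ _ _ A' B))].
    cbv beta. ring. }
  assert (DR : forall x, X0 <= x -> cder (fun x => (D x / y x)%C) x (W / (y x * y x))%C).
  { intros x Hx. destruct (Eq x ltac:(lra)) as (A & B & A' & B').
    eapply cder_eq; [|exact (cder_div _ _ _ _ _ (Ny x Hx) A' A)]. rewrite <- (HW x Hx). reflexivity. }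
  assert (W0 : W = 0%C).
  (* Dividing by W leaves the derivative 1 / y^2, whose real part is at least 1/2; linear growth
     contradicts the limit 0 of D / y. *)
  { apply NNPP. intros NW.
    assert (G : forall x, X0 <= x -> Re (D X0 / y X0 * / W)%C + 1/2 * (x - X0) <= Re (D x / y x * / W)%C).
    { intros x Hx. apply (Re_derive_ge (fun x => (D x / y x * / W)%C) (fun x => (/ (y x * y x))%C) X0 (1/2) x Hx).
      - intros t Ht. eapply cder_eq; [|exact (cder_mult _ _ _ _ _ (DR t Ht) (cder_const (/ W)%C t))].
        assert (N := Ny t Ht). cbv beta. field. repeat split; assumption.
      - intros t Ht. specialize (HX2 t ltac:(lra)). cbv beta in HX2. rewrite n2 in HX2.
        assert (N := Ny t Ht). specialize (LE t ltac:(lra)).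
        set (E := exp (2 * k * ln t - t)) in *.
        assert (HE : 0 < E <= 1).
        { split; [apply exp_pos|]. rewrite <- exp_0. apply exp_le_compat. exact LE. }
        assert (Hr : Re (RtoC E / (y t * y t))%C = E * Re (/ (y t * y t))%C) by (unfold Cdiv; apply re_scal_l).
        assert (Hc := re_le_Cmod (RtoC E / (y t * y t) - 1)%C). rewrite Re_minus, re_RtoC, Hr in Hc.
        assert (Hd : Rabs (E * Re (/ (y t * y t))%C - 1) < 1/2) by lra.
        apply Rabs_def2 in Hd. set (r := Re (/ (y t * y t))%C) in *.
        destruct (Rle_lt_dec (1/2) r) as [V|V]; [exact V|]. nra. }
    assert (LR' := ctends_mult _ _ _ _ LR (ctends_const (/ W)%C)).
    rewrite Cmult_0_l in LR'. destruct (LR' 1 Rlt_0_1) as (X4 & HX4).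
    pose (B := Rabs (Re (D X0 / y X0 * / W)%C)).
    pose (x := Rmax X0 (Rmax (X4 + 1) (X0 + 2 * (B + 2)))).
    assert (c1 : X0 <= x) by apply Rmax_l.
    assert (c2 : X4 + 1 <= x) by (eapply Rle_trans; [apply Rmax_l|apply Rmax_r]).
    assert (c3 : X0 + 2 * (B + 2) <= x) by (eapply Rle_trans; [apply Rmax_r|apply Rmax_r]).
    specialize (G x c1). specialize (HX4 x ltac:(lra)). cbv beta in HX4.
    replace (D x / y x * / W - 0)%C with (D x / y x * / W)%C in HX4 by ring.
    assert (U := re_le_Cmod (D x / y x * / W)%C). assert (U2 := Rle_abs (Re (D x / y x * / W)%C)).
    assert (U3 : - B <= Re (D X0 / y X0 * / W)%C).
    { unfold B. generalize (Rle_abs (- Re (D X0 / y X0 * / W)%C)). rewrite Rabs_Ropp. lra. }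
    lra. }
  assert (D0 : forall x, X0 <= x -> D x = 0%C).
  { intros x Hx.
    assert (Rc : forall t, x <= t -> (D t / y t)%C = (D x / y x)%C).
    { intros t Ht. apply (cder_0_const (fun x => (D x / y x)%C) x t Ht). intros s Hs.
      eapply cder_eq; [|exact (DR s ltac:(lra))]. rewrite W0. unfold Cdiv. ring. }
    assert (R0 : (D x / y x)%C = 0%C).
    { apply (ctends_unique (F := Rbar_locally p_infty) (fun t => (D t / y t)%C)); [|exact LR].
      apply ctends_ext_loc with (fun _ => (D x / y x)%C); [|apply ctends_const].
      exists x. intros t Ht. symmetry. apply Rc. lra. }
    assert (N := Ny x Hx). transitivity (D x / y x * y x)%C; [field; exact N|]. rewrite R0. ring. }
  intros x Hx. apply Ceq_minus. change (D x = 0%C).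
  destruct (Rle_lt_dec X0 x) as [V|V]; [apply D0, V|].
  (* The point X0 + 1 has a two-sided neighbourhood on which D vanishes, which X0 itself need not
     have. *)
  assert (HD1 : D1 (X0 + 1) = 0%C).
  { apply (cder_unique D (X0 + 1)); [apply Eq; lra|].
    apply cder_ext_loc with (fun _ => RtoC 0); [|apply cder_const].
    exists (mkposreal 1 Rlt_0_1). intros t Ht. change (Rabs (t - (X0 + 1)) < 1) in Ht.
    apply Rabs_def2 in Ht. symmetry. apply D0. lra. }
  apply (linear_ode_zero D D1 q x (X0 + 1) (1 / 4 + Cmod kappa / x + Cmod (mu * mu - RtoC (1 / 4))%C / x ^ 2)); try assumption; try lra.
  - intros t Ht. destruct (Eq t ltac:(lra)) as (_ & _ & A & B). split; [exact A|]. split; [exact B|].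
    unfold q. assert (t2 : 0 < t ^ 2) by nra. assert (x2 : 0 < x ^ 2) by nra.
    eapply Rle_trans; [apply Cmod_triangle|].
    eapply Rle_trans; [apply Rplus_le_compat_r, Cmod_triangle|].
    rewrite Cmod_opp, !Cmod_div, !Cmod_R by (apply RtoC_neq_0; lra).
    rewrite (Rabs_pos_eq (1/4)), (Rabs_pos_eq t), (Rabs_pos_eq (t ^ 2)) by lra.
    apply Rplus_le_compat; [apply Rplus_le_compat_l|]; (apply Rmult_le_compat_l; [apply Cmod_ge_0|]); apply Rinv_le_contravar; nra.
  - apply D0. lra.
Qed.

(** Conjugation by x^kappa exp (- x / 2) turns the equation of f into Whittaker's. The condition on
    mu says mu = (a - b) / 2 or its negative; the equation contains mu through its square, so one (z
    - z') / 2 serves both signs. *)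
Lemma whittakerW_value (a b kappa mu : C) (f f1 f2 : R -> C) : Im kappa = 0 ->
  (2 * kappa = 1 - a - b)%C -> (4 * (mu * mu) = (2 * kappa - 1) * (2 * kappa - 1) - 4 * (a * b))%C ->
  ctends (Rbar_locally p_infty) f 1%C ->
  (forall x, 0 < x -> cder f x (f1 x) /\ cder f1 x (f2 x) /\
    (RtoC x * RtoC x * f2 x + (1 - a - b - RtoC x) * (RtoC x * f1 x) + a * b * f x = 0)%C) ->
  forall x, 0 < x -> whittakerW kappa mu x = (Rcpow x kappa * RtoC (exp (- x / 2)) * f x)%C.
Proof.
  intros Hk Hab Hmu Lf Hf.
  pose (n := fun x => (Rcpow x kappa * RtoC (exp (- x / 2)))%C).
  pose (m := fun x => (kappa / RtoC x - RtoC (1 / 2))%C).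
  assert (Nn : forall x, n x <> 0%C).
  { intros x. apply Cmult_neq_0; [apply Rcpow_neq_0|]. apply RtoC_neq_0, Rgt_not_eq, exp_pos. }
  assert (Dn : forall x, 0 < x -> cder n x (m x * n x)%C).
  { intros x Hx.
    assert (De : is_derive (fun x => exp (- x / 2)) x (- (1 / 2) * exp (- x / 2))) by (auto_derive; [trivial|unfold Rdiv; ring]).
    eapply cder_eq; [|exact (cder_mult _ _ _ _ _ (cder_Rcpow kappa x Hx) (cder_RtoC _ _ _ De))].
    unfold m, n. cbv beta. rewrite RtoC_mult, RtoC_opp. ring. }
  assert (Dm : forall x, 0 < x -> cder m x (- kappa / (RtoC x * RtoC x))%C).
  { intros x Hx. assert (Nx : RtoC x <> 0%C) by (apply RtoC_neq_0; lra).
    eapply cder_eq; [|apply cder_minus; [apply cder_div; [exact Nx|apply cder_const|apply cder_RtoC, (is_derive_id (K := R_AbsRing))]|apply cder_const]].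
    cbv beta. unfold one; simpl. field. exact Nx. }
  assert (IW : is_whittaker kappa mu (fun x => (n x * f x)%C)).
  { split.
    - exists (fun x => (m x * n x * f x + n x * f1 x)%C),
        (fun x => (((- kappa / (RtoC x * RtoC x)) * n x + m x * (m x * n x)) * f x + m x * n x * f1 x
              + (m x * n x * f1 x + n x * f2 x))%C).
      intros x Hx. destruct (Hf x Hx) as (A & B & E).
      assert (Nx : RtoC x <> 0%C) by (apply RtoC_neq_0; lra).
      split; [|split].
      + apply is_derive_cder. exact (cder_mult _ _ _ _ _ (Dn x Hx) A).
      + apply is_derive_cder.
        exact (cder_plus _ _ _ _ _ (cder_mult _ _ _ _ _ (cder_mult _ _ _ _ _ (Dm x Hx) (Dn x Hx)) A)
                 (cder_mult _ _ _ _ _ (Dn x Hx) B)).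
      + assert (F2 : f2 x = (- ((1 - a - b - RtoC x) * (RtoC x * f1 x) + a * b * f x) / (RtoC x * RtoC x))%C).
        { transitivity ((RtoC x * RtoC x * f2 x + (1 - a - b - RtoC x) * (RtoC x * f1 x) + a * b * f x
             - ((1 - a - b - RtoC x) * (RtoC x * f1 x) + a * b * f x)) / (RtoC x * RtoC x))%C.
          - field. exact Nx.
          - rewrite E. field. exact Nx. }
        rewrite F2, <- Hab.
        assert (EM : (mu * mu = ((2 * kappa - 1) * (2 * kappa - 1) - 4 * (a * b)) / 4)%C) by (rewrite <- Hmu; field).
        rewrite EM. unfold m. rewrite RtoC_pow. rewrite !RtoC_div by lra. simpl Cpow. field. exact Nx.
    - apply ctends_filterlim. apply ctends_ext with (2 := Lf). intros x.
      fold (n x). assert (N := Nn x). field. exact N. }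
  intros x Hx. change (whittakerW kappa mu x = n x * f x)%C.
  refine (is_whittaker_unique kappa mu (whittakerW kappa mu) (fun x => (n x * f x)%C) Hk _ IW x Hx).
  unfold whittakerW. apply epsilon_spec. exists (fun x => (n x * f x)%C). exact IW.
Qed.

(** * The parameters and the weight psi *)

Lemma poch_factor_neq_0 (a : C) (n k : nat) : (k < n)%nat -> poch a n <> 0%C -> (a + RtoC (INR k))%C <> 0%C.
Proof.
  intros Hk Hn E. apply Hn. clear Hn. induction n as [|n IH]; [lia|].
  simpl. destruct (Nat.eq_dec k n) as [->|Nk].
  - rewrite E. ring.
  - rewrite IH by lia. ring.
Qed.

Lemma real_positive_RtoC (a : C) : real_positive a -> a = RtoC (Re a) /\ 0 < Re a.
Proof. intros [H1 H2]. split; [apply Ceq; [reflexivity|exact H1]|exact H2]. Qed.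

(** The standing assumption for one sign, (p, p') being (z, z') or (-z, -z'). The Pochhammer symbols
    start at 1 + p because these are the ones occurring in psi. *)
Record positive_pair (p p' : C) (t s : R) : Prop := {
  gp_t : 0 < t;
  gp_prod : (p * p' = RtoC t)%C;
  gp_sum : (p + p' = RtoC s)%C;
  gp_pos : forall k, exists r, 0 < r /\ (poch (1 + p) k * poch (1 + p') k = RtoC r)%C
}.

(** k = 1 makes t = z z' real and positive; k = 2 makes t (t + z + z' + 1) real, hence z + z' real.
    Dividing (z)_(k + 1) (z')_(k + 1) by t gives positivity for the shifted symbols. *)
Lemma admissible_pair (z z' : C) :
  (forall k : nat, (1 <= k)%nat -> real_positive (poch z k * poch z' k)%C) ->
  exists t s, positive_pair z z' t s.
Proof.
  intros H.
  destruct (real_positive_RtoC _ (H 1%nat ltac:(lia))) as [E1 P1].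
  destruct (real_positive_RtoC _ (H 2%nat ltac:(lia))) as [E2 P2].
  pose (t := Re (poch z 1 * poch z' 1)%C). fold t in E1, P1.
  pose (t2 := Re (poch z 2 * poch z' 2)%C). fold t2 in E2, P2.
  assert (Ez : (z * z' = RtoC t)%C).
  { rewrite <- E1. simpl. ring. }
  assert (tn : RtoC t <> 0%C) by (apply RtoC_neq_0; lra).
  assert (Es : (z + z' = RtoC (t2 / t - t - 1))%C).
  { rewrite !RtoC_minus, RtoC_div by lra.
    replace (RtoC t2) with (RtoC t * (RtoC t + (z + z') + 1))%C; [field; exact tn|].
    rewrite <- E2. rewrite <- Ez. simpl. ring. }
  exists t, (t2 / t - t - 1). split; [exact P1|exact Ez|exact Es|].
  intros k. destruct (real_positive_RtoC _ (H (S k) ltac:(lia))) as [E P].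
  exists (Re (poch z (S k) * poch z' (S k))%C / t). split; [apply Rdiv_lt_0_compat; assumption|].
  rewrite RtoC_div, <- E by lra. rewrite !poch_shift, <- Ez.
  replace (1 + z)%C with (z + 1)%C by ring. replace (1 + z')%C with (z' + 1)%C by ring.
  rewrite <- Ez in tn. field.
  split; intros Z; apply tn; rewrite Z; ring.
Qed.

Section GoodPair.
Variables (p p' : C) (t s : R).
Hypothesis gp : positive_pair p p' t s.

Lemma gp_regular : regular (1 + p)%C /\ regular (1 + p')%C.
Proof.
  split; intros k; destruct (gp_pos _ _ _ _ gp (S k)) as (r & Hr & E);
  (apply (poch_factor_neq_0 _ (S k)); [lia|]); intros Z; rewrite Z in E;
  [rewrite Cmult_0_l in E|rewrite Cmult_0_r in E]; apply RtoC_inj in E; lra.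
Qed.

(** The product of the two Euler sequences is positive at each n, since n is raised to the real
    power 2 + p + p'. The limit is therefore real and nonnegative, and nonvanishing of [Gamma] makes
    it positive. *)
Lemma gp_gamma : exists g, 0 < g /\ (Gamma (1 + p) * Gamma (1 + p') = RtoC g)%C.
Proof.
  destruct gp_regular as [R1 R2].
  destruct (Gamma_spec _ R1) as [N1 L1]. destruct (Gamma_spec _ R2) as [N2 L2].
  assert (LP := ctends_mult _ _ _ _ L1 L2).
  assert (Epos : forall n, exists r, 0 < r /\ (euler (1 + p) n * euler (1 + p') n = RtoC r)%C).
  { intros n. destruct (gp_pos _ _ _ _ gp (S n)) as (r & Hr & E).
    exists (INR (fact n) * INR (fact n) * Rpower (INR n) (2 + s) / r). split.
    - apply Rdiv_lt_0_compat; [|exact Hr]. assert (F := INR_fact_lt_0 n).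
      apply Rmult_lt_0_compat; [nra|apply exp_pos].
    - rewrite RtoC_div, !RtoC_mult, <- E, <- Rcpow_RtoC by lra.
      assert (P1 : poch (1 + p)%C (S n) <> 0%C) by (apply poch_neq_0, R1).
      assert (P2 : poch (1 + p')%C (S n) <> 0%C) by (apply poch_neq_0, R2).
      replace (RtoC (2 + s)) with ((1 + p) + (1 + p'))%C.
      + rewrite Rcpow_plus. unfold euler. field. split; assumption.
      + rewrite RtoC_plus, <- (gp_sum _ _ _ _ gp). ring. }
  assert (I0 : Im (Gamma (1 + p) * Gamma (1 + p'))%C = 0).
  { assert (Q := ctends_im _ _ LP).
    refine (filterlim_locally_unique (F := eventually) _ _ _ Q _).
    apply filterlim_ext with (fun _ => 0); [|apply filterlim_const].
    intros n. destruct (Epos n) as (r & _ & E). rewrite E, im_RtoC. reflexivity. }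
  assert (R0 : 0 <= Re (Gamma (1 + p) * Gamma (1 + p'))%C).
  { assert (Q := ctends_re _ _ LP).
    refine (is_lim_seq_le (fun _ => 0) _ (Finite 0) (Finite _) _ (is_lim_seq_const 0) Q).
    intros n. destruct (Epos n) as (r & Hr & E). rewrite E, re_RtoC. lra. }
  assert (E : (Gamma (1 + p) * Gamma (1 + p'))%C = RtoC (Re (Gamma (1 + p) * Gamma (1 + p'))%C)).
  { apply Ceq; [reflexivity|exact I0]. }
  exists (Re (Gamma (1 + p) * Gamma (1 + p'))%C). split; [|exact E].
  destruct R0 as [R0|R0]; [exact R0|]. exfalso. rewrite <- R0 in E. revert E. apply Cmult_neq_0; assumption.
Qed.
End GoodPair.

(** The reciprocal of Euler's sequence at 1 + a; the leftover factor 1 + (1 + a) / k tends to 1. *)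
Lemma poch_fact_asymp (a : C) : regular (1 + a)%C ->
  ctends eventually (fun k => (poch (1 + a) k / RtoC (INR (fact k)) / Rcpow (INR k) a)%C) (/ Gamma (1 + a))%C.
Proof.
  intros Ha. destruct (Gamma_spec _ Ha) as [N L].
  assert (Li := ctends_RtoC _ _ filterlim_inv_INR).
  assert (Q : ctends eventually (fun k => (/ euler (1 + a) k * / (1 + (1 + a) * RtoC (/ INR k)))%C)
                (/ Gamma (1 + a) * / (1 + (1 + a) * 0))%C).
  { apply ctends_mult; [apply ctends_inv; assumption|]. apply ctends_inv.
    - rewrite Cmult_0_r, Cplus_0_r. apply C1_nz.
    - apply ctends_plus; [apply ctends_const|]. apply ctends_mult; [apply ctends_const|exact Li]. }
  replace (/ Gamma (1 + a) * / (1 + (1 + a) * 0))%C with (/ Gamma (1 + a))%C in Q.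
  2: { rewrite Cmult_0_r, Cplus_0_r. field. exact N. }
  apply ctends_ext_loc with (2 := Q). exists 1%nat. intros k Hk.
  assert (Hk0 : 0 < INR k) by (apply lt_0_INR; lia).
  assert (HkC : RtoC (INR k) <> 0%C) by (apply RtoC_neq_0; lra).
  assert (P1 : poch (1 + a)%C k <> 0%C) by (apply poch_neq_0, Ha).
  assert (P2 : (1 + a + RtoC (INR k))%C <> 0%C) by apply Ha.
  assert (FN : RtoC (INR (fact k)) <> 0%C) by apply RtoC_neq_0, INR_fact_neq_0.
  assert (RN := Rcpow_neq_0 (INR k) a).
  unfold euler. rewrite Rcpow_plus, Rcpow_1 by exact Hk0.
  change (poch (1 + a)%C (S k)) with (poch (1 + a) k * (1 + a + RtoC (INR k)))%C.
  rewrite RtoC_inv by lra. field. repeat split; try assumption.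
  replace (INR k + (1 + a))%C with (1 + a + INR k)%C by ring. exact P2.
Qed.

Lemma cder_poch (x : R) (N : nat) : exists l, cder (fun y => poch (RtoC (y + 1)) N) x l.
Proof.
  induction N as [|N (l & H)].
  - exists (RtoC 0). exact (cder_const (RtoC 1) x).
  - assert (D : cder (fun y => (RtoC (y + 1) + RtoC (INR N))%C) x (RtoC 1 + 0)%C).
    { apply cder_plus; [|apply cder_const]. apply cder_RtoC. auto_derive; [trivial|ring]. }
    eexists. exact (cder_mult _ _ _ _ _ H D).
Qed.

(** Choosing b = N + 1 - p makes (1 + p + y) + b an integer shift of y + 1. The quotient then equals
    (y + 1)_(N + 1) B(b, 1 + p + y) / Gamma(b), a polynomial times a beta integral; N is large
    enough for Re b > 1. *)
Lemma Gamma_ratio_cder (p : C) (x : R) : -1 < x -> 0 < 1 + Re p + x ->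
  exists l, cder (fun y => (Gamma (RtoC (y + 1) + p) / Gamma (RtoC (y + 1)))%C) x l.
Proof.
  intros Hx Hp.
  destruct (nfloor_ex (Rabs (Re p) + 2)) as (N & _ & HN); [generalize (Rabs_pos (Re p)); lra|].
  pose (b := (RtoC (INR (S N)) - p)%C).
  assert (Hb : 1 < Re b).
  { unfold b. rewrite Re_minus, re_RtoC, S_INR. generalize (Rle_abs (Re p)). lra. }
  destruct (cder_poch x (S N)) as (l1 & D1).
  destruct (beta_cder b (1 + p)%C x Hb) as (l2 & D2); [rewrite re_plus, re_RtoC; lra|].
  eexists.
  apply cder_ext_loc with (fun y => (poch (RtoC (y + 1)) (S N) * beta b 1 (1 + p + RtoC y + b) * / Gamma b)%C).
  2: { exact (cder_mult _ _ _ _ _ (cder_mult _ _ _ _ _ D1 D2) (cder_const (/ Gamma b)%C x)). }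
  assert (Hd : 0 < Rmin (x + 1) (1 + Re p + x)) by (apply Rmin_pos; lra).
  exists (mkposreal _ Hd). intros y Hy. change (Rabs (y - x) < Rmin (x + 1) (1 + Re p + x)) in Hy.
  assert (y1 : Rabs (y - x) < x + 1) by (eapply Rlt_le_trans; [exact Hy|apply Rmin_l]).
  assert (y2 : Rabs (y - x) < 1 + Re p + x) by (eapply Rlt_le_trans; [exact Hy|apply Rmin_r]).
  apply Rabs_def2 in y1. apply Rabs_def2 in y2.
  assert (G := Gamma_beta b (1 + p + RtoC y)%C Hb).
  rewrite !re_plus, !re_RtoC in G. specialize (G ltac:(lra)).
  assert (R1 : regular (RtoC (y + 1))) by (apply Re_pos_regular; rewrite re_RtoC; lra).
  destruct (Gamma_spec _ R1) as [N1 _].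
  destruct (Gamma_spec b (Re_pos_regular b ltac:(lra))) as [N2 _].
  replace (Gamma (1 + p + RtoC y + b)%C) with (poch (RtoC (y + 1)) (S N) * Gamma (RtoC (y + 1)))%C in G.
  2: { rewrite <- Gamma_poch by exact R1. f_equal. unfold b. rewrite RtoC_plus. ring. }
  replace (RtoC (y + 1) + p)%C with (1 + p + RtoC y)%C by (rewrite RtoC_plus; ring).
  transitivity (beta b 1 (1 + p + RtoC y + b) * (poch (RtoC (y + 1)) (S N) * Gamma (RtoC (y + 1)))
     / (Gamma b * Gamma (RtoC (y + 1))))%C.
  - field. split; assumption.
  - rewrite G. field. split; assumption.
Qed.

(** * The integer part k of u / e and the elementary limits along it *)

Lemma nat_part_bounds (r : R) : 0 <= r -> INR (nat_part r) <= r < INR (nat_part r) + 1.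
Proof.
  intros Hr. unfold nat_part. destruct (base_Int_part r) as [H1 H2].
  assert (Hz : (0 <= Int_part r)%Z).
  { apply Z.lt_succ_r. unfold Z.succ. apply lt_IZR. rewrite plus_IZR. lra. }
  rewrite INR_IZR_INZ, Z2Nat.id by exact Hz. lra.
Qed.

Definition scaled_index (u e : R) : nat := nat_part (u / e).

Lemma at_right_pos (d : R) : 0 < d -> at_right 0 (fun e => 0 < e < d).
Proof.
  intros Hd. exists (mkposreal d Hd). intros e He He0. change (Rabs (e - 0) < d) in He.
  rewrite Rminus_0_r in He. apply Rabs_def2 in He. lra.
Qed.

Lemma scaled_index_bounds (u e : R) : 0 < u -> 0 < e -> e * INR (scaled_index u e) <= u < e * INR (scaled_index u e) + e.
Proof.
  intros Hu He. destruct (nat_part_bounds (u / e)) as [H1 H2]; [apply Rdiv_le_0_compat; lra|].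
  unfold scaled_index. apply Rle_div_r in H1; [|exact He]. apply Rlt_div_l in H2; [|exact He]. lra.
Qed.

(** The offset c covers the exponent k + 1/2 in psi, the third parameters k + 1 and k + 2 of F, and
    the denominators of the kernel. *)
Lemma scaled_index_lim (u c : R) : 0 < u -> filterlim (fun e => e * (INR (scaled_index u e) + c)) (at_right 0) (locally u).
Proof.
  intros Hu. apply filterlim_locally. intros eps.
  assert (Hd : 0 < eps / (Rabs c + 2)).
  { apply Rdiv_lt_0_compat; [apply cond_pos|]. generalize (Rabs_pos c). lra. }
  generalize (at_right_pos _ Hd). apply filter_imp. intros e [He He2].
  assert (c0 := Rabs_pos c). apply Rlt_div_r in He2; [|lra].
  assert (B := scaled_index_bounds u e Hu He). change (Rabs (e * (INR (scaled_index u e) + c) - u) < eps).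
  replace (e * (INR (scaled_index u e) + c) - u) with ((e * INR (scaled_index u e) - u) + e * c) by ring.
  eapply Rle_lt_trans; [apply Rabs_triang|]. rewrite Rabs_mult, (Rabs_pos_eq e) by lra.
  assert (Rabs (e * INR (scaled_index u e) - u) <= e) by (apply Rabs_le; lra). lra.
Qed.

Lemma scaled_index_infty (u : R) : 0 < u -> filterlim (scaled_index u) (at_right 0) eventually.
Proof.
  intros Hu P [N HN]. change (at_right 0 (fun e => P (scaled_index u e))).
  assert (Hd : 0 < u / (INR N + 1)) by (apply Rdiv_lt_0_compat; generalize (pos_INR N); lra).
  generalize (at_right_pos _ Hd). apply filter_imp. intros e [He He2]. apply HN.
  assert (N0 := pos_INR N). apply Rlt_div_r in He2; [|lra].
  assert (B := scaled_index_bounds u e Hu He).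
  apply INR_le. apply Rlt_le. assert (e * INR N < e * INR (scaled_index u e)) by lra.
  apply Rmult_lt_reg_l with e; assumption.
Qed.

Lemma ln_quotient_lim : filterlim (fun e => ln (1 - e) / e) (at_right 0) (locally (-1)).
Proof.
  assert (D : is_derive (fun h => ln (1 - h)) 0 (-1)).
  { auto_derive; [lra|]. field. }
  apply is_derive_Reals in D. apply filterlim_locally. intros eps.
  destruct (D eps (cond_pos eps)) as (d & Hd).
  generalize (at_right_pos d (cond_pos d)). apply filter_imp. intros e [He He2].
  specialize (Hd e ltac:(lra) ltac:(rewrite Rabs_pos_eq; lra)).
  rewrite Rplus_0_l, Rminus_0_r, ln_1, Rminus_0_r in Hd. exact Hd.
Qed.

Lemma filterlim_Rmult_fin {I : Type} {F : (I -> Prop) -> Prop} {FF : Filter F} (f g : I -> R) (l m : R) :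
  filterlim f F (locally l) -> filterlim g F (locally m) ->
  filterlim (fun i => f i * g i) F (locally (l * m)).
Proof.
  intros Hf Hg. apply (filterlim_comp_2 f g Rmult Hf Hg).
  apply (filterlim_Rbar_mult (Finite l) (Finite m) (Finite (l * m))). reflexivity.
Qed.

Lemma Rpower_lim (u : R) : 0 < u ->
  filterlim (fun e => Rpower (1 - e) (INR (scaled_index u e) + 1 / 2)) (at_right 0) (locally (exp (- u))).
Proof.
  intros Hu.
  assert (H := filterlim_Rmult_fin _ _ _ _ (scaled_index_lim u (1/2) Hu) ln_quotient_lim).
  replace (u * -1) with (- u) in H by ring.
  assert (H2 := filterlim_comp _ _ _ _ exp _ _ _ H (continuous_exp (- u))).
  apply filterlim_ext_loc with (2 := H2).
  generalize (at_right_pos 1 Rlt_0_1). apply filter_imp. intros e He. unfold Rpower. f_equal. field. lra.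
Qed.

Lemma Gamma_fact (n : nat) : Gamma (RtoC (INR n + 1)) = RtoC (INR (fact n)).
Proof.
  replace (RtoC (INR n + 1)) with (1 + RtoC (INR n))%C by (rewrite RtoC_plus; ring).
  rewrite Gamma_poch, poch_1, Gamma_1, Cmult_1_r; [reflexivity|].
  apply Re_pos_regular. rewrite re_RtoC. lra.
Qed.

(** The common factor [sqrt psi] drops out of the Wronskian, so only its limit, not that
    of its derivative, is needed on the diagonal. *)
Lemma CDerive_common_factor (S : R -> R) (f g : R -> C) (x S1 : R) (f1 g1 : C) :
  is_derive S x S1 -> cder f x f1 -> cder g x g1 ->
  (CDerive (fun y => RtoC (S y) * f y) x * (RtoC (S x) * g x)
   - CDerive (fun y => RtoC (S y) * g y) x * (RtoC (S x) * f x)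
   = RtoC (S x) * RtoC (S x) * (f1 * g x - g1 * f x))%C.
Proof.
  intros HS Hf Hg.
  rewrite (cder_CDerive _ _ _ (cder_mult _ _ _ _ _ (cder_RtoC _ _ _ HS) Hf)).
  rewrite (cder_CDerive _ _ _ (cder_mult _ _ _ _ _ (cder_RtoC _ _ _ HS) Hg)). ring.
Qed.

(** * Limits of the kernel entries *)

Section OneSign.
Variables (z z' : C) (sg : pm) (t s g : R).
Let p := signed sg z.
Let p' := signed sg z'.
Hypothesis gp : positive_pair p p' t s.
Hypothesis Ht : tpar z z' = t.
Hypothesis Hg : 0 < g.
Hypothesis HG : (Gamma (1 + p) * Gamma (1 + p') = RtoC g)%C.

Lemma signed_sum : signed sg (z + z')%C = RtoC s.
Proof. rewrite <- (gp_sum _ _ _ _ gp). unfold p, p'. destruct sg; simpl; ring. Qed.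

(** The limit of [sqrt_psi]. [mlim_value] recognises it as the constant of [whitP] times x^kappa exp
    (- x / 2), kappa being the index that occurs in [whitP]. *)
Definition mlim (u : R) : R := sqrt (sqrt t * exp (- u) * Rpower u s / g).

Lemma psi_integer (xi : R) (k : nat) :
  psi z z' xi sg (INR k) = (RtoC (sqrt t) * RtoC (Rpower xi (INR k + 1 / 2)) * Rcpow (1 - xi) (RtoC s)
     * ((poch (1 + p) k / RtoC (INR (fact k))) * (poch (1 + p') k / RtoC (INR (fact k)))))%C.
Proof.
  destruct (gp_regular _ _ _ _ gp) as [R1 R2].
  destruct (Gamma_spec _ R1) as [N1 _]. destruct (Gamma_spec _ R2) as [N2 _].
  unfold psi. rewrite Ht, signed_sum, Gamma_fact. fold p p'.
  replace (RtoC (INR k + 1) + p)%C with (1 + p + RtoC (INR k))%C by (rewrite RtoC_plus; ring).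
  replace (RtoC (INR k + 1) + p')%C with (1 + p' + RtoC (INR k))%C by (rewrite RtoC_plus; ring).
  rewrite !Gamma_poch by assumption.
  assert (FN := INR_factC k). field. repeat split; assumption.
Qed.

(** The Pochhammer quotients grow like k^p k^p' = k^s, and the factor (1 - xi)^s = e^s completes
    this to (e k)^s, which tends to u^s. *)
Lemma psi_lim (u : R) : 0 < u ->
  ctends (at_right 0) (fun e => psi z z' (1 - e) sg (INR (scaled_index u e))) (RtoC (sqrt t * exp (- u) * Rpower u s / g)).
Proof.
  intros Hu.
  destruct (gp_regular _ _ _ _ gp) as [R1 R2].
  destruct (Gamma_spec _ R1) as [N1 _]. destruct (Gamma_spec _ R2) as [N2 _].
  assert (A1 := ctends_comp _ _ _ (scaled_index_infty u Hu) (poch_fact_asymp p R1)).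
  assert (A2 := ctends_comp _ _ _ (scaled_index_infty u Hu) (poch_fact_asymp p' R2)).
  assert (A3 := ctends_RtoC _ _ (Rpower_lim u Hu)).
  assert (A4 := ctends_Rcpow _ _ (RtoC s) Hu (scaled_index_lim u 0 Hu)).
  assert (Q := ctends_mult _ _ _ _ (ctends_mult _ _ _ _ (ctends_mult _ _ _ _ (ctends_const (RtoC (sqrt t))) A3) A4)
       (ctends_mult _ _ _ _ A1 A2)).
  replace (RtoC (sqrt t * exp (- u) * Rpower u s / g))
    with (RtoC (sqrt t) * RtoC (exp (- u)) * Rcpow u (RtoC s) * (/ Gamma (1 + p) * / Gamma (1 + p')))%C.
  2: { rewrite RtoC_div, !RtoC_mult, Rcpow_RtoC, <- HG by lra. field. split; assumption. }
  apply ctends_ext_loc with (2 := Q).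
  generalize (filter_and _ _ (at_right_pos 1 Rlt_0_1) (scaled_index_infty u Hu _ (ex_intro _ 1%nat (fun n H => H)))).
  apply filter_imp. intros e [He Hk]. rewrite psi_integer, Rplus_0_r.
  assert (Hk0 : 0 < INR (scaled_index u e)) by (apply lt_0_INR; lia).
  replace (1 - (1 - e)) with e by ring.
  rewrite Rcpow_mult by lra.
  assert (E : Rcpow (INR (scaled_index u e)) (RtoC s) = (Rcpow (INR (scaled_index u e)) p * Rcpow (INR (scaled_index u e)) p')%C).
  { rewrite <- (gp_sum _ _ _ _ gp). apply Rcpow_plus. }
  rewrite E. assert (F1 := Rcpow_neq_0 (INR (scaled_index u e)) p). assert (F2 := Rcpow_neq_0 (INR (scaled_index u e)) p').
  assert (FN := INR_factC (scaled_index u e)). field. repeat split; assumption.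
Qed.

Lemma sqrt_psi_lim (u : R) : 0 < u ->
  filterlim (fun e => sqrt_psi z z' (1 - e) sg (INR (scaled_index u e))) (at_right 0) (locally (mlim u)).
Proof.
  intros Hu. assert (Q := ctends_re _ _ (psi_lim u Hu)). rewrite re_RtoC in Q.
  apply (filterlim_comp _ _ _ _ sqrt _ _ _ Q). apply continuous_sqrt.
Qed.

Lemma sqrt_t_pos : 0 < sqrt t.
Proof. apply sqrt_lt_R0. apply (gp_t _ _ _ _ gp). Qed.

Lemma mlim_arg_pos (u : R) : 0 < sqrt t * exp (- u) * Rpower u s / g.
Proof.
  apply Rdiv_lt_0_compat; [|exact Hg]. apply Rmult_lt_0_compat; [|apply exp_pos].
  apply Rmult_lt_0_compat; [apply sqrt_t_pos|apply exp_pos].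
Qed.

Lemma psi_cder (xi x : R) : -1 < x -> 0 < 1 + Re p + x -> 0 < 1 + Re p' + x ->
  exists l, cder (psi z z' xi sg) x l.
Proof.
  intros Hx H1 H2.
  destruct (Gamma_ratio_cder p x Hx H1) as (l1 & D1). destruct (Gamma_ratio_cder p' x Hx H2) as (l2 & D2).
  destruct (gp_regular _ _ _ _ gp) as [R1 R2].
  destruct (Gamma_spec _ R1) as [N1 _]. destruct (Gamma_spec _ R2) as [N2 _].
  assert (D3 : cder (fun y => RtoC (Rpower xi (y + 1 / 2))) x (RtoC (ln xi * Rpower xi (x + 1 / 2)))).
  { apply cder_RtoC. unfold Rpower. auto_derive; [trivial|]. ring. }
  eexists.
  apply cder_ext_loc with (fun y => (RtoC (sqrt t) * Rcpow (1 - xi) (signed sg (z + z')) * / (Gamma (1 + p) * Gamma (1 + p'))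
     * (RtoC (Rpower xi (y + 1 / 2)) * ((Gamma (RtoC (y + 1) + p) / Gamma (RtoC (y + 1))) * (Gamma (RtoC (y + 1) + p') / Gamma (RtoC (y + 1))))))%C).
  2: { exact (cder_mult _ _ _ _ _ (cder_const _ x) (cder_mult _ _ _ _ _ D3 (cder_mult _ _ _ _ _ D1 D2))). }
  exists (mkposreal (x + 1) ltac:(lra)). intros y Hy. change (Rabs (y - x) < x + 1) in Hy. apply Rabs_def2 in Hy.
  destruct (Gamma_spec (RtoC (y + 1))) as [N3 _]; [apply Re_pos_regular; rewrite re_RtoC; lra|].
  unfold psi. rewrite Ht. fold p p'. field. repeat split; assumption.
Qed.

(** Holds once e is small: psi is then positive at k because its limit is, and k is large enough for
    the Gamma arguments to lie in the right half-plane. *)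
Lemma sqrt_psi_derivable (u : R) : 0 < u ->
  at_right 0 (fun e => ex_derive (sqrt_psi z z' (1 - e) sg) (INR (scaled_index u e))).
Proof.
  intros Hu.
  destruct (nfloor_ex (Rabs (Re p) + Rabs (Re p') + 1)) as (N & _ & HN);
    [generalize (Rabs_pos (Re p)) (Rabs_pos (Re p')); lra|].
  assert (Q := ctends_re _ _ (psi_lim u Hu)). rewrite re_RtoC in Q.
  assert (Pos : at_right 0 (fun e => 0 < Re (psi z z' (1 - e) sg (INR (scaled_index u e))))).
  { generalize (proj1 (filterlim_locally _ _) Q (mkposreal _ (mlim_arg_pos u))). apply filter_imp.
    intros e He. change (Rabs (Re (psi z z' (1 - e) sg (INR (scaled_index u e))) - sqrt t * exp (- u) * Rpower u s / g)
       < sqrt t * exp (- u) * Rpower u s / g) in He. apply Rabs_def2 in He. lra. }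
  generalize (filter_and _ _ Pos (scaled_index_infty u Hu _ (ex_intro _ (S N) (fun n H => H)))).
  apply filter_imp. intros e [He Hk].
  assert (Hk' : INR (S N) <= INR (scaled_index u e)) by (apply le_INR; exact Hk). rewrite S_INR in Hk'.
  assert (a1 := Rle_abs (- Re p)). assert (a2 := Rle_abs (- Re p')). rewrite Rabs_Ropp in a1, a2.
  assert (a3 := Rabs_pos (Re p)). assert (a4 := Rabs_pos (Re p')).
  destruct (psi_cder (1 - e) (INR (scaled_index u e))) as (l & [D _]); try lra.
  eexists. unfold sqrt_psi. apply (is_derive_comp sqrt (fun y => Re (psi z z' (1 - e) sg y))); [|exact D].
  apply is_derive_Reals, derivable_pt_lim_sqrt. exact He.
Qed.

Variables (fP fP1 fP2 fQ fQ1 fQ2 : R -> C).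
Hypothesis CP : Hf_converges (- p) (- p') fP fP1.
Hypothesis CQ : Hf_converges (1 - p) (1 - p') fQ fQ1.
Hypothesis LP : ctends (Rbar_locally p_infty) fP 1%C.
Hypothesis LQ : ctends (Rbar_locally p_infty) fQ 1%C.
Hypothesis EP : forall x, 0 < x -> cder fP x (fP1 x) /\ cder fP1 x (fP2 x) /\
    (RtoC x * RtoC x * fP2 x + (1 - - p - - p' - RtoC x) * (RtoC x * fP1 x) + (- p) * (- p') * fP x = 0)%C.
Hypothesis EQ : forall x, 0 < x -> cder fQ x (fQ1 x) /\ cder fQ1 x (fQ2 x) /\
    (RtoC x * RtoC x * fQ2 x + (1 - (1 - p) - (1 - p') - RtoC x) * (RtoC x * fQ1 x) + (1 - p) * (1 - p') * fQ x = 0)%C.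

Definition gQ (x : R) : C := (RtoC (sqrt t) * (fQ x / RtoC x))%C.

Lemma hypP_eq (e x : R) : 0 < e ->
  hypP z z' (1 - e) sg x = (RtoC (sqrt_psi z z' (1 - e) sg x) * Hf (- p) (- p') e (e * (x + 1)))%C.
Proof.
  intros He. unfold hypP, Hf. do 2 f_equal.
  - f_equal. field. lra.
  - f_equal. field. lra.
Qed.

Lemma hypQ_eq (e x : R) : 0 < e ->
  hypQ z z' (1 - e) sg x = (RtoC (sqrt_psi z z' (1 - e) sg x)
    * (RtoC (sqrt t * sqrt (1 - e) / e) * (Hf (1 - p) (1 - p') e (e * (x + 2)) / RtoC (x + 1))))%C.
Proof.
  intros He. unfold hypQ, Hf. rewrite Ht. fold p p'.
  replace (e * (x + 2) / e) with (x + 2) by (field; lra).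
  replace ((1 - e) / (1 - e - 1)) with (1 - / e) by (field; lra).
  replace (1 - (1 - e)) with e by ring.
  replace (sqrt t * sqrt (1 - e) * sqrt_psi z z' (1 - e) sg x / e)
    with (sqrt_psi z z' (1 - e) sg x * (sqrt t * sqrt (1 - e) / e)) by (field; lra).
  rewrite RtoC_mult. ring.
Qed.

Lemma to_near (u c : R) : 0 < u -> filterlim (fun e => (e, e * (INR (scaled_index u e) + c))) (at_right 0) (near u).
Proof. intros Hu. apply filterlim_pair; [apply filterlim_id|apply scaled_index_lim, Hu]. Qed.

Lemma sqrt_1_minus_lim : ctends (at_right 0) (fun e => RtoC (sqrt (1 - e))) 1%C.
Proof.
  replace (RtoC 1) with (RtoC (sqrt 1)) by (rewrite sqrt_1; reflexivity). apply ctends_RtoC.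
  assert (H : filterlim (fun e => sqrt (1 - e)) (locally 0) (locally (sqrt 1))).
  { replace (sqrt 1) with (sqrt (1 - 0)) by (f_equal; ring).
    apply (ex_derive_continuous (fun e => sqrt (1 - e))). auto_derive. lra. }
  intros P HP. apply filter_le_within, H, HP.
Qed.

Lemma hypP_lim (u : R) : 0 < u ->
  ctends (at_right 0) (fun e => hypP z z' (1 - e) sg (INR (scaled_index u e))) (RtoC (mlim u) * fP u)%C.
Proof.
  intros Hu. destruct (CP u Hu) as (D & _ & H & _).
  apply ctends_ext_loc with (fun e => (RtoC (sqrt_psi z z' (1 - e) sg (INR (scaled_index u e))) * Hf (- p) (- p') e (e * (INR (scaled_index u e) + 1)))%C).
  - generalize (at_right_pos 1 Rlt_0_1). apply filter_imp. intros e He. symmetry. apply hypP_eq. lra.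
  - apply ctends_mult; [apply ctends_RtoC, sqrt_psi_lim, Hu|].
    exact (ctends_comp _ _ _ (to_near u 1 Hu) H).
Qed.

(** [Q] behaves like [sqrt_psi * gQ], after absorbing [1 / e] into [1 / (k + 1)]. *)
Lemma Qfactor_lim (u : R) (X : R -> C) (l : C) : 0 < u -> ctends (at_right 0) X l ->
  ctends (at_right 0) (fun e => (RtoC (sqrt t * sqrt (1 - e) / e) * (X e / RtoC (INR (scaled_index u e) + 1)))%C)
    (RtoC (sqrt t) * (l / RtoC u))%C.
Proof.
  intros Hu HX. assert (Nu : RtoC u <> 0%C) by (apply RtoC_neq_0; lra).
  assert (Q := ctends_mult _ _ _ _ (ctends_mult _ _ _ _ (ctends_const (RtoC (sqrt t))) sqrt_1_minus_lim)
     (ctends_div _ _ _ _ Nu HX (ctends_RtoC _ _ (scaled_index_lim u 1 Hu)))).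
  replace (RtoC (sqrt t) * 1 * (l / RtoC u))%C with (RtoC (sqrt t) * (l / RtoC u))%C in Q by ring.
  apply ctends_ext_loc with (2 := Q).
  generalize (at_right_pos 1 Rlt_0_1). apply filter_imp. intros e He.
  assert (K1 : RtoC (INR (scaled_index u e) + 1) <> 0%C) by (apply RtoC_neq_0; generalize (pos_INR (scaled_index u e)); lra).
  assert (NeC : RtoC e <> 0%C) by (apply RtoC_neq_0; lra).
  rewrite RtoC_div, !RtoC_mult by lra. field. split; assumption.
Qed.

Lemma hypQ_lim (u : R) : 0 < u ->
  ctends (at_right 0) (fun e => hypQ z z' (1 - e) sg (INR (scaled_index u e))) (RtoC (mlim u) * gQ u)%C.
Proof.
  intros Hu. destruct (CQ u Hu) as (D & _ & H & _).
  apply ctends_ext_loc with (fun e => (RtoC (sqrt_psi z z' (1 - e) sg (INR (scaled_index u e)))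
    * (RtoC (sqrt t * sqrt (1 - e) / e) * (Hf (1 - p) (1 - p') e (e * (INR (scaled_index u e) + 2)) / RtoC (INR (scaled_index u e) + 1))))%C).
  - generalize (at_right_pos 1 Rlt_0_1). apply filter_imp. intros e He. symmetry. apply hypQ_eq. lra.
  - apply ctends_mult; [apply ctends_RtoC, sqrt_psi_lim, Hu|].
    apply (Qfactor_lim u (fun e => Hf (1 - p) (1 - p') e (e * (INR (scaled_index u e) + 2)))); [exact Hu|].
    exact (ctends_comp _ _ _ (to_near u 2 Hu) H).
Qed.

Lemma gQ_cder (u : R) : 0 < u ->
  cder gQ u (RtoC (sqrt t) * (fQ1 u / RtoC u) - RtoC (sqrt t) * (fQ u / RtoC u / RtoC u))%C.
Proof.
  intros Hu. assert (Nu : RtoC u <> 0%C) by (apply RtoC_neq_0; lra).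
  destruct (EQ u Hu) as (D & _ & _).
  eapply cder_eq; [|apply cder_mult; [apply cder_const|apply cder_div; [exact Nu|exact D|apply cder_RtoC, (is_derive_id (K := R_AbsRing))]]].
  cbv beta. unfold one; simpl. field. exact Nu.
Qed.

Lemma mlim_derivable (u : R) : 0 < u -> exists l, is_derive mlim u l.
Proof.
  intros Hu. eexists. unfold mlim.
  apply (is_derive_comp sqrt (fun u => sqrt t * exp (- u) * Rpower u s / g)).
  - apply is_derive_Reals, derivable_pt_lim_sqrt, mlim_arg_pos.
  - unfold Rpower. auto_derive; [exact Hu|reflexivity].
Qed.

Lemma mlim_value (u : R) : 0 < u ->
  mlim u = Rpower t (1 / 4) / sqrt (g * u) * (Rpower u ((s + 1) / 2) * exp (- u / 2)).
Proof.
  intros Hu. assert (tp := gp_t _ _ _ _ gp).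
  assert (Es : forall x, 0 < x -> sqrt x = Rpower x (/ 2)) by (intros; symmetry; apply Rpower_sqrt; assumption).
  unfold mlim. rewrite Es by apply mlim_arg_pos. rewrite (Es t tp), (Es (g * u)) by nra.
  unfold Rpower, Rdiv.
  assert (LX : forall x, ln (exp x) = x) by apply ln_exp.
  assert (P : forall x, 0 < exp x) by apply exp_pos.
  rewrite !ln_mult by (try apply Rmult_lt_0_compat; try apply Rmult_lt_0_compat; try apply Rinv_0_lt_compat; auto).
  rewrite ln_Rinv by exact Hg. rewrite !LX.
  rewrite <- exp_Ropp, <- !exp_plus. f_equal. field.
Qed.

Lemma whitP_eq (u : R) : 0 < u -> whitP z z' sg u = (RtoC (mlim u) * fP u)%C.
Proof.
  intros Hu. unfold whitP. fold p p'.
  replace (RtoC 1 + p)%C with (1 + p)%C by reflexivity.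
  rewrite HG, re_RtoC, Ht, signed_sum.
  assert (E : ((RtoC s + 1) / 2)%C = RtoC ((s + 1) / 2)) by (rewrite RtoC_div, RtoC_plus by lra; reflexivity).
  assert (W := whittakerW_value (- p) (- p') ((RtoC s + 1) / 2) ((z - z') / 2) fP fP1 fP2).
  rewrite W; try assumption.
  - rewrite (mlim_value u Hu), E, Rcpow_RtoC. rewrite !RtoC_mult. ring.
  - rewrite E. apply im_RtoC.
  - rewrite <- (gp_sum _ _ _ _ gp). field.
  - rewrite <- (gp_sum _ _ _ _ gp). unfold p, p'. destruct sg; simpl signed; field.
Qed.

(** The index kappa of Q is one less than that of P, which produces the quotient by u in [gQ], and
    t^(3/4) = t^(1/4) sqrt t produces its constant. *)
Lemma whitQ_eq (u : R) : 0 < u -> whitQ z z' sg u = (RtoC (mlim u) * gQ u)%C.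
Proof.
  intros Hu. unfold whitQ. fold p p'.
  replace (RtoC 1 + p)%C with (1 + p)%C by reflexivity.
  rewrite HG, re_RtoC, Ht, signed_sum.
  assert (E : ((RtoC s - 1) / 2)%C = RtoC ((s - 1) / 2)) by (rewrite RtoC_div, RtoC_minus by lra; reflexivity).
  assert (W := whittakerW_value (1 - p) (1 - p') ((RtoC s - 1) / 2) ((z - z') / 2) fQ fQ1 fQ2).
  rewrite W; try assumption.
  - unfold gQ. rewrite (mlim_value u Hu), E, Rcpow_RtoC.
    assert (T1 : Rpower t (3 / 4) = Rpower t (1 / 4) * sqrt t).
    { rewrite <- Rpower_sqrt by apply (gp_t _ _ _ _ gp). rewrite <- Rpower_plus. f_equal. field. }
    assert (T2 : Rpower u ((s + 1) / 2) = Rpower u ((s - 1) / 2) * u).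
    { rewrite <- (Rpower_1 u Hu) at 3. rewrite <- Rpower_plus. f_equal. field. }
    assert (Nu : RtoC u <> 0%C) by (apply RtoC_neq_0; lra).
    assert (Ng : sqrt (g * u) <> 0) by (apply Rgt_not_eq, sqrt_lt_R0; nra).
    assert (NgC : RtoC (sqrt (g * u)) <> 0%C) by (apply RtoC_neq_0, Ng).
    rewrite T1, T2. rewrite ?RtoC_mult, ?RtoC_div, ?RtoC_mult by exact Ng. field. split; assumption.
  - rewrite E. apply im_RtoC.
  - rewrite <- (gp_sum _ _ _ _ gp). field.
  - rewrite <- (gp_sum _ _ _ _ gp). unfold p, p'. destruct sg; simpl signed; field.
Qed.

(** F depends on k through x = e (k + const), so d/dk = e d/dx, and this factor e cancels the
    prefactor 1 / e. *)
Lemma diagonal_lim (u : R) : 0 < u ->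
  ctends (at_right 0)
   (fun e => (RtoC (/ e) * (CDerive (hypP z z' (1 - e) sg) (INR (scaled_index u e)) * hypQ z z' (1 - e) sg (INR (scaled_index u e))
      - CDerive (hypQ z z' (1 - e) sg) (INR (scaled_index u e)) * hypP z z' (1 - e) sg (INR (scaled_index u e))))%C)
   (CDerive (whitP z z' sg) u * whitQ z z' sg u - CDerive (whitQ z z' sg) u * whitP z z' sg u)%C.
Proof.
  intros Hu. assert (Nu : RtoC u <> 0%C) by (apply RtoC_neq_0; lra).
  destruct (EP u Hu) as (DP & _ & _). destruct (mlim_derivable u Hu) as (m1 & Dm).
  assert (RHS : (CDerive (whitP z z' sg) u * whitQ z z' sg u - CDerive (whitQ z z' sg) u * whitP z z' sg u)%C
    = (RtoC (mlim u) * RtoC (mlim u) * (fP1 u * gQ u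
          - (RtoC (sqrt t) * (fQ1 u / RtoC u) - RtoC (sqrt t) * (fQ u / RtoC u / RtoC u)) * fP u))%C).
  { rewrite <- (CDerive_common_factor mlim fP gQ u m1 _ _ Dm DP (gQ_cder u Hu)).
    rewrite <- whitP_eq, <- whitQ_eq by exact Hu.
    (* The closed forms of P and Q hold for positive arguments, so they are differentiated through
       local equality at u. *)
    assert (Loc : locally u (fun y => 0 < y)).
    { exists (mkposreal u Hu). intros y Hy. change (Rabs (y - u) < u) in Hy. apply Rabs_def2 in Hy. lra. }
    assert (CE : forall f h : R -> C, locally u (fun y => f y = h y) -> CDerive f u = CDerive h u).
    { intros f h Hfh. unfold CDerive. f_equal; apply Derive_ext_loc; revert Hfh; apply filter_imp; intros y ->; reflexivity. }
    rewrite (CE (whitP z z' sg) (fun y => (RtoC (mlim y) * fP y)%C)).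
    2: { revert Loc. apply filter_imp. intros y Hy. apply whitP_eq, Hy. }
    rewrite (CE (whitQ z z' sg) (fun y => (RtoC (mlim y) * gQ y)%C)).
    2: { revert Loc. apply filter_imp. intros y Hy. apply whitQ_eq, Hy. }
    reflexivity. }
  rewrite RHS.
  destruct (CP u Hu) as (EDP & N1 & HP & HP1). destruct (CQ u Hu) as (EDQ & N2 & HQ & HQ1).
  assert (N1' := to_near u 1 Hu _ N1). assert (N2' := to_near u 2 Hu _ N2). unfold filtermap in N1', N2'. simpl fst in N1', N2'. simpl snd in N1', N2'.
  assert (LHP := ctends_comp _ _ _ (to_near u 1 Hu) HP). assert (LHP1 := ctends_comp _ _ _ (to_near u 1 Hu) HP1).
  assert (LHQ := ctends_comp _ _ _ (to_near u 2 Hu) HQ). assert (LHQ1 := ctends_comp _ _ _ (to_near u 2 Hu) HQ1).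
  simpl fst in LHP, LHQ; simpl snd in LHP, LHQ.
  pose (hP := fun e => Hf (- p) (- p') e (e * (INR (scaled_index u e) + 1))).
  pose (hQ := fun e => Hf (1 - p) (1 - p') e (e * (INR (scaled_index u e) + 2))).
  pose (dP := fun e => EDP (e, e * (INR (scaled_index u e) + 1))). pose (dQ := fun e => EDQ (e, e * (INR (scaled_index u e) + 2))).
  pose (y := fun e => RtoC (e * (INR (scaled_index u e) + 1))).
  pose (q := fun e => RtoC (sqrt t * sqrt (1 - e) / e)).
  pose (K1 := fun e => RtoC (INR (scaled_index u e) + 1)).
  assert (Ly : ctends (at_right 0) y (RtoC u)) by (apply ctends_RtoC, scaled_index_lim, Hu).
  assert (LS := ctends_RtoC _ _ (sqrt_psi_lim u Hu)).
  assert (Q1 := Qfactor_lim u hQ _ Hu LHQ). assert (Q2 := Qfactor_lim u dQ _ Hu LHQ1).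
  (* The contribution of differentiating 1 / (k + 1) in Q; with the prefactor 1 / e it becomes a
     division by y = e (k + 1). *)
  assert (Q3 := Qfactor_lim u (fun e => hQ e / y e)%C _ Hu (ctends_div _ _ _ _ Nu LHQ Ly)).
  assert (Lim := ctends_mult _ _ _ _ (ctends_mult _ _ _ _ LS LS)
     (ctends_minus _ _ _ _ (ctends_mult _ _ _ _ LHP1 Q1) (ctends_mult _ _ _ _ (ctends_minus _ _ _ _ Q2 Q3) LHP))).
  apply ctends_ext_loc with (2 := Lim).
  generalize (filter_and _ _ (at_right_pos 1 Rlt_0_1) (filter_and _ _ (sqrt_psi_derivable u Hu) (filter_and _ _ N1' N2'))).
  apply filter_imp. intros e (He & (S1 & DS) & (_ & D1) & (_ & D2)).
  assert (NeC : RtoC e <> 0%C) by (apply RtoC_neq_0; lra).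
  set (k := INR (scaled_index u e)) in *.
  assert (Hk : 0 <= k) by apply pos_INR.
  assert (KC : RtoC (k + 1) <> 0%C) by (apply RtoC_neq_0; lra).
  assert (D1' : cder (fun x => Hf (- p) (- p') e (e * (x + 1))) k (RtoC e * dP e)%C).
  { apply (cder_comp (Hf (- p) (- p') e) (fun x => e * (x + 1))); [exact D1|]. auto_derive; [trivial|ring]. }
  assert (D2' : cder (fun x => Hf (1 - p) (1 - p') e (e * (x + 2))) k (RtoC e * dQ e)%C).
  { apply (cder_comp (Hf (1 - p) (1 - p') e) (fun x => e * (x + 2))); [exact D2|]. auto_derive; [trivial|ring]. }
  assert (D3 : cder (fun x => RtoC (x + 1)) k 1%C) by (apply cder_RtoC; auto_derive; [trivial|ring]).
  assert (D4 := cder_mult _ _ _ _ _ (cder_const (q e) k) (cder_div _ (fun x => RtoC (x + 1)) k _ _ KC D2' D3)).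
  assert (FP : hypP z z' (1 - e) sg = (fun x => (RtoC (sqrt_psi z z' (1 - e) sg x) * Hf (- p) (- p') e (e * (x + 1)))%C))
    by (apply functional_extensionality; intros; apply hypP_eq; lra).
  assert (FQ : hypQ z z' (1 - e) sg = (fun x => (RtoC (sqrt_psi z z' (1 - e) sg x)
      * (q e * (Hf (1 - p) (1 - p') e (e * (x + 2)) / RtoC (x + 1))))%C))
    by (apply functional_extensionality; intros; apply hypQ_eq; lra).
  rewrite FP, FQ. cbv beta.
  rewrite (CDerive_common_factor _ _ _ k S1 _ _ DS D1' D4).
  unfold y. fold k. simpl fst; simpl snd.
  change (EDP (e, e * (k + 1))) with (dP e).
  change (Hf (1 - p) (1 - p') e (e * (k + 2))) with (hQ e).
  change (Hf (- p) (- p') e (e * (k + 1))) with (hP e).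
  change (RtoC (sqrt t * sqrt (1 - e) / e)) with (q e).
  rewrite RtoC_inv, (RtoC_mult e) by lra. field. split; assumption.
Qed.
End OneSign.

Lemma one_sign_limits (z z' : C) (sg : pm) (t s : R) :
  positive_pair (signed sg z) (signed sg z') t s -> tpar z z' = t ->
  forall u, 0 < u ->
    ctends (at_right 0) (fun e => hypP z z' (1 - e) sg (INR (scaled_index u e))) (whitP z z' sg u) /\
    ctends (at_right 0) (fun e => hypQ z z' (1 - e) sg (INR (scaled_index u e))) (whitQ z z' sg u) /\
    ctends (at_right 0)
     (fun e => (RtoC (/ e) * (CDerive (hypP z z' (1 - e) sg) (INR (scaled_index u e)) * hypQ z z' (1 - e) sg (INR (scaled_index u e))
      - CDerive (hypQ z z' (1 - e) sg) (INR (scaled_index u e)) * hypP z z' (1 - e) sg (INR (scaled_index u e))))%C)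
     (CDerive (whitP z z' sg) u * whitQ z z' sg u - CDerive (whitQ z z' sg) u * whitP z z' sg u)%C.
Proof.
  intros gp Ht u Hu.
  destruct (gp_gamma _ _ _ _ gp) as (g & Hg & HG).
  destruct (confluent_exists (- signed sg z) (- signed sg z')) as (fP & fP1 & fP2 & CP & LP & EP).
  destruct (confluent_exists (1 - signed sg z) (1 - signed sg z')) as (fQ & fQ1 & fQ2 & CQ & LQ & EQ).
  split; [|split].
  - erewrite whitP_eq by eassumption. eapply hypP_lim; eassumption.
  - erewrite whitQ_eq by eassumption. eapply hypQ_lim; eassumption.
  - eapply diagonal_lim; eassumption.
Qed.

(** * From one sign to the four blocks *)

Lemma admissible_positive_pair (z z' : C) (sg : pm) : admissible z z' ->
  exists s, positive_pair (signed sg z) (signed sg z') (tpar z z') s.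
Proof.
  intros H.
  assert (E : exists t s, positive_pair (signed sg z) (signed sg z') t s).
  { destruct sg; apply admissible_pair; intros k Hk; apply (H k Hk). }
  destruct E as (t & s & gp). exists s.
  assert (Et : t = tpar z z').
  { unfold tpar. rewrite <- (re_RtoC t), <- (gp_prod _ _ _ _ gp). f_equal. destruct sg; simpl; ring. }
  rewrite <- Et. exact gp.
Qed.

Lemma to_at_right (f : R -> C) (l : C) :
  ctends (at_right 0) (fun e => f (1 - e)) l -> filterlim f (at_left 1) (locally l).
Proof.
  intros H. apply ctends_filterlim.
  assert (G : filterlim (fun xi => 1 - xi) (at_left 1) (at_right 0)).
  { intros P [d Hd]. exists d. intros xi Hxi Hlt. change (Rabs (xi - 1) < d) in Hxi. apply Hd; [|lra].
    change (Rabs (1 - xi - 0) < d). rewrite Rminus_0_r, Rabs_minus_sym. exact Hxi. }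
  apply ctends_ext with (2 := ctends_comp _ _ _ G H). intros xi. f_equal. ring.
Qed.

Theorem theorem5p4 :
  forall z z' : C, admissible z z' ->
  forall (e1 e2 : pm) (u v : R), (0 < u)%R -> (0 < v)%R ->
    filterlim
      (fun xi : R =>
         (RtoC (1 / (1 - xi))
          * hyp_kernel z z' xi e1 e2
              (nat_part (u / (1 - xi))) (nat_part (v / (1 - xi))))%C)
      (at_left 1%R) (locally (whit_kernel z z' e1 e2 u v)).
Proof.
  intros z z' Hz e1 e2 u v Hu Hv. apply to_at_right.
  apply ctends_ext with (fun e => (RtoC (1 / e) * hyp_kernel z z' (1 - e) e1 e2 (scaled_index u e) (scaled_index v e))%C).
  { intros e. unfold scaled_index. replace (1 - (1 - e)) with e by ring. reflexivity. }
  assert (Lim : forall sg w, 0 < w ->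
    ctends (at_right 0) (fun e => hypP z z' (1 - e) sg (INR (scaled_index w e))) (whitP z z' sg w) /\
    ctends (at_right 0) (fun e => hypQ z z' (1 - e) sg (INR (scaled_index w e))) (whitQ z z' sg w) /\
    ctends (at_right 0)
     (fun e => (RtoC (/ e) * (CDerive (hypP z z' (1 - e) sg) (INR (scaled_index w e)) * hypQ z z' (1 - e) sg (INR (scaled_index w e))
      - CDerive (hypQ z z' (1 - e) sg) (INR (scaled_index w e)) * hypP z z' (1 - e) sg (INR (scaled_index w e))))%C)
     (CDerive (whitP z z' sg) w * whitQ z z' sg w - CDerive (whitQ z z' sg) w * whitP z z' sg w)%C).
  { intros sg. destruct (admissible_positive_pair z z' sg Hz) as (s & gp).
    exact (one_sign_limits z z' sg _ s gp eq_refl). }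
  assert (Same : forall sg, ctends (at_right 0)
     (fun e => (RtoC (1 / e) * hyp_kernel z z' (1 - e) sg sg (scaled_index u e) (scaled_index v e))%C) (whit_kernel z z' sg sg u v)).
  { intros sg.
    enough (S : ctends (at_right 0)
      (fun e => (RtoC (1 / e) * (if Nat.eq_dec (scaled_index u e) (scaled_index v e) then
        CDerive (hypP z z' (1 - e) sg) (INR (scaled_index u e)) * hypQ z z' (1 - e) sg (INR (scaled_index u e))
        - CDerive (hypQ z z' (1 - e) sg) (INR (scaled_index u e)) * hypP z z' (1 - e) sg (INR (scaled_index u e))
      else (hypP z z' (1 - e) sg (INR (scaled_index u e)) * hypQ z z' (1 - e) sg (INR (scaled_index v e))
            - hypQ z z' (1 - e) sg (INR (scaled_index u e)) * hypP z z' (1 - e) sg (INR (scaled_index v e)))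
            / RtoC (INR (scaled_index u e) - INR (scaled_index v e))))%C)
      (if Req_EM_T u v then
        CDerive (whitP z z' sg) u * whitQ z z' sg u - CDerive (whitQ z z' sg) u * whitP z z' sg u
       else (whitP z z' sg u * whitQ z z' sg v - whitQ z z' sg u * whitP z z' sg v) / RtoC (u - v))%C)
      by (destruct sg; exact S).
    (* For u = v the two indices coincide at every e and the L'Hospital value is used throughout.
       For u <> v, e (k - l) tends to u - v, so the indices eventually differ. *)
    destruct (Req_EM_T u v) as [Euv|Nuv].
    - subst v. destruct (Lim sg u Hu) as (_ & _ & Ld). apply ctends_ext with (2 := Ld).
      intros e. destruct (Nat.eq_dec (scaled_index u e) (scaled_index u e)) as [_|N]; [|congruence].
      unfold Rdiv. rewrite Rmult_1_l. reflexivity.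
    - destruct (Lim sg u Hu) as (LPu & LQu & _). destruct (Lim sg v Hv) as (LPv & LQv & _).
      assert (Nd : RtoC (u - v) <> 0%C) by (apply RtoC_neq_0; lra).
      assert (Ld := ctends_minus _ _ _ _ (ctends_RtoC _ _ (scaled_index_lim u 0 Hu)) (ctends_RtoC _ _ (scaled_index_lim v 0 Hv))).
      rewrite <- RtoC_minus in Ld.
      assert (Q := ctends_div _ _ _ _ Nd (ctends_minus _ _ _ _ (ctends_mult _ _ _ _ LPu LQv) (ctends_mult _ _ _ _ LQu LPv)) Ld).
      apply ctends_ext_loc with (2 := Q).
      generalize (filter_and _ _ (at_right_pos 1 Rlt_0_1) (ctends_ne0 _ _ Nd Ld)). apply filter_imp.
      intros e [He Hne]. rewrite !Rplus_0_r, <- RtoC_minus, <- Rmult_minus_distr_l in Hne.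
      destruct (Nat.eq_dec (scaled_index u e) (scaled_index v e)) as [E|_].
      { exfalso. apply Hne. rewrite E, Rminus_diag, Rmult_0_r. reflexivity. }
      assert (Nk : RtoC (INR (scaled_index u e) - INR (scaled_index v e)) <> 0%C).
      { intros E. apply Hne. rewrite RtoC_mult, E. ring. }
      assert (NeC : RtoC e <> 0%C) by (apply RtoC_neq_0; lra).
      rewrite !Rplus_0_r, <- RtoC_minus, <- Rmult_minus_distr_l, RtoC_mult, RtoC_div by lra.
      field. split; assumption. }
  assert (Mixed : forall s1 s2, ctends (at_right 0)
     (fun e => (RtoC (1 / e) * ((hypP z z' (1 - e) s1 (INR (scaled_index u e)) * hypP z z' (1 - e) s2 (INR (scaled_index v e))
            + hypQ z z' (1 - e) s1 (INR (scaled_index u e)) * hypQ z z' (1 - e) s2 (INR (scaled_index v e)))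
            / RtoC (INR (scaled_index u e) + INR (scaled_index v e) + 1)))%C)
     ((whitP z z' s1 u * whitP z z' s2 v + whitQ z z' s1 u * whitQ z z' s2 v) / RtoC (u + v))%C).
  { intros s1 s2.
    destruct (Lim s1 u Hu) as (LPu & LQu & _). destruct (Lim s2 v Hv) as (LPv & LQv & _).
    assert (Nd : RtoC (u + v) <> 0%C) by (apply RtoC_neq_0; lra).
    (* The + 1 in the denominator k + l + 1 is attached to the second index as its offset. *)
    assert (Ld := ctends_plus _ _ _ _ (ctends_RtoC _ _ (scaled_index_lim u 0 Hu)) (ctends_RtoC _ _ (scaled_index_lim v 1 Hv))).
    rewrite <- RtoC_plus in Ld.
    assert (Q := ctends_div _ _ _ _ Nd (ctends_plus _ _ _ _ (ctends_mult _ _ _ _ LPu LPv) (ctends_mult _ _ _ _ LQu LQv)) Ld).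
    apply ctends_ext_loc with (2 := Q).
    generalize (at_right_pos 1 Rlt_0_1). apply filter_imp. intros e He.
    assert (Nk : RtoC (INR (scaled_index u e) + INR (scaled_index v e) + 1) <> 0%C).
    { apply RtoC_neq_0. generalize (pos_INR (scaled_index u e)) (pos_INR (scaled_index v e)). lra. }
    assert (NeC : RtoC e <> 0%C) by (apply RtoC_neq_0; lra).
    replace (RtoC (e * (INR (scaled_index u e) + 0)) + RtoC (e * (INR (scaled_index v e) + 1)))%C
      with (RtoC e * RtoC (INR (scaled_index u e) + INR (scaled_index v e) + 1))%C
      by (rewrite <- RtoC_plus, <- RtoC_mult; f_equal; ring).
    rewrite RtoC_div by lra. field. split; assumption. }
  destruct e1, e2.
  - apply Same.
  - apply Mixed.
  - apply ctends_ext with (2 := ctends_opp _ _ (Mixed Minus Plus)).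
    intros e. unfold hyp_kernel. ring.
  - apply Same.
Qed.
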